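(* Let $\Lambda$ be a non-zero measure on the space $\mathcal{H}$ of hyperplanes of $\mathbb{R}^\ell$ that is translation invariant, locally finite, and whose support has the property that there is no line in $\mathbb{R}^\ell$ to which all hyperplanes of the support are parallel. Let $W\subset\mathbb{R}^\ell$ be a window. Let $(U_n)_{n\ge1}$, $(V_n)_{n\ge1}$, $(G_n)_{n\ge1}$ be three independent sequences of i.i.d. random variables with $U_n\sim\mathrm{Uniform}[0,1)$, $V_n\sim\mathrm{Exponential}(1)$, $G_n\sim\widehat\Lambda_{[W]}$. Define random tessellations $\mathcal{Y}_n=\{C(\vec e):\vec e\in E_n\}$ of $W$, $n\ge 0$, recursively as follows. (0) $E_0=\{o\}$, $C(o)=W$, so $\mathcal{Y}_0=\{W\}$. (n+1) Given $\mathcal{Y}_n$, let $\Gamma_n=\sum_{C\in\mathcal{Y}_n}\Lambda_{[C]}$, a measure on $[W]$ of total mass $\zeta(\mathcal{Y}_n)=\sum_{C\in\mathcal{Y}_n}\Lambda([C])$, let $\widehat\Gamma_n=\zeta(\mathcal{Y}_n)^{-1}\Gamma_n$, and for $H\in[W]$ let $\xi_n(H)=\#\{C\in\mathcal{Y}_n: H\in[C]\}$, which is a version of the density $d\Gamma_n/d\Lambda_{[W]}$. Let $\Xi_n:[W]\to[W]$ be a bimeasurable map, depending only on $\Gamma_n$, with $\widehat\Lambda_{[W]}\circ\Xi_n^{-1}=\widehat\Gamma_n$ (with $\Xi_0$ the identity), and put $H_{n+1}=\Xi_n(G_{n+1})$, where the choice of $\Xi_n$ is such that $H_{n+1}$ is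 a random variable measurable with respect to $\sigma(\mathcal{Y}_n,G_{n+1})$; thus the conditional law of $H_{n+1}$ given $\mathcal{Y}_n$ is $\widehat\Gamma_n$. Partition $[0,1)$ into $\xi_n(H_{n+1})$ consecutive intervals $[a^n_{\vec e},b^n_{\vec e})$ of equal length $\xi_n(H_{n+1})^{-1}$, indexed by those $\vec e\in E_n$ with $H_{n+1}\in[C(\vec e)]$ and arranged according to the total order $\le$ on $\mathcal{E}^*$. Let $\vec e^{\,*}$ be the index with $U_{n+1}\in[a^n_{\vec e^{\,*}},b^n_{\vec e^{\,*}})$, put $C^*_n=C(\vec e^{\,*})$, $C(\vec e^{\,*}-)=C^*_n\cap H_{n+1}^-$, $C(\vec e^{\,*}+)=C^*_n\cap H_{n+1}^+$, $E_{n+1}=(E_n\setminus\{\vec e^{\,*}\})\cup\{\vec e^{\,*}-,\vec e^{\,*}+\}$ and $$\mathcal{Y}_{n+1}=(\mathcal{Y}_n\setminus\{C^*_n\})\cup\{C^*_n\cap H_{n+1}^-,\;C^*_n\cap H_{n+1}^+\}.$$ Put $\pi_n=\zeta(\mathcal{Y}_{n-1})^{-1}V_n$ for $n\ge1$, $\mathcal{S}_0=0$, $\mathcal{S}_n=\sum_{j=1}^n\pi_j$, and define $$(\widehat Y\wedge W)_t=\mathcal{Y}_n\quad\text{when } t\in[\mathcal{S}_n,\mathcal{S}_{n+1}),\ n\in\mathbb{N}=\{0,1,\dots\}.$$ Then the process $\widehat Y\wedge W=((\widehat Y\wedge W)_t:t\ge0)$ is the STIT process on $W$ associated to $\Lambda_{[W]}$;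 that is, it has the same law as the STIT tessellation process $Y\wedge W=((Y\wedge W)_t:t\ge 0)$.
   Context: Polytopes and tessellations. A polytope is the convex hull of a finite set in $\mathbb{R}^\ell$; a polytope with nonempty interior is called a window, or a cell. A tessellation of a window $W$ is a finite set of cells with pairwise disjoint interiors and union $W$. The set $\mathbb{T}\wedge W$ of tessellations of $W$ carries the $\sigma$-algebra $\mathcal{B}(\mathbb{T}\wedge W)$ generated by the sets $\{T:\partial T\cap A=\emptyset\}$, $A\subseteq W$ compact, where $\partial T=\bigcup_{C\in T}\partial C$. Hyperplanes. Let $\mathbb{S}_+^{\ell-1}$ be the upper half unit sphere of $\mathbb{R}^\ell$. Hyperplanes are written $H(\alpha,u)=\{x:\langle x,u\rangle=\alpha\}$ with $\alpha\in\mathbb{R}$, $u\in\mathbb{S}_+^{\ell-1}$, with closed half-spaces $H^-=\{x:\langle x,u\rangle\le\alpha\}$ and $H^+=\{x:\langle x,u\rangle\ge\alpha\}$. $\mathcal{H}$ is the set of all hyperplanes, with the $\sigma$-algebra induced from the Borel $\sigma$-algebra of the parameter space. For Borel $B\subseteq\mathbb{R}^\ell$, $[B]=\{H\in\mathcal{H}:H\cap B\ne\emptyset\}$. Locally finite means $\Lambda([B])<\infty$ for every bounded Borel $B$. For a cell or window $C$, $\Lambda_{[C]}$ is the restriction of $\Lambda$ to $[C]$, one has $0<\Lambda([C])<\infty$, and $\widehat\Lambda_{[C]}=\Lambda([C])^{-1}\Lambda_{[C]}$. Tree indices. $\mathcal{E}=\{-,+\}$; $\mathcal{E}^*=\bigcup_{k\ge0}\mathcal{E}^k$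 is the set of finite words over $\mathcal{E}$, with $\mathcal{E}^0=\{o\}$, $o$ the empty word. The successors of $\vec e$ are the words $\vec e-$ and $\vec e+$; $\mathrm{Pred}(\vec e)$ is the word of which $\vec e\ne o$ is a successor. $\mathcal{E}^*$ is totally ordered by $\le$: shorter words precede longer ones, and words of equal length are ordered lexicographically with $-<+$. STIT process. The STIT tessellation process $Y\wedge W$ on $W$ associated to $\Lambda_{[W]}$ is (in law) the following process. Let $(Z(\vec e):\vec e\in\mathcal{E}^* )$ and $(G'_n:n\ge1)$ be two independent families of independent random variables with $Z(\vec e)\sim\mathrm{Exponential}(1)$ and $G'_n\sim\widehat\Lambda_{[W]}$. Put $C'(o)=W$, $\kappa(o)=1$ and, going through $\mathcal{E}^*$ in increasing order, for $\vec e\neq o$ let $\kappa(\vec e)=\inf\{n: G'_n\in[C'(\vec e)],\ n>\max\{\kappa(\vec e\,'):\vec e\,'<\vec e\}\}$; for all $\vec e$ let $H'(\vec e)=G'_{\kappa(\vec e)}$, $C'(\vec e-)=C'(\vec e)\cap H'(\vec e)^-$, $C'(\vec e+)=C'(\vec e)\cap H'(\vec e)^+$. The lifetime of $C'(\vec e)$ is $t_l(\vec e)=\Lambda([C'(\vec e)])^{-1}Z(\vec e)$; its birth time is $t_b(o)=0$ and $t_b(\vec e)=t_b(\mathrm{Pred}(\vec e))+t_l(\mathrm{Pred}(\vec e))$ for $\vec e\ne o$. Then $(Y\wedge W)_t=\{C'(\vec e): t_b(\vec e)\le t<t_b(\vec e)+t_l(\vec e)\}$, $t\ge0$. All objects are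 well-defined almost surely (in particular the newly created sets are a.s. cells, and $\mathcal{S}_n\to\infty$ a.s.); null events may be ignored. ''Same law'' means equality of laws of stochastic processes with values in $(\mathbb{T}\wedge W,\mathcal{B}(\mathbb{T}\wedge W))$.
   Formalization: The choice of Ξ_n is required to be jointly measurable in the tessellation and the hyperplane, which is stronger than H_{n+1} being σ(Y_n,G_{n+1})-measurable; the latter alone does not give the conditional law of H_{n+1} on arbitrary probability spaces. *)

(* Defs.v *)
From HB Require Import structures.
From mathcomp Require Import all_boot all_order all_algebra.
From mathcomp Require Import all_classical all_reals all_analysis.

Set Implicit Arguments.
Unset Strict Implicit.
Unset Printing Implicit Defensive.

Import Order.TTheory GRing.Theory Num.Theory.
Import numFieldTopology.Exports numFieldNormedType.Exports.

Local Open Scope classical_set_scope.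
Local Open Scope ring_scope.

(* The dimension of the ambient space 'rV[R]_l.+1 is l.+1 >= 1.               *)

(** * Hyperplanes *)

Section Hyperplanes.
Context {R : realType} {l : nat}.
Implicit Types (x v : 'rV[R]_l.+1) (B : set 'rV[R]_l.+1).

(* The library norm on 'rV is the sup norm, so the Euclidean structure is     *)
(* given by this inner product.                                               *)
Definition dot x v : R := \sum_(i < l.+1) x ord0 i * v ord0 i.

(* Exactly one of u, - u belongs to the upper half sphere (the sign is that   *)
(* of the last nonzero coordinate), so that (alpha, u) |-> H(alpha, u) is a   *)
(* bijection onto the set of all hyperplanes.                                 *)
Definition upper_sphere : set 'rV[R]_l.+1 :=
  [set u | dot u u = 1 /\
           exists i, 0 < u ord0 i /\ forall j : 'I_l.+1, (i < j)%N -> u ord0 j = 0].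

Lemma upper_sphere_delta_max : delta_mx ord0 ord_max \in upper_sphere.
Proof.
rewrite inE; split.
  rewrite /dot (bigD1 ord_max)//= big1 ?addr0 => [|i /negPf i0].
    by rewrite !mxE !eqxx mulr1.
  by rewrite !mxE i0 andbF mulr0.
exists ord_max; split; first by rewrite mxE !eqxx ltr01.
by move=> j; rewrite ltnNge -ltnS ltn_ord.
Qed.

End Hyperplanes.

Definition half_sphere (R : realType) (l : nat) : Type :=
  set_type (@upper_sphere R l).

HB.instance Definition _ R l :=
  Topological.copy (half_sphere R l) (set_type (@upper_sphere R l)).
HB.instance Definition _ R l := isPointed.Build (half_sphere R l)
  (SigSub (@upper_sphere_delta_max R l)).

(* A hyperplane is given by its parameters (alpha, u), with the Borel         *)
(* sigma-algebra of the parameter space.                                      *)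
Definition hyperplane (R : realType) (l : nat) : Type :=
  g_sigma_algebraType (@open (R * half_sphere R l)%type).

HB.instance Definition _ R l := Measurable.copy (hyperplane R l)
  (g_sigma_algebraType (@open (R * half_sphere R l)%type)).

Section HyperplaneTheory.
Context {R : realType} {l : nat}.
Implicit Types (x v : 'rV[R]_l.+1) (B C W : set 'rV[R]_l.+1).
Implicit Types (h : hyperplane R l).

Definition offset h : R := h.1.
Definition normal h : 'rV[R]_l.+1 := \val (h.2 : set_type (@upper_sphere R l)).

Definition hpset h : set 'rV[R]_l.+1 := [set x | dot x (normal h) = offset h].

(* [false] and [true] stand for the letters - and +. *)
Definition half (b : bool) h : set 'rV[R]_l.+1 :=
  if b then [set x | offset h <= dot x (normal h)]
  else [set x | dot x (normal h) <= offset h].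

Definition hits B : set (hyperplane R l) := [set h | hpset h `&` B !=set0].

Definition translate x h : hyperplane R l := (offset h + dot x (normal h), h.2).

Lemma hpset_translate x h :
  hpset (translate x h) = [set y + x | y in hpset h].
Proof.
have dotD y z v : dot (y + z) v = dot y v + dot z v.
  by rewrite /dot -big_split; apply: eq_bigr => i _; rewrite mxE mulrDl.
apply/seteqP; split => y /=.
  rewrite /hpset /= => yx; exists (y - x); last by rewrite subrK.
  by apply: (addIr (dot x (normal h))); rewrite -dotD subrK.
by move=> [z zh <-]; rewrite /hpset /= dotD zh.
Qed.

Variable Lam : {measure set (hyperplane R l) -> \bar R}.

Definition translation_invariant : Prop :=
  forall x (A : set (hyperplane R l)), measurable A ->
    Lam (translate x @^-1` A) = Lam A.

(* For an arbitrary Borel set B, [hits B] need not belong to the Borel        *)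
(* sigma-algebra, and then Lam has no meaningful value at it. It is           *)
(* measurable for instance when B is a closed ball.                           *)
Definition locally_finite : Prop :=
  forall B, <<s @open 'rV[R]_l.+1 >> B -> bounded_set B ->
    measurable (hits B) -> (Lam (hits B) < +oo)%E.

Definition hyperplane_support : set (hyperplane R l) :=
  [set h | forall O : set (R * half_sphere R l),
             open O -> O h -> (0 < Lam O)%E].

Definition all_parallel_to_line (S : set (hyperplane R l)) v : Prop :=
  v != 0 /\ forall h, S h -> dot v (normal h) = 0.

Definition no_common_parallel_line : Prop :=
  ~ exists v, all_parallel_to_line hyperplane_support v.

End HyperplaneTheory.

(** * Polytopes and tessellations *)

Section Tessellations.
Context {R : realType} {l : nat}.
Implicit Types (C W : set 'rV[R]_l.+1) (T : set (set 'rV[R]_l.+1)).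

Definition conv_hull n (p : 'I_n -> 'rV[R]_l.+1) : set 'rV[R]_l.+1 :=
  [set x | exists c : 'I_n -> R,
     [/\ forall i, 0 <= c i, \sum_i c i = 1 & x = \sum_i c i *: p i]].

Definition polytope C : Prop :=
  exists n (p : 'I_n -> 'rV[R]_l.+1), C = conv_hull p.

Definition window C : Prop := polytope C /\ interior C !=set0.

Definition tessellation W T : Prop :=
  [/\ finite_set T, T `<=` window,
      trivIset T (@interior _) & \bigcup_(C in T) C = W].

Definition boundary C : set 'rV[R]_l.+1 := closure C `\` interior C.

Definition tess_boundary T : set 'rV[R]_l.+1 := \bigcup_(C in T) boundary C.

Definition tess_generator W : set (set (set (set 'rV[R]_l.+1))) :=
  [set [set T | tessellation W T /\ tess_boundary T `&` A = set0]
  | A in [set A | compact A /\ A `<=` W]].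

(* The carrier consists of all sets of sets of points. Taking A = set0 in     *)
(* [tess_generator] shows that the set of tessellations of W is measurable;   *)
(* the sigma-algebra induced on it is B(T /\ W).                              *)
Definition tess_space W := g_sigma_algebraType (tess_generator W).

(** * Laws of tessellation-valued processes *)

Definition tess_paths W : set (R -> set (set 'rV[R]_l.+1)) :=
  [set f | forall t, 0 <= t -> tessellation W (f t)].

(* Product sigma-algebra on the tessellation-valued paths; only times t >= 0  *)
(* are taken into account.                                                    *)
Definition path_events W : set (set (R -> set (set 'rV[R]_l.+1))) :=
  <<s tess_paths W,
      [set E | exists t (B : set (tess_space W)),
         [/\ 0 <= t, measurable B & E = tess_paths W `&` [set f | B (f t)]]] >>.

End Tessellations.

Section Probability.
Context {R : realType}.

(* E is the event F, up to a null set. *)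
Definition ae_event d (Om : measurableType d) (P : probability Om R)
    (F E : set Om) : Prop :=
  measurable E /\ P.-negligible (F `+` E).

(* The processes below are total functions which take arbitrary values on the *)
(* null event where the construction breaks down, so that the law of a        *)
(* process is defined through the completion of P.                            *)
Definition same_law l (W : set 'rV[R]_l.+1)
    d (Om : measurableType d) (P : probability Om R)
    (X : R -> Om -> set (set 'rV[R]_l.+1))
    d' (Om' : measurableType d') (P' : probability Om' R)
    (X' : R -> Om' -> set (set 'rV[R]_l.+1)) : Prop :=
  forall A, path_events W A -> exists E E',
    [/\ ae_event P [set w | A (X ^~ w)] E,
        ae_event P' [set w | A (X' ^~ w)] E' & P E = P' E'].

Definition has_law d (Om : measurableType d) (P : probability Om R)
    d' (T : measurableType d') (X : {RV P >-> T}) (mu : set T -> \bar R) : Prop :=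
  forall A, measurable A -> distribution P X A = mu A.

Definition events_of d (Om : measurableType d) (P : probability Om R)
    d' (T : measurableType d') (X : {RV P >-> T}) : set (set Om) :=
  preimage_set_system setT X measurable.

Definition mutually_independent d (Om : measurableType d)
    (P : probability Om R) (I : eqType) (F : I -> set (set Om)) : Prop :=
  forall (s : seq I) (A : I -> set Om), uniq s ->
    (forall i, i \in s -> F i (A i)) ->
    P (\bigcap_(i in [set` s]) A i) = (\prod_(i <- s) P (A i))%E.

Definition normalize T (mu : set T -> \bar R) : set T -> \bar R :=
  fun A => (((fine (mu setT))^-1)%:E * mu A)%E.

End Probability.

(** * Measures attached to cells and tessellations *)

Section Intensity.
Context {R : realType} {l : nat}.
Variable Lam : {measure set (hyperplane R l) -> \bar R}.
Implicit Types (C W : set 'rV[R]_l.+1) (T : set (set 'rV[R]_l.+1)).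

Definition Lam_on C : set (hyperplane R l) -> \bar R :=
  fun A => Lam (A `&` hits C).

Definition Gam T : set (hyperplane R l) -> \bar R :=
  fun A => (\sum_(C \in T) Lam_on C A)%E.

Definition zeta T : R := fine (\sum_(C \in T) Lam (hits C))%E.

(* xi is a bimeasurable self-map of [hits W] that transports the normalization *)
(* of [Lam_on W] to the normalization of G.                                   *)
Definition transports W (G : set (hyperplane R l) -> \bar R)
    (xi : hyperplane R l -> hyperplane R l) : Prop :=
  [/\ forall h, hits W h -> hits W (xi h),
      measurable_fun (hits W) xi,
      forall A, measurable A -> A `<=` hits W -> measurable (xi @` A) &
      forall A, measurable A ->
        normalize (Lam_on W) (xi @^-1` A) = normalize G A].

End Intensity.

(** * Tree indices *)

(* Words over {-, +} are stored with their last letter first: the successors  *)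
(* of e are [false :: e] and [true :: e], and Pred e is [behead e].           *)
Definition word := seq bool.

Definition word_le (e f : word) : bool :=
  (size e < size f)%N ||
  ((size e == size f) && ((rev e : seqlexi bool) <= (rev f : seqlexi bool))%O).

Definition word_lt (e f : word) : bool := (e != f) && word_le e f.

(** * The STIT process *)

Section Stit.
Context {R : realType} {l : nat}.
Variables (Lam : {measure set (hyperplane R l) -> \bar R}).
Variable W : set 'rV[R]_l.+1.
Variables (z : word -> R) (g : nat -> hyperplane R l).

Fixpoint stit_cell_of (k : word -> nat) (e : word) : set 'rV[R]_l.+1 :=
  if e is b :: e' then stit_cell_of k e' `&` half b (g (k e')) else W.

Definition is_stit_index (k : word -> nat) : Prop :=
  k [::] = 1%N /\
  forall e, e != [::] ->
    let S := [set n | hits (stit_cell_of k e) (g n) /\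
                      forall e', word_lt e' e -> (k e' < n)%N] in
    S (k e) /\ forall n, S n -> (k e <= n)%N.

(* By induction along the order of words there is at most one such index      *)
(* function; it is a.s. that there is one.                                    *)
Definition stit_index : word -> nat :=
  xget (fun=> 0%N) [set k | is_stit_index k].

Definition stit_cell (e : word) : set 'rV[R]_l.+1 := stit_cell_of stit_index e.

Definition lifetime (e : word) : R := (fine (Lam (hits (stit_cell e))))^-1 * z e.

Fixpoint birth (e : word) : R :=
  if e is _ :: e' then birth e' + lifetime e' else 0.

Definition stit (t : R) : set (set 'rV[R]_l.+1) :=
  [set stit_cell e | e in [set e | birth e <= t < birth e + lifetime e]].

End Stit.

(** * The construction from the global sequences *)

Section Construction.
Context {R : realType} {l : nat}.
Variables (Lam : {measure set (hyperplane R l) -> \bar R}).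
Variable W : set 'rV[R]_l.+1.
Variable Xi :
  nat -> (set (hyperplane R l) -> \bar R) -> hyperplane R l -> hyperplane R l.
(* Only the indices n >= 1 of these sequences are used. *)
Variables (u v : nat -> R) (g : nat -> hyperplane R l).

(* The index set E_n together with the cells C(e). *)
Definition state : Type := (seq word * (word -> set 'rV[R]_l.+1))%type.

Definition cells (s : state) : set (set 'rV[R]_l.+1) :=
  [set s.2 e | e in [set` s.1]].

(* The indices of the cells hit by h, in increasing order; there are          *)
(* xi_n(h) of them.                                                           *)
Definition hit_words (s : state) (h : hyperplane R l) : seq word :=
  sort word_le [seq e <- s.1 | `[< hits (s.2 e) h >]].

Definition in_slot (L : seq word) (x : R) (e : word) : bool :=
  (index e L)%:R / (size L)%:R <= x < (index e L).+1%:R / (size L)%:R.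

Definition split_cell (s : state) (e : word) (h : hyperplane R l) : state :=
  ([:: false :: e, true :: e & rem e s.1],
   fun f => if f == false :: e then s.2 e `&` half false h
            else if f == true :: e then s.2 e `&` half true h
            else s.2 f).

Definition step (s : state) (h : hyperplane R l) (x : R) : state :=
  let L := hit_words s h in
  if [seq e <- L | in_slot L x e] is e :: _ then split_cell s e h else s.

Fixpoint split_state (n : nat) : state :=
  if n is m.+1 then
    let s := split_state m in step s (Xi m (Gam Lam (cells s)) (g n)) (u n)
  else ([:: [::]], fun=> W).

Definition split_tess (n : nat) : set (set 'rV[R]_l.+1) :=
  cells (split_state n).

Definition waiting (n : nat) : R := (zeta Lam (split_tess n.-1))^-1 * v n.

Definition jump_time (n : nat) : R := \sum_(1 <= j < n.+1) waiting j.

(* The union is over the (a.s. unique) n such that t \in [S_n, S_(n+1)). *)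
Definition split_process (t : R) : set (set 'rV[R]_l.+1) :=
  \bigcup_(n in [set n | jump_time n <= t < jump_time n.+1]) split_tess n.

End Construction.

Section DrivingEvents.
Context {R : realType} d (Om : measurableType d) (P : probability Om R).
Context d' (T : measurableType d').

Definition UVG_events (U V : nat -> {RV P >-> R}) (G : nat -> {RV P >-> T})
    (i : nat + nat + nat) : set (set Om) :=
  match i with
  | inl (inl n) => events_of (U n.+1)
  | inl (inr n) => events_of (V n.+1)
  | inr n => events_of (G n.+1)
  end.

Definition ZG_events (Z : word -> {RV P >-> R}) (G : nat -> {RV P >-> T})
    (i : word + nat) : set (set Om) :=
  match i with
  | inl e => events_of (Z e)
  | inr n => events_of (G n.+1)
  end.

End DrivingEvents.

(* Main.v *)
(* Both processes are functions of the same kind of sequence: the successive  *)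
(* split words, splitting hyperplanes and waiting times. In both cases, given *)
(* the first n splits, with cells C(e) and zeta = sum_e Lam [C(e)], the next  *)
(* split is that of C(u), by a hyperplane of A, after a waiting time > s,     *)
(* with conditional probability Lam (A /\ [C(u)]) zeta^-1 exp (- s zeta), so  *)
(* that the two sequences, hence the two processes, have the same law.        *)
(*                                                                            *)
(* For the construction from the global sequences, the choice by the uniform  *)
(* variable among the xi_n(H) cells hit by H turns the density xi_n into the  *)
(* indicator of [C(u)]. For the STIT process, the hyperplane of C(e) is the   *)
(* first of an i.i.d. sequence to hit C(e), hence distributed as the          *)
(* normalization of Lam on [C(e)], also conditionally on the hyperplanes of   *)
(* all words that do not descend from e; and the exponential lifetimes are    *)
(* memoryless. The split times tend to infinity because zeta(Y_n) is at most  *)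
(* (n + 1) Lam [W], which makes E exp (- S_n) tend to 0.                      *)

Require Import Defs.
From HB Require Import structures.
From mathcomp Require Import all_boot all_order all_algebra.
From mathcomp Require Import all_classical all_reals all_analysis.
From mathcomp Require Import measurable_realfun lebesgue_measure lebesgue_integral probability.
From mathcomp Require Import finmap ring lra zify.
Set Implicit Arguments.
Unset Strict Implicit.
Unset Printing Implicit Defensive.

Import Order.TTheory GRing.Theory Num.Theory.
Import numFieldTopology.Exports numFieldNormedType.Exports.

Local Notation half := Defs.half.

Local Open Scope classical_set_scope.
Local Open Scope ring_scope.

(** * Conditioning and independence *)

(** Either process is a function of a path, the sequence of its splits, each recorded by the word of
    the split cell, the splitting hyperplane and the waiting time since the previous split
    ([path_space], [path_process]). It suffices that the two random paths have the same law
    ([same_law_paths]). The property [split_chain] prescribes, given the first n splits, the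
    conditional probability [kern] that the next split is of C(u), by a hyperplane of A, after a
    waiting time > s: Lam (A /\ [C(u)]) exp (- s zeta) / zeta, where zeta is the sum of Lam [C(e)]
    over the present cells. These kernels determine the law ([split_chain_unique]), so both paths
    have to be shown to satisfy [split_chain].

    For the construction from the global sequences, integrating out G(n+1) gives a hyperplane
    distributed as the normalization of Gamma_n ([split_G_step]). On the hyperplanes that hit
    exactly the cells of a list L, Gamma_n is |L| times Lam ([sum_hit_cells]), while the uniform
    variable selects a given cell of L with probability 1 / |L| ([uniform_slot]). The two factors
    cancel in [split_kernel], and the exponential variable gives exp (- s zeta).

    For the STIT process, the hyperplane of a word e is the first one after a stopping time to hit
    C(e); given the clocks and the hyperplanes of earlier words it is distributed as the
    normalization of Lam on [C(e)] ([split_law]), and this remains true given the hyperplanes of all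
    words that do not descend from e ([split_law_aside]). With the order of the splits prescribed,
    this and the memorylessness of the clocks yield the kernel ([split_times_kernel]). The true
    order is the order of death times, and [stit_chain] sums over the countably many possible
    beginnings of it.

    Null events are controlled by two facts on Lam. Almost no hyperplane touches a compact set
    without cutting it ([touch_null]), so that parts of windows are windows; and a set with interior
    is hit with positive measure ([hits_gt0]), so that every cell is eventually split. That the
    split times tend to infinity is proved for the global construction ([split_no_explosion]) and
    passes to the STIT process by the equality of laws. *)

Section sub_sigma_algebras.
Context d (T : measurableType d).
Implicit Types G : set (set T).

Lemma gen_sub_measurable G : G `<=` measurable ->
  forall A, <<s G >> A -> measurable A.
Proof. by move=> GM; apply: smallest_sub => //; exact: sigma_algebra_measurable. Qed.

Lemma gen_mono G G' : G `<=` G' -> forall A : set T, <<s G >> A -> <<s G' >> A.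
Proof. by move=> GG'; exact: sub_smallest2r. Qed.

Lemma gen_le_gen G G' : G `<=` <<s G' >> -> forall A : set T, <<s G >> A -> <<s G' >> A.
Proof. by move=> GG'; apply: smallest_sub => //; exact: smallest_sigma_algebra. Qed.

Lemma measurable_fun_gen_le G G' d' (Y : measurableType d') (f : T -> Y) :
  G `<=` <<s G' >> ->
  measurable_fun setT (f : g_sigma_algebraType G -> Y) ->
  measurable_fun setT (f : g_sigma_algebraType G' -> Y).
Proof.
move=> GG' mf _ B mB; have := mf measurableT _ mB; rewrite !setTI.
exact: gen_le_gen.
Qed.

Lemma measurable_fun_gen G d' (Y : measurableType d') (f : T -> Y) :
  G `<=` measurable ->
  measurable_fun setT (f : g_sigma_algebraType G -> Y) -> measurable_fun setT f.
Proof.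
move=> GM mf _ B mB; have := mf measurableT _ mB; rewrite !setTI.
exact: gen_sub_measurable.
Qed.

(** Read as a map into the coarser sigma-algebra, the identity pushes a measure forward to its
    restriction; integrals are moved to and from a sub-sigma-algebra in this way. *)
Lemma measurable_id_gen  G : G `<=` measurable ->
  measurable_fun setT (id : T -> g_sigma_algebraType G).
Proof. by move=> GM _ B mB; rewrite setTI; exact: gen_sub_measurable mB. Qed.

End sub_sigma_algebras.

Section freezing.
Context d (T : measurableType d) (R : realType) (P : probability T R).
Context d' (Y : measurableType d') (nu : probability Y R).
Variables (G : set (set T)) (y : T -> Y).
Hypothesis GM : G `<=` measurable.
Hypothesis my : measurable_fun setT y.
Hypothesis indep : forall A B, <<s G >> A -> measurable B ->
  P (A `&` y @^-1` B) = (P A * nu B)%E.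
Local Open Scope ereal_scope.

(** Freezing: by independence, the identity (read modulo [G]) and [y] have the product law as joint
    law, and Tonelli's theorem applies. Integrations over a fresh driving variable rest on this
    formula. *)
Lemma indep_integral (f : g_sigma_algebraType G * Y -> \bar R) :
  measurable_fun setT f -> (forall z, 0 <= f z) ->
  \int[P]_w f (w, y w) = \int[P]_w \int[nu]_v f (w, v).
Proof.
move=> mf f0.
pose iG := (id : T -> g_sigma_algebraType G).
have miG : measurable_fun setT iG by exact: measurable_id_gen.
pose phi := fun w => (iG w, y w).
have mphi : measurable_fun setT phi by exact: measurable_fun_pair.
pose iGm : {mfun T >-> g_sigma_algebraType G} := HB.pack iG (isMeasurableFun.Build _ _ _ _ _ miG).
pose phim : {mfun T >-> (g_sigma_algebraType G * Y)%type} := HB.pack phi (isMeasurableFun.Build _ _ _ _ _ mphi).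
pose P1 : probability (g_sigma_algebraType G) R := distribution P iGm.
pose P2 : probability (g_sigma_algebraType G * Y)%type R := distribution P phim.
have E X : measurable X -> (P1 \x nu) X = P2 X.
  apply: product_measure_unique => A B mA mB /=.
  rewrite /pushforward -indep//.
transitivity (\int[P2]_z f z).
  by rewrite [RHS]ge0_integral_pushforward.
transitivity (\int[P1 \x nu]_z f z).
  by apply: eq_measure_integral => A mA _; rewrite /= -E.
rewrite fubini_tonelli1//.
rewrite [LHS]ge0_integral_pushforward//.
  exact: measurable_fun_fubini_tonelli_F.
by move=> x _; exact: integral_ge0.
Qed.

End freezing.

Section pi_systems.
Context d (T : measurableType d) (R : realType).
Local Open Scope ereal_scope.

Lemma measure_eq_gen (G : set (set T)) (m1 m2 : {measure set T -> \bar R}) :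
  G `<=` measurable -> setI_closed G -> G setT ->
  (forall A, G A -> m1 A = m2 A) -> m1 setT < +oo ->
  forall A, <<s G >> A -> m1 A = m2 A.
Proof.
move=> GM GI GT m12 fin; apply: (g_sigma_algebra_measure_unique G GM (fun=> setT)) => //.
by rewrite bigcup_const.
Qed.

Lemma integral_gen (G : set (set T)) (GM : G `<=` measurable) (m : {measure set T -> \bar R})
    (miG : measurable_fun setT (id : T -> g_sigma_algebraType G))
    (D : set T) (f : T -> \bar R) :
  measurable_fun setT (f : g_sigma_algebraType G -> \bar R) ->
  (forall x, 0 <= f x) -> <<s G >> D ->
  \int[pushforward m (id : T -> g_sigma_algebraType G)]_(x in D) (f : g_sigma_algebraType G -> \bar R) x
  = \int[m]_(x in D) f x.
Proof.
move=> mf f0 GD; rewrite ge0_integral_pushforward//.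
exact: (measurable_funS (measurableT : measurable (setT : set (g_sigma_algebraType G)))).
Qed.

Lemma measure_eq_gen_integral (G : set (set T)) (m1 m2 : {measure set T -> \bar R})
    (D : set T) (f : T -> \bar R) :
  G `<=` measurable -> (forall A, <<s G >> A -> m1 A = m2 A) ->
  measurable_fun setT (f : g_sigma_algebraType G -> \bar R) ->
  (forall x, 0 <= f x) -> <<s G >> D ->
  \int[m1]_(x in D) f x = \int[m2]_(x in D) f x.
Proof.
move=> GM m12 mf f0 GD; have miG := measurable_id_gen GM.
rewrite -(integral_gen GM m1 miG)// -(integral_gen GM m2 miG)//.
by apply: eq_measure_integral => A mA _; rewrite /pushforward/= m12.
Qed.

Import HBNNSimple.

(** The hypothesis on [nu] is the case of indicators; linearity gives simple functions, monotone
    convergence the rest. Finiteness of [g] lets the products pass to the limit. *)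
Lemma integral_density (mu nu : {measure set T -> \bar R}) (g f : T -> \bar R) E :
  measurable_fun setT g -> (forall x, 0 <= g x) -> (forall x, g x \is a fin_num) ->
  (forall A, measurable A -> nu A = \int[mu]_(x in A) g x) ->
  (forall x, 0 <= f x) -> measurable E -> measurable_fun E f ->
  \int[nu]_(x in E) f x = \int[mu]_(x in E) (f x * g x).
Proof.
move=> mg g0 gfin nuE f0 mE mf; apply/esym.
pose h := nnsfun_approx mE mf.
have -> : \int[nu]_(x in E) f x =
    lim (\int[nu]_(x in E) (EFin \o h n) x @[n --> \oo]).
  have fE x : E x -> f x = lim ((EFin \o h n) x @[n --> \oo]).
    by move=> Ex; apply/esym/cvg_lim => //; exact: cvg_nnsfun_approx.
  under eq_integral => x /set_mem /fE -> //.
  apply: monotone_convergence => //.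
  - move=> n; apply/measurable_EFinP.
    by apply: (measurable_funS measurableT) => //; exact/measurable_funP.
  - by move=> n x Ex //=; rewrite lee_fin.
  - by move=> x Ex a b ab; rewrite lee_fin; exact/lefP/nd_nnsfun_approx.
have -> : \int[mu]_(x in E) (f \* g) x =
    lim (\int[mu]_(x in E) ((EFin \o h n) \* g) x @[n --> \oo]).
  have fg x : E x -> f x * g x = lim (((EFin \o h n) \* g) x @[n --> \oo]).
    by move=> Ex; apply/esym/cvg_lim => //; apply: cvgeZr => //; exact: cvg_nnsfun_approx.
  under eq_integral => x /set_mem /fg -> //.
  apply: monotone_convergence => [//| | |].
  - move=> n; apply/emeasurable_funM; apply/measurable_funTS => //.
    exact/measurable_EFinP.
  - by move=> n x Ex /=; rewrite mule_ge0 ?lee_fin.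
  - by move=> x Ex a b ab/=; rewrite lee_wpmul2r ?lee_fin//; exact/lefP/nd_nnsfun_approx.
suff suf n : \int[mu]_(x in E) ((EFin \o h n) x * g x) =
    \int[nu]_(x in E) (EFin \o h n) x.
  by under eq_fun do rewrite suf.
transitivity (\int[nu]_(x in E)
   (\sum_(y \in range (h n)) (y * \1_(h n @^-1` [set y]) x)%:E)); last first.
  by apply: eq_integral => t tE; rewrite /= fimfunE -fsumEFin.
have indich m r : measurable_fun E (fun x => (r * \1_(h m @^-1` [set r]) x)%:E).
  by apply: (measurable_comp measurableT) => //; exact: measurable_funM.
rewrite ge0_integral_fsum//; last by move=> m y Ey; exact: nnfun_muleindic_ge0.
transitivity (\int[mu]_(x in E) (\sum_(y \in range (h n))
    (y * \1_(h n @^-1` [set y]) x)%:E * g x)).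
  under [RHS]eq_integral => x xE.
    rewrite -ge0_mule_fsuml => [|y]; last exact: nnfun_muleindic_ge0.
    rewrite fsumEFin // -(fimfunE _ x); over.
  by [].
rewrite ge0_integral_fsum//; last 2 first.
  - by move=> y; apply: emeasurable_funM => //; exact: measurable_funTS.
  - by move=> m y Ey; rewrite mule_ge0// nnfun_muleindic_ge0.
apply: eq_fsbigr => r rhn.
under [RHS]eq_integral do rewrite EFinM.
rewrite integralZl_indic_nnsfun => //.
under eq_integral do rewrite EFinM -muleA.
rewrite ge0_integralZl//.
- under eq_integral do rewrite muleC.
  rewrite (eq_integral (g \_ (h n @^-1` [set r]))); last first.
    by move=> x xE; rewrite epatch_indic.
  by rewrite -integral_mkcondr -nuE// integral_indic// setIC.
- apply: emeasurable_funM; first exact/measurable_EFinP.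
  exact/measurable_funTS.
- by move=> t Et; rewrite mule_ge0// lee_fin.
- by move: rhn => /set_mem[t _ <-]; rewrite lee_fin.
Qed.

End pi_systems.

Section conditional.
Context d (T : measurableType d) (R : realType) (P : probability T R).
Variable G : set (set T).
Hypothesis GM : G `<=` measurable.
Local Open Scope ereal_scope.

(* The hypothesis says that [q] is the conditional probability of [B] given   *)
(* the sigma-algebra generated by [G].                                        *)
Lemma conditional_integral (B : set T) (q : T -> \bar R) (D : set T) (f : T -> \bar R) :
  measurable B ->
  measurable_fun setT (q : g_sigma_algebraType G -> \bar R) ->
  (forall x, 0 <= q x) -> (forall x, q x \is a fin_num) ->
  (forall K, <<s G >> K -> P (K `&` B) = \int[P]_(x in K) q x) ->
  measurable_fun setT (f : g_sigma_algebraType G -> \bar R) -> (forall x, 0 <= f x) ->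
  <<s G >> D ->
  \int[P]_(x in D `&` B) f x = \int[P]_(x in D) (f x * q x).
Proof.
move=> mB mq q0 qfin H mf f0 GD.
have mD := gen_sub_measurable GM GD.
have mf' := measurable_fun_gen GM mf.
have mq' := measurable_fun_gen GM mq.
have miG := measurable_id_gen GM.
pose iG := (id : T -> g_sigma_algebraType G).
pose iGm : {mfun T >-> g_sigma_algebraType G} := HB.pack iG (isMeasurableFun.Build _ _ _ _ _ miG).
have E : \int[mrestr P mB]_(x in D) f x = \int[P]_(x in D) (f x * (\1_B x)%:E).
  apply: integral_density => //.
  - exact/measurable_EFinP.
  - move=> A mA; rewrite /mrestr /=.
    by rewrite integral_indic// setIC.
  - exact: measurable_funTS.
have {E}-> : \int[P]_(x in D `&` B) f x = \int[mrestr P mB]_(x in D) f x.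
  rewrite E integral_mkcondr; apply: eq_integral => x _.
  by rewrite patchE indicE; case: ifPn => _; rewrite ?mule1 ?mule0.
have mfq : measurable_fun setT ((fun x => f x * q x) : g_sigma_algebraType G -> \bar R).
  exact: emeasurable_funM.
rewrite -(integral_gen GM P miG (f:=fun x => f x * q x))//; last first.
  by move=> x; exact: mule_ge0.
rewrite -(integral_gen GM (mrestr P mB) miG)//.
apply: (@integral_density _ (g_sigma_algebraType G) R (pushforward P iGm) (pushforward (mrestr P mB) iGm)) => //.
- move=> A mA; rewrite (integral_gen GM P miG)//.
  by rewrite /= -H.
- exact: (measurable_funS (measurableT : measurable (setT : set (g_sigma_algebraType G)))).
Qed.

End conditional.

Section independence.
Context d (T : measurableType d) (R : realType) (P : probability T R).
Variables (I : choiceType) (F : I -> set (set T)).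
Hypothesis Fm : forall i, F i `<=` measurable.
Hypothesis FT : forall i, F i setT.
Hypothesis FI : forall i, setI_closed (F i).
Hypothesis ind : mutually_independent P F.
Local Open Scope ereal_scope.

Definition join_events (J : set I) : set (set T) := \bigcup_(i in J) F i.

Lemma join_events_measurable J : join_events J `<=` measurable.
Proof. by move=> A [i _]; exact: Fm. Qed.

Lemma join_events_mono J J' : J `<=` J' -> join_events J `<=` join_events J'.
Proof. by move=> JJ' A [i /JJ' J'i FA]; exists i. Qed.

Let inter_events (J : set I) : set (set T) :=
  [set A | exists s a, [/\ uniq s, forall i, i \in s -> J i /\ F i (a i)
     & A = \bigcap_(i in [set` s]) a i]].

(** Finite intersections of events of the families in [J] form a pi-system, on which mutual
    independence gives the product formula. For fixed [B] both sides are finite measures in [A], so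
    the formula extends to the generated sigma-algebra. *)
Lemma indep_join_events (j : I) (J : set I) : ~ J j ->
  forall A B, <<s join_events J >> A -> F j B -> P (A `&` B) = P A * P B.
Proof.
move=> Jj A B GA FB; have mB := Fm FB.
pose G := inter_events J.
have GM : G `<=` measurable.
  move=> _ [s [a [us sa ->]]]; rewrite bigcap_seq.
  rewrite big_seq; apply: bigsetI_measurable => i si.
  by have [_ /Fm] := sa i si.
have GI : setI_closed G.
  move=> _ _ [s1 [a1 [u1 h1 ->]]] [s2 [a2 [u2 h2 ->]]].
  (* The two families of events are merged on the union of their index lists, with [setT] where an
     index is absent. *)
  exists (undup (s1 ++ s2)), (fun i => (if i \in s1 then a1 i else setT) `&`
     (if i \in s2 then a2 i else setT)); split; first exact: undup_uniq.
    move=> i; rewrite mem_undup mem_cat => ii; split.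
      by case/orP : ii => [/h1[]|/h2[]].
    by apply: FI; case: ifP => // si; [have [] := h1 _ si|have [] := h2 _ si].
  apply/seteqP; split => t /=.
    by move=> [t1 t2] i /= _; split; case: ifP => // si; do [exact: t1|exact: t2].
  move=> h; split => i /= si; have /= := h i; rewrite mem_undup mem_cat si ?orbT => /(_ isT) [].
    by [].
  by [].
have GT : G setT.
  exists [::], (fun=> setT); split => //.
  by apply/esym; rewrite -subTset => t _ i.
have GA' : <<s G >> A.
  move: A GA; apply: gen_le_gen => A [i Ji FA]; apply: sub_sigma_algebra.
  exists [:: i], (fun=> A); split => // [k|]; first by rewrite inE => /eqP ->.
  apply/seteqP; split => [t At k //|t /(_ i)]; apply.
  by rewrite /= inE.
have PB : (fine (P B))%:E = P B by rewrite fineK// fin_num_measure.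
have PB0 : (0 <= fine (P B))%R by apply: fine_ge0.
have E : mrestr P mB A = mscale (NngNum PB0) P A; last first.
  move: E; rewrite /mrestr /mscale /= => ->; set pB := (X in X * _); have -> : pB = P B by exact: PB.
  by rewrite muleC.
move: A GA' {GA}; apply: (measure_eq_gen GM GI GT).
- move=> _ [s [a [us sa ->]]].
  change (P (\bigcap_(i in [set` s]) a i `&` B) =
    (fine (P B))%:E * P (\bigcap_(i in [set` s]) a i)).
  rewrite PB.
  have js : j \notin s by apply/negP => /sa[].
  have /= := @ind (j :: s) (fun i => if i == j then B else a i).
  rewrite js us => /(_ isT); rewrite big_cons eqxx.
  rewrite (eq_big_seq (fun i => P (a i))); last first.
    by move=> i si; case: eqP => // ij; rewrite -ij si in js.
  have := @ind s a us (fun i si => (sa i si).2) => <- <-; last first.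
    by move=> i; rewrite inE; case: eqP => [-> //|_ /= /sa[]].
  congr (P _); apply/seteqP; split => t /=.
    move=> [h Bt] i; rewrite /= inE; case: eqP => //= _ si; exact: h.
  move=> h; split; last by have := h j; rewrite /= inE eqxx; exact.
  move=> i /= si; have := h i; rewrite /= inE si orbT => /(_ isT).
  by case: eqP => // ij; rewrite -ij si in js.
- by rewrite ltey_eq fin_num_measure.
Qed.

End independence.

(** * Integrals against the exponential law *)

Section exponential_integrals.
Context (R : realType).
Local Open Scope ereal_scope.
Notation leb := (@lebesgue_measure R).

Lemma integral_exp_tail (c a : R) : (0 < c)%R ->
  \int[leb]_(x in `[a, +oo[) (c * expR (- c * x))%:E = (expR (- c * a))%:E.
Proof.
move=> c0.
have cexp : continuous (fun z : R^o => expR (- c * z)).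
  move=> z; apply: continuous_comp; last exact: continuous_expR.
  by apply: continuousM => //; apply: (@continuousN _ R^o); exact: cst_continuous.
rewrite (@ge0_continuous_FTC2y _ _ (fun x => - (expR (- c * x)))%R _ 0)//.
- by rewrite EFinN oppeK add0e.
- by move=> x _; rewrite mulr_ge0 ?expR_ge0// ltW.
- apply: continuous_subspaceT => x.
  apply: (@continuousM _ R^o (fun=> c) (fun x => expR (- c * x))).
    exact: cst_continuous.
  exact: cexp.
- rewrite -oppr0; apply: cvgN.
  rewrite (_ : (fun x => expR (- c * x)) =
               (fun z => expR (- z)) \o (fun z => c * z)%R); last first.
    by apply: eq_fun => x; rewrite mulNr.
  apply: (@cvg_comp _ _ _ _ _ _ (pinfty_nbhs R)); last exact: cvgr_expR.
  exact: gt0_cvgMry.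
- by apply: cvgN; apply/cvg_at_right_filter; exact: cexp.
- move=> z _.
  rewrite derive1_comp// derive1N// derive1_id mulN1r derive1_comp// derive1E.
  have /funeqP -> := @derive_expR R.
  by rewrite derive1Ml// derive1_id mulr1 mulrN opprK mulrC.
Qed.

Let idR : measurableTypeR R -> R := id.

Let midR : measurable_fun setT idR.
Proof. by move=> _ B mB; rewrite setTI. Qed.

(* The canonical measurable structures of [R] and of [measurableTypeR R],     *)
(* which carries [lebesgue_measure], have the same measurable sets but        *)
(* different displays.                                                        *)
Let lebR : {measure set R -> \bar R} :=
  @measure_function_pushforward__canonical__measure_function_Measure
    _ _ _ _ _ leb idR midR.

Let integral_lebR (D : set R) (f : R -> \bar R) : measurable D ->
  measurable_fun D f -> (forall x, 0 <= f x) ->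
  \int[lebR]_(x in D) f x = \int[leb]_(x in D) f x.
Proof. by move=> mD mf f0; rewrite ge0_integral_pushforward. Qed.

Variable nu : {measure set R -> \bar R}.
Hypothesis nuE : forall A, measurable A -> nu A = exponential_prob 1 A.

(** With b = 0 this is the survival function. A positive b arises when other clocks, integrated out
    first, leave a factor that is exponential in the remaining clock. *)
Lemma exponential_tail_integral (a b : R) : (0 <= a)%R -> (0 <= b)%R ->
  \int[nu]_z ((a < z)%R%:R * expR (- b * z))%:E =
  (expR (- (1 + b) * a) / (1 + b))%:E.
Proof.
move=> a0 b0.
have b10 : (0 < 1 + b)%R by lra.
have mexp (k : R) : measurable_fun setT (fun z : R => expR (k * z)).
  apply: measurableT_comp => //; exact: measurable_funM.
have mind : measurable_fun setT (fun z : R => ((a < z)%R%:R : R)).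
  rewrite (_ : (fun x : R => _) = \1_(`]a, +oo[%classic)); first exact: measurable_indic.
  by apply/funext => x; rewrite indicE mem_setE in_itv/= andbT.
have mpdf : measurable_fun setT (fun x : R => (exponential_pdf 1 x)%:E).
  by apply/measurable_EFinP; exact: measurable_exponential_pdf.
rewrite (@integral_density _ _ _ lebR _ (fun x => (exponential_pdf 1 x)%:E))//; last 3 first.
- by move=> x; rewrite lee_fin exponential_pdf_ge0.
- move=> A mA; rewrite nuE// integral_lebR//; first exact: measurable_funTS.
  by move=> x; rewrite lee_fin exponential_pdf_ge0.
- by apply/measurable_EFinP; exact: measurable_funM.
rewrite integral_lebR//; last 2 first.
- by apply: emeasurable_funM => //; apply/measurable_EFinP; exact: measurable_funM.
- by move=> x; rewrite -EFinM lee_fin !mulr_ge0 ?expR_ge0 ?exponential_pdf_ge0.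
transitivity (\int[leb]_(x in `]a, +oo[) (((1 + b)^-1)%:E * ((1 + b) * expR (- (1 + b) * x))%:E)).
  rewrite [RHS]integral_mkcond; apply: eq_integral => x _.
  rewrite patchE mem_setE in_itv/= andbT; case: ltP => ax; last by rewrite /= mul0r mul0e.
  rewrite exponential_pdfE; last by rewrite (le_trans a0)// ltW.
  rewrite !mul1r -!EFinM mulKf ?gt_eqF// -expRD; congr (expR _)%:E; ring.
rewrite integral_itv_obnd_cbnd; last first.
  apply/measurable_EFinP/measurable_funTS; apply: measurable_funM => //; exact: measurable_funM.
rewrite ge0_integralZl//; last 3 first.
- apply/measurable_EFinP/measurable_funTS; apply: measurable_funM => //.
  exact: mexp.
- by move=> x _; rewrite lee_fin mulr_ge0 ?expR_ge0 ?ltW.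
- by rewrite lee_fin invr_ge0 ltW.
by rewrite integral_exp_tail// -EFinM mulrC.
Qed.

Lemma exponential_tail (a : R) : (0 <= a)%R ->
  \int[nu]_z ((a < z)%R%:R)%:E = (expR (- a))%:E.
Proof.
move=> a0; have := @exponential_tail_integral a 0 a0 (lexx _).
rewrite addr0 divr1 mulN1r => <-; apply: eq_integral => x _.
by rewrite oppr0 mul0r expR0 mulr1.
Qed.

End exponential_integrals.

(** * Polytopes and hyperplanes *)

Section inner_product.
Context {R : realType} {l : nat}.
Implicit Types (x y u v : 'rV[R]_l.+1).

Lemma dotDl x y u : dot (x + y) u = dot x u + dot y u.
Proof. by rewrite /dot -big_split; apply: eq_bigr => i _; rewrite mxE mulrDl. Qed.

Lemma dotZl (a : R) x u : dot (a *: x) u = a * dot x u.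
Proof. by rewrite /dot big_distrr; apply: eq_bigr => i _; rewrite mxE /= mulrA. Qed.

Lemma continuous_dotl u : continuous (fun x : 'rV[R]_l.+1 => dot x u).
Proof.
apply: continuous_big => [|i _]; first exact: add_continuous.
have ci : continuous (fun x : 'rV[R]_l.+1 => x ord0 i) by exact: coord_continuous.
by move=> x; exact: (cvgM (ci x) (cvg_cst _)).
Qed.

Lemma dot_normal_gt0 (h : hyperplane R l) : dot (normal h) (normal h) = 1.
Proof. by have := set_valP h.2 => -[]. Qed.

End inner_product.

Section measurable_parameters.
Context {R : realType} {l : nat}.

Lemma continuous_measurable_hyperplane (f : R * half_sphere R l -> R) :
  continuous f -> measurable_fun setT (f : hyperplane R l -> R).
Proof.
move=> cf; apply: (measurability _ (RGenOpens.measurableE R)) => //.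
move=> _ [B [a [b ->]] <-].
rewrite setTI; apply: sub_sigma_algebra.
apply: open_comp; first by move=> x _; exact: cf.
exact: interval_open.
Qed.

Lemma measurable_offset : measurable_fun setT (@offset R l).
Proof. by apply: continuous_measurable_hyperplane => -[a u]; exact: cvg_fst. Qed.

Lemma continuous_val_half_sphere : continuous (set_val : half_sphere R l -> 'rV[R]_l.+1).
Proof. exact: initial_continuous. Qed.

Lemma measurable_dot_normal (x : 'rV[R]_l.+1) :
  measurable_fun setT (fun h : hyperplane R l => dot x (normal h)).
Proof.
apply: (@continuous_measurable_hyperplane (fun h => dot x (\val h.2))).
apply: continuous_big => [|i _]; first exact: add_continuous.
move=> -[a u]; apply: cvgM; first exact: cvg_cst.
apply: (cvg_comp (snd : R * half_sphere R l -> _)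
  (fun u : half_sphere R l => (\val u : 'rV[R]_l.+1) ord0 i)); first exact: cvg_snd.
apply: (cvg_comp (set_val : half_sphere R l -> 'rV[R]_l.+1) (fun x : 'rV[R]_l.+1 => x ord0 i)).
  exact: continuous_val_half_sphere.
exact: coord_continuous.
Qed.

End measurable_parameters.

Section level_sets.
Context d (T : measurableType d) (R : realType).

Lemma measurable_lt_cst (f : T -> R) c : measurable_fun setT f ->
  measurable [set t | f t < c].
Proof.
move=> mf; rewrite (_ : [set t | _] = setT `&` f @^-1` `]-oo, c[%classic).
  exact: mf.
by apply/seteqP; split => t /=; rewrite in_itv/= => -[].
Qed.

Lemma measurable_gt_cst (f : T -> R) c : measurable_fun setT f ->
  measurable [set t | c < f t].
Proof.
move=> mf; rewrite (_ : [set t | _] = setT `&` f @^-1` `]c, +oo[%classic).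
  exact: mf.
by apply/seteqP; split => t /=; rewrite in_itv/= andbT => // -[].
Qed.

End level_sets.

(** * Measurability of existence statements over a compact set *)

Section compact_engine.
Context {R : realType} {n : nat}.
Local Notation V := 'rV[R]_n.

Lemma compact_finite_net (K : set V) (e : R) : compact K -> 0 < e ->
  exists D : {fset V}, [set` D] `<=` K /\ K `<=` \bigcup_(x in [set` D]) ball x e.
Proof.
rewrite compact_cover => cK e0.
have [|x Kx|D DK KD] := cK V K (fun x => ball x e).
- by move=> x _; exact: ball_open.
- by exists x => //; exact: ballxx.
- by exists D; split => // x /= /DK /set_mem.
Qed.

(** A nonnegative continuous function has a zero on a compact set iff its infimum there is 0, that
    is, iff for each k it takes a value below 1/(k+1) at some point of some finite net. Only
    countably many points are involved, which removes the existential over the uncountable set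
    [K]. *)
Lemma measurable_exists_compact d (T : measurableType d) (K : set V)
    (g : T -> V -> R) :
  compact K -> (forall t, continuous (g t)) -> (forall x, measurable_fun setT (g ^~ x)) ->
  (forall t x, 0 <= g t x) ->
  measurable [set t | exists2 x, K x & g t x = 0].
Proof.
move=> cK cg mg g0.
have ne (m : nat) : 0 < m.+1%:R^-1 :> R by rewrite invr_gt0.
have [D HD] : {D : nat -> {fset V} & forall m, [set` D m] `<=` K /\
    K `<=` \bigcup_(x in [set` D m]) ball x (m.+1%:R^-1)}.
  apply: (@choice _ _ (fun m (Dm : {fset V}) => [set` Dm] `<=` K /\
    K `<=` \bigcup_(x in [set` Dm]) ball x (m.+1%:R^-1))) => m.
  exact: compact_finite_net.
rewrite [X in measurable X](_ : _ = \bigcap_k \bigcup_m \bigcup_(x in [set` D m])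
    [set t | g t x < k.+1%:R^-1]).
  apply: bigcapT_measurable => k; apply: bigcupT_measurable => m.
  apply: fin_bigcup_measurable => // x _.
  exact: measurable_lt_cst.
apply/seteqP; split => t /=.
  move=> [x Kx gx0] k _.
  have /(_ (ball 0 (k.+1%:R^-1))) := cg t x; rewrite gx0.
  move=> /(_ (nbhsx_ballx _ _ (ne k))) /nbhs_ballP[r /= r0 xr].
  have [m mr] : exists m, m.+1%:R^-1 < r.
    exists (Num.truncn r^-1); rewrite invf_plt ?posrE//.
    exact: truncnS_gt.
  exists m => //; have [_ /(_ _ Kx) [y Dy yx]] := HD m.
  exists y => //=; have /xr := le_ball (ltW mr) (ball_sym yx).
  by rewrite /= -ball_normE /= sub0r normrN ger0_norm.
move=> h.
have K0 : K !=set0.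
  by have [m _ [x Dx _]] := h 0%N I; exists x; have [+ _] := HD m; apply.
(* The minimum is attained, and it is below every 1/(k+1). *)
have [c /set_mem Kc cmin] := EVT_min_rV K0 cK (continuous_subspaceT (cg t)).
exists c => //; apply/eqP; rewrite eq_le g0 andbT.
apply/ler_addgt0Pr => e e0; rewrite add0r.
have [k ke] : exists k, k.+1%:R^-1 < e.
  exists (Num.truncn e^-1); rewrite invf_plt ?posrE//; exact: truncnS_gt.
have [m _ [x Dx /= gx]] := h k I.
have [DK _] := HD m.
by apply: (le_trans (cmin x (mem_set (DK _ Dx)))); apply: ltW; exact: lt_trans ke.
Qed.

End compact_engine.

Section hulls.
Context {R : realType} {l : nat}.
Local Notation V := 'rV[R]_l.+1.

Lemma conv_hull_convex n (p : 'I_n -> V) x y (t : R) :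
  conv_hull p x -> conv_hull p y -> 0 <= t <= 1 ->
  conv_hull p ((1 - t) *: x + t *: y).
Proof.
move=> [c [c0 c1 ->]] [d [d0 d1 ->]] /andP[t0 t1].
exists (fun i => (1 - t) * c i + t * d i); split.
- by move=> i; rewrite addr_ge0// mulr_ge0// subr_ge0.
- by rewrite big_split/= -!mulr_sumr c1 d1 !mulr1 subrK.
- rewrite !scaler_sumr -big_split/=; apply: eq_bigr => i _.
  by rewrite !scalerA -scalerDl.
Qed.

(** The hull is the image of the standard simplex, which is closed and bounded, under a continuous
    map. *)
Lemma conv_hull_compact n (p : 'I_n -> V) : compact (conv_hull p).
Proof.
pose S : set 'rV[R]_n := [set c | (forall i, 0 <= c ord0 i) /\ \sum_i c ord0 i = 1].
pose f (c : 'rV[R]_n) : V := \sum_i c ord0 i *: p i.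
have -> : conv_hull p = f @` S.
  apply/seteqP; split => x.
    move=> [c [c0 c1 ->]]; exists (\row_i c i).
      split; first by move=> i; rewrite mxE.
      by rewrite -c1; apply: eq_bigr => i _; rewrite mxE.
    by rewrite /f; apply: eq_bigr => i _; rewrite mxE.
  by move=> [c [c0 c1] <-]; exists (fun i => c ord0 i).
apply: continuous_compact.
  apply: continuous_subspaceT; apply: continuous_big => [|i _]; first exact: add_continuous.
  have ci : continuous (fun c : 'rV[R]_n => c ord0 i) by exact: coord_continuous.
  by move=> c; exact: (cvgZr_tmp (ci c)).
apply: bounded_closed_compact.
  exists 1; split; first exact: real1.
  move=> M M1 c [c0 c1]; rewrite /Num.norm/= mx_normrE.
  apply: bigmax_le; first exact: le_trans ler01 (ltW M1).
  move=> [i j] _ /=; rewrite (ord1 i) ger0_norm//.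
  apply: le_trans (ltW M1); rewrite -c1 (bigD1 j)//= lerDl.
  by apply: sumr_ge0 => k _.
have -> : S = (\bigcap_i [set c | 0 <= c ord0 i]) `&` [set c | \sum_i c ord0 i = 1].
  apply/seteqP; split => c; first by move=> [h1 h2]; split => // i _; exact: h1.
  by move=> [h1 h2]; split => // i; exact: h1.
apply: closedI.
  apply: closed_bigI => i _.
  apply: (@closed_comp _ _ (fun c : 'rV[R]_n => c ord0 i) [set x : R | 0 <= x]).
    by move=> c _; exact: coord_continuous.
  exact: closed_ge.
apply: (@closed_comp _ _ (fun c : 'rV[R]_n => \sum_i c ord0 i) [set x : R | x = 1]).
  move=> c _; apply: continuous_big c => [|i _]; first exact: add_continuous.
  exact: coord_continuous.
exact: closed_eq.
Qed.

(** Allows vertices indexed by a part of any finite type. The part of a polytope in a half-space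
    needs this: its vertices are indexed by certain points and certain pairs of points. *)
Lemma conv_hull_pred (I : finType) (v : pred I) (p : I -> V) :
  polytope [set x | exists c : I -> R,
     [/\ forall i, v i -> 0 <= c i, \sum_(i | v i) c i = 1 &
         x = \sum_(i | v i) c i *: p i]].
Proof.
exists #|v|, (fun i => p (enum_val i)); apply/seteqP; split => x.
  move=> [c [c0 c1 ->]]; exists (fun i => c (enum_val i)); split.
  - by move=> i; apply: c0; exact: enum_valP.
  - by rewrite -[RHS]c1 -(big_enum_val (A:=v) c).
  - by rewrite -(big_enum_val (A:=v) (fun i => c i *: p i)).
move=> [c [c0 c1 ->]]; exists (fun i => \sum_(k | enum_val k == i) c k).
have E j : \sum_(k | @enum_val I v k == enum_val j) c k = c j.
  rewrite (big_pred1 j)// => k /=; apply/eqP/eqP => [/enum_val_inj//|->//].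
split.
- by move=> i _; exact: sumr_ge0.
- rewrite -[RHS]c1 (big_enum_val (A:=v) (fun i => \sum_(k | @enum_val I v k == i) c k)).
  by apply: eq_bigr => j _; rewrite E.
- rewrite (big_enum_val (A:=v) (fun i => (\sum_(k | @enum_val I v k == i) c k) *: p i)).
  by apply: eq_bigr => j _; rewrite E.
Qed.

End hulls.

Section polytopes.
Context {R : realType} {l : nat}.
Local Notation V := 'rV[R]_l.+1.
Implicit Types (C : set V) (h : hyperplane R l).

Definition convex_body C := forall x y (t : R), C x -> C y -> 0 <= t <= 1 ->
  C ((1 - t) *: x + t *: y).

Lemma polytope_convex C : polytope C -> convex_body C.
Proof. by move=> [n [p ->]] x y t; exact: conv_hull_convex. Qed.

Lemma polytope_compact C : polytope C -> compact C.
Proof. by move=> [n [p ->]]; exact: conv_hull_compact. Qed.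

(** An affine function that is nonpositive exactly on [half b h], so that the two sides of a
    hyperplane are treated alike. *)
Definition excess (b : bool) h (x : V) : R :=
  if b then offset h - dot x (normal h) else dot x (normal h) - offset h.

Lemma halfE b h : half b h = [set x | excess b h x <= 0].
Proof. by case: b; apply/seteqP; split => x /=; rewrite subr_le0. Qed.

Lemma continuous_excess b h : continuous (excess b h).
Proof.
case: b => x; rewrite /excess.
  exact: (cvgB (cvg_cst _) (@continuous_dotl R l (normal h) x)).
exact: (cvgB (@continuous_dotl R l (normal h) x) (cvg_cst _)).
Qed.

Lemma closed_half b h : closed (half b h).
Proof.
rewrite halfE; apply: (@closed_comp _ _ (excess b h) [set x : R | x <= 0]).
  by move=> x _; exact: continuous_excess.
exact: closed_le.
Qed.

Lemma excess_comb b h (x y : V) (s t : R) : s + t = 1 ->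
  excess b h (s *: x + t *: y) = s * excess b h x + t * excess b h y.
Proof.
move=> st; have o : offset h = (s + t) * offset h by rewrite st mul1r.
rewrite /excess dotDl !dotZl; case: b; rewrite [X in X - _ = _]o || rewrite [X in _ - X = _]o; ring.
Qed.

Lemma excess_sum b h (I : finType) (v : pred I) (c : I -> R) (p : I -> V) :
  \sum_(i | v i) c i = 1 ->
  excess b h (\sum_(i | v i) c i *: p i) = \sum_(i | v i) c i * excess b h (p i).
Proof.
move=> c1.
have dot0 : dot (0 : V) (normal h) = 0.
  by rewrite /dot big1// => i _; rewrite mxE mul0r.
have dsum : dot (\sum_(i | v i) c i *: p i) (normal h) = \sum_(i | v i) c i * dot (p i) (normal h).
  rewrite (big_morph (fun x => dot x (normal h)) (fun x y => dotDl x y (normal h)) dot0).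
  by apply: eq_bigr => i _; rewrite dotZl.
have o : offset h = \sum_(i | v i) c i * offset h by rewrite -mulr_suml c1 mul1r.
rewrite /excess dsum; case: b.
  by rewrite [X in X - _ = _]o -sumrB; apply: eq_bigr => i _; rewrite mulrBr.
by rewrite [X in _ - X = _]o -sumrB; apply: eq_bigr => i _; rewrite mulrBr.
Qed.

Lemma conv_hull_comb n (p : 'I_n -> V) (I : finType) (v : pred I) (c : I -> R) (q : I -> V) :
  (forall i, v i -> 0 <= c i) -> \sum_(i | v i) c i = 1 ->
  (forall i, v i -> conv_hull p (q i)) -> conv_hull p (\sum_(i | v i) c i *: q i).
Proof.
move=> c0 c1 hq.
have /choice[w Hw] : forall i, exists w : 'I_n -> R, v i ->
    [/\ forall j, 0 <= w j, \sum_j w j = 1 & q i = \sum_j w j *: p j].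
  move=> i; case: (boolP (v i)) => vi; last by exists (fun=> 0).
  by have [w Hw] := hq i vi; exists w.
exists (fun j => \sum_(i | v i) c i * w i j); split.
- by move=> j; apply: sumr_ge0 => i vi; rewrite mulr_ge0 ?c0//; have [] := Hw i vi.
- rewrite exchange_big/= -[RHS]c1; apply: eq_bigr => i vi.
  by rewrite -mulr_sumr; have [_ -> _] := Hw i vi; rewrite mulr1.
- transitivity (\sum_(i | v i) \sum_j (c i * w i j) *: p j).
    apply: eq_bigr => i vi; have [_ _ ->] := Hw i vi.
    by rewrite scaler_sumr; apply: eq_bigr => j _; rewrite scalerA.
  by rewrite exchange_big/=; apply: eq_bigr => j _; rewrite scaler_suml.
Qed.

(* The vertices of the part of a polytope where an affine function is         *)
(* nonpositive are among its vertices in that half-space and the points where *)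
(* the edges between its two sides cross the bounding hyperplane.             *)
Lemma polytope_half C b h : polytope C -> polytope (C `&` half b h).
Proof.
move=> [n [p ->]].
pose f i := excess b h (p i).
pose I : finType := ('I_n + 'I_n * 'I_n)%type.
pose v (k : I) := match k with inl i => f i <= 0 | inr ij => (0 < f ij.1) && (f ij.2 < 0) end.
pose q (k : I) : V := match k with inl i => p i
  | inr ij => (f ij.1 - f ij.2)^-1 *: (- f ij.2 *: p ij.1 + f ij.1 *: p ij.2) end.
have := conv_hull_pred v q; congr (polytope _); apply/seteqP; split => x.
  move=> [c [c0 c1 xE]].
  have qC k : v k -> conv_hull p (q k) /\ excess b h (q k) <= 0.
    have pC i : conv_hull p (p i).
      exists (fun j => (j == i)%:R); split.
      - by move=> j; rewrite ler0n.
      - by rewrite (bigD1 i)//= eqxx big1 ?addr0// => j /negPf ->.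
      - rewrite (bigD1 i)//= eqxx scale1r big1 ?addr0// => j /negPf ->.
        by rewrite scale0r.
    case: k => [i fi|[i j] /= /andP[fi fj]]; first by split; [exact: pC|].
    have fij : 0 < f i - f j by rewrite subr_gt0 (lt_trans fj).
    have fij0 : f i - f j != 0 by rewrite gt_eqF.
    have -> : (f i - f j)^-1 *: (- f j *: p i + f i *: p j) =
      (1 - f i / (f i - f j)) *: p i + (f i / (f i - f j)) *: p j.
      rewrite scalerDr !scalerA; congr (_ *: _ + _ *: _); last by rewrite mulrC.
      by field.
    split.
      apply: conv_hull_convex => //.
      apply/andP; split; first by rewrite divr_ge0 ?ltW.
      by rewrite ler_pdivrMr// mul1r lerDl oppr_ge0 ltW.
    rewrite excess_comb ?subrK// -/(f i) -/(f j) le_eqVlt; apply/orP; left; apply/eqP.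
    by field.
  split; first by rewrite xE; apply: conv_hull_comb => // k /qC[].
  rewrite halfE /= xE excess_sum//; apply: sumr_le0 => k vk.
  by rewrite mulr_ge0_le0 ?c0//; have [] := qC k vk.
move=> [[c [c0 c1 xE]]]; rewrite halfE /= xE (@excess_sum b h _ xpredT)// => fx.
have {}fx : \sum_i c i * f i <= 0 by [].
pose A := \sum_(i | 0 < f i) c i * f i.
pose B := \sum_(j | f j < 0) c j * - f j.
have A0 : 0 <= A by apply: sumr_ge0 => i fi; rewrite mulr_ge0// ltW.
have B0 : 0 <= B by apply: sumr_ge0 => i fi; rewrite mulr_ge0// oppr_ge0 ltW.
have AB : A <= B.
  move: fx; rewrite (bigID (fun i => 0 < f i))/= -/A (bigID (fun i => f i < 0))/=.
  rewrite [X in A + (X + _)](_ : _ = - B); last first.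
    rewrite /B -sumrN; apply: eq_big => [i|i _]; last by rewrite mulrN opprK.
    by case: ltgtP.
  rewrite big1 ?addr0 ?subr_le0// => i /andP[]; rewrite -!leNgt => f1 f2.
  have -> : f i = 0 by apply/eqP; rewrite eq_le f1.
  by rewrite mulr0.
(* If [B] is 0 then so is [A], and the points of positive excess have weight 0; the division by [B]
   is then harmless. *)
have cB i : 0 < f i -> c i * B / B = c i.
  move=> fi; have [B00|B00] := eqVneq B 0; last by rewrite mulfK.
  have A00 : A = 0 by apply/eqP; rewrite eq_le A0 andbT -B00.
  have /eqP : c i * f i = 0.
    move/eqP: A00; rewrite psumr_eq0; last by move=> j fj; rewrite mulr_ge0// ltW.
    by move=> /allP /(_ i (mem_index_enum _)) /implyP/(_ fi)/eqP.
  by rewrite mulf_eq0 (gt_eqF fi) orbF => /eqP ->; rewrite !mul0r.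
(* The weight of each point of positive excess is matched with points of negative excess, in
   proportion to their share of [B], and each matched pair is placed at its crossing point. A point
   of negative excess keeps the fraction 1 - A / B of its weight. *)
pose m (k : I) : R := match k with
  | inl i => c i * (1 - A / B * (f i < 0)%R%:R)
  | inr ij => (f ij.1 - f ij.2) * (c ij.1 * c ij.2 / B) end.
have m0 k : v k -> 0 <= m k.
  case: k => [i fi|[i j] /= /andP[fi fj]] /=.
    rewrite mulr_ge0// subr_ge0; case: ltP => _; rewrite ?mulr0 ?mulr1//.
    have [->|B00] := eqVneq B 0; first by rewrite invr0 mulr0.
    by rewrite ler_pdivrMr ?mul1r// lt_neqAle eq_sym B00.
  by rewrite mulr_ge0 ?divr_ge0 ?mulr_ge0// subr_ge0 ltW// (lt_trans fj).
(* Stated in an arbitrary module so as to serve twice: the constant 1 gives the total of the new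
   weights, the points themselves give the barycentre. *)
have key (U : lmodType R) (g : 'I_n -> U) :
    \sum_(k | v k) m k *: (match k with inl i => g i
       | inr ij => (f ij.1 - f ij.2)^-1 *: (- f ij.2 *: g ij.1 + f ij.1 *: g ij.2) end)
    = \sum_i c i *: g i.
  rewrite big_sumType /=.
  rewrite -(pair_big (fun i => 0 < f i) (fun j => f j < 0) (fun i j =>
     ((f i - f j) * (c i * c j / B)) *: ((f i - f j)^-1 *: (- f j *: g i + f i *: g j))))/=.
  rewrite [X in _ + X](eq_bigr (fun i => c i *: g i + \sum_(j | f j < 0) (c i * f i * (c j / B)) *: g j)); last first.
    move=> i fi.
    have -> : c i *: g i = \sum_(j | f j < 0) (c i * (c j * - f j) / B) *: g i.
      by rewrite -scaler_suml -mulr_suml -mulr_sumr -/B cB.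
    rewrite -big_split/=; apply: eq_bigr => j fj; rewrite !scalerA scalerDr !scalerA.
    have fij0 : f i - f j != 0 by rewrite gt_eqF// subr_gt0 (lt_trans fj).
    have e X : (f i - f j) * X / (f i - f j) = X by rewrite mulrC mulKf.
    by rewrite !e; congr (_ *: _ + _ *: _); ring.
  rewrite big_split/= exchange_big/=.
  rewrite [X in _ + (_ + X)](eq_bigr (fun j => (c j * (A / B)) *: g j)); last first.
    by move=> j fj; rewrite -scaler_suml -mulr_suml -/A; congr (_ *: _); ring.
  rewrite [RHS](bigID (fun i => f i <= 0))/= [X in _ = _ + X](eq_bigl (fun i => 0 < f i)); last first.
    by move=> i; rewrite ltNge.
  rewrite addrCA [RHS]addrC; congr (_ + _).
  rewrite [X in _ + X]big_mkcond [X in X + _]big_mkcond -big_split/= [RHS]big_mkcond/=.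
  apply: eq_bigr => i _; case: ltgtP => fi //=; rewrite ?addr0 ?mulr0 ?subr0 ?mulr1//.
  by rewrite -scalerDl; congr (_ *: _); ring.
exists m; split => //.
  have := key R^o (fun=> 1); rewrite [X in _ = X -> _](_ : _ = 1); last first.
    by rewrite -[RHS]c1; apply: eq_bigr => i _; rewrite /GRing.scale/= mulr1.
  move=> <-; apply: eq_bigr => -[i|[i j] /=] vk; rewrite /GRing.scale/= ?mulr1//.
  case/andP: vk => fi fj.
  by rewrite [- f j + _]addrC mulVf ?mulr1// gt_eqF// subr_gt0 (lt_trans fj).
by rewrite -(key V p).
Qed.

End polytopes.

Section windows.
Context {R : realType} {l : nat}.
Local Notation V := 'rV[R]_l.+1.
Implicit Types (C : set V) (h : hyperplane R l).

(** Strict crossing. This, rather than [hits], is the condition under which both parts of a window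
    are windows. *)
Definition cuts C h := forall b, exists2 x, C x & excess b h x < 0.

Lemma interior_half b h : interior (half b h) = [set x | excess b h x < 0].
Proof.
apply/seteqP; split => x; last first.
  move=> /= hx; have o : open (excess b h @^-1` [set y | y < 0]).
    apply: open_comp => [y _|]; first exact: continuous_excess.
    exact: open_lt.
  rewrite halfE; apply: (filterS _ (open_nbhs_nbhs (conj o hx))) => y /=.
  exact: ltW.
rewrite /interior halfE => /nbhs_ballP[e /= e0 xe]; rewrite /= ltNge; apply/negP => hx.
pose s : R := if b then -1 else 1.
(* The norm is the sup norm, so a unit normal need not have norm 1; dividing by 1 plus its norm
   keeps the displaced point in the ball. *)
pose d : R := e / 2 / (1 + `|normal h|).
have n0 : 0 < 1 + `|normal h| by rewrite ltr_wpDr.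
have d0 : 0 < d by rewrite !divr_gt0.
have /xe /= : ball x e (x + (s * d) *: normal h).
  rewrite -ball_normE /= opprD addNKr normrN normrZ normrM.
  have -> : `|s| = 1 by rewrite /s; case: (b); rewrite ?normrN normr1.
  rewrite mul1r gtr0_norm// /d mulrAC ltr_pdivrMr//.
  have : 0 <= `|normal h| by []; nra.
apply/negP; rewrite -ltNge.
have -> : excess b h (x + (s * d) *: normal h) = excess b h x + d.
  rewrite /excess dotDl dotZl dot_normal_gt0 /s; case: (b); ring.
by rewrite ltr_wpDl.
Qed.

Lemma interior_halves C D h : interior (C `&` half false h) `&` interior (D `&` half true h) = set0.
Proof.
rewrite -subset0 !interiorI => x [[_ +] [_]]; rewrite !interior_half /= => h1.
by rewrite /excess in h1 * => h2; lra.
Qed.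

(** A point of [C] strictly on side [b], moved slightly towards an interior point of [C], stays
    strictly on that side, and by convexity a small ball around it lies in [C]. *)
Lemma interior_cut C b h : convex_body C -> interior C !=set0 -> cuts C h ->
  interior (C `&` half b h) !=set0.
Proof.
move=> cC [x0 /nbhs_ballP[r /= r0 x0r]] /(_ b)[x Cx hx].
set a := excess b h x0; set c := excess b h x in hx.
have [t t01 ht] : exists2 t : R, 0 < t < 1 & (1 - t) * c + t * a < 0.
  (* Small enough for the combination of [c] < 0 and [a] to stay negative; the denominator is
     positive whatever the sign of [a]. *)
  exists (- c / 2 / (1 + `|a| - c)).
    have : 0 <= `|a| by []. have c0 := hx.
    move=> a0; rewrite !divr_gt0//=; [|lra|lra].
    by rewrite ltr_pdivrMr; lra.
  have k0 : 0 < 1 + `|a| - c by have : 0 <= `|a| by []; lra.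
  have aa : a <= `|a| by exact: ler_norm.
  set K := 1 + `|a| - c in k0 *.
  have -> : (1 - - c / 2 / K) * c + - c / 2 / K * a = c / K * (K + (c - a) / 2).
    by field; rewrite gt_eqF.
  rewrite pmulr_llt0; last by rewrite /K; have : 0 <= `|a| by []; lra.
  by rewrite pmulr_llt0// invr_gt0.
have /andP[t0 t1] := t01.
exists ((1 - t) *: x + t *: x0); rewrite interiorI; split; last first.
  by rewrite interior_half /= excess_comb ?subrK.
apply/nbhs_ballP; exists (t * r) => /=; first exact: mulr_gt0.
move=> z; rewrite -ball_normE /= => zr.
have -> : z = (1 - t) *: x + t *: (x0 - t^-1 *: ((1 - t) *: x + t *: x0 - z)).
  rewrite scalerBr scalerA divff ?gt_eqF// scale1r opprB addrCA addrA.
  by rewrite [t *: x0 + _]addrC [RHS]addrC subrK.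
apply: cC => //; last by rewrite !ltW.
apply: x0r; rewrite -ball_normE /= opprB addrC subrK normrZ gtr0_norm ?invr_gt0//.
by rewrite mulrC ltr_pdivrMr// mulrC.
Qed.

Lemma window_cut C b h : window C -> cuts C h -> window (C `&` half b h).
Proof.
move=> [pC iC] ch; split; first exact: polytope_half.
by apply: interior_cut => //; exact: polytope_convex.
Qed.

Lemma setI_halves C h : (C `&` half false h) `|` (C `&` half true h) = C.
Proof.
apply/seteqP; split => x; first by case=> -[].
move=> Cx; case: (leP (excess false h x) 0) => hx; [left|right]; split => //; rewrite halfE //=.
by rewrite /excess in hx *; lra.
Qed.

End windows.

(** * Cells of a binary splitting tree and their measurability *)

Section cells.
Context {R : realType} {l : nat}.
Local Notation V := 'rV[R]_l.+1.
Variable W : set V.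
Implicit Types (C : set V) (h : hyperplane R l) (H : word -> hyperplane R l) (e : word).

(* The cell C(e) when every cell C(f) is split by the hyperplane [H f]. *)
Fixpoint tree_cell H e : set V :=
  if e is b :: e' then tree_cell H e' `&` half b (H e') else W.

Fixpoint ancestors e : seq word := if e is _ :: e' then e' :: ancestors e' else [::].

Lemma eq_tree_cell H H' e : {in ancestors e, H =1 H'} -> tree_cell H e = tree_cell H' e.
Proof.
elim: e => //= b e ih HH'; rewrite HH' ?mem_head// ih// => f fe.
by apply: HH'; rewrite inE fe orbT.
Qed.

Definition gap b h (x : V) : R := Num.max 0 (excess b h x).

(** Continuous, nonnegative, and zero on [W] exactly at the points of the cell. Questions on a
    random cell thus become questions on zeros over the fixed compact set [W]. *)
Fixpoint penalty H e (x : V) : R :=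
  if e is b :: e' then penalty H e' x + gap b (H e') x else 0.

Lemma gap_ge0 b h x : 0 <= gap b h x. Proof. by rewrite /gap le_max lexx. Qed.

Lemma gap0 b h x : (gap b h x = 0) <-> half b h x.
Proof. by rewrite halfE /gap /=; case: (leP 0 (excess b h x)) => hx; split; lra. Qed.

Lemma penalty_ge0 H e x : 0 <= penalty H e x.
Proof. by elim: e => //= b e ih; rewrite addr_ge0// gap_ge0. Qed.

Lemma tree_cellE H e : tree_cell H e = W `&` [set x | penalty H e x = 0].
Proof.
elim: e => [|b e ih] /=; first by apply/seteqP; split => x //= -[].
rewrite ih; apply/seteqP; split => x /=.
  by move=> [[Wx ->]] /gap0 ->; rewrite addr0.
move=> [Wx /eqP]; rewrite paddr_eq0 ?penalty_ge0 ?gap_ge0// => /andP[/eqP p0 /eqP /gap0].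
by [].
Qed.

Lemma continuous_gap b h : continuous (gap b h).
Proof.
move=> x; apply: (@continuous_max _ _ (fun=> 0) (excess b h)); first exact: cst_continuous.
exact: continuous_excess.
Qed.

Lemma continuous_penalty H e : continuous (penalty H e).
Proof.
elim: e => [|b e ih].
  exact: (@cst_continuous 'rV[R]_l.+1 R 0).
move=> x /=; exact: (cvgD (ih x) (@continuous_gap b (H e) x)).
Qed.

Lemma tree_cell_closed H e : closed W -> closed (tree_cell H e).
Proof. by move=> cW; elim: e => //= b e ih; apply: closedI => //; exact: closed_half. Qed.

Lemma tree_cell_compact H e : compact W -> compact (tree_cell H e).
Proof.
move=> cW; elim: e => //= b e ih; apply: compact_closedI => //; exact: closed_half.
Qed.

Lemma tree_cell_sub H e : tree_cell H e `<=` W.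
Proof. by elim: e => //= b e ih x [/ih]. Qed.

(** A point of the cell is on the boundary iff it is not interior to [W] or not interior to one of
    the half-spaces, that is, lies on the hyperplane of an ancestor. The boundary is thus a finite
    union of pieces to which [measurable_cell_meets] applies. *)
Lemma tree_cell_boundary H e : closed W ->
  boundary (tree_cell H e) = (tree_cell H e `&` (W `\` interior W)) `|`
    \bigcup_(f in [set` ancestors e]) (tree_cell H e `&` hpset (H f)).
Proof.
move=> cW; rewrite /boundary -(closure_id _).1; last exact: tree_cell_closed.
elim: e => [|b e ih] /=.
  rewrite [X in _ `|` X]bigcup0 ?setU0//; apply/seteqP; split => x; first by move=> [].
  by move=> [_].
have hE x : half b (H e) x -> ~ interior (half b (H e)) x <-> hpset (H e) x.
  rewrite interior_half halfE /= /hpset /excess /=; case: (b) => /= h1; split; lra.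
apply/seteqP; split => x.
  rewrite interiorI => -[[cx hx] /not_andP[xi|xi]].
    have : (tree_cell H e `\` interior (tree_cell H e)) x by [].
    rewrite ih => - [[_ ?]|[f fe [_ ?]]]; [by left|right].
    by exists f => //=; rewrite inE fe orbT.
  by right; exists e; [rewrite /= mem_head|split => //; apply/hE].
move=> h; have [cx hx] : (tree_cell H e `&` half b (H e)) x by case: h => [[]|[f _ []]].
split => //; rewrite interiorI => -[xi xh].
case: h => [[_ Wx]|[f /=]].
  have : (tree_cell H e `\` interior (tree_cell H e)) x by rewrite ih; left.
  by case.
rewrite inE => /orP[/eqP -> [_ /hE]|fe [_ hf]]; first exact.
have : (tree_cell H e `\` interior (tree_cell H e)) x by rewrite ih; right; exists f.
by case.
Qed.

End cells.

Lemma measure_mono d (T : measurableType d) (R : realType) (mu : {measure set T -> \bar R}) A B :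
  measurable A -> measurable B -> A `<=` B -> (mu A <= mu B)%E.
Proof. by move=> mA mB AB; apply: le_measure => //; exact: mem_set. Qed.

Section random_cells.
Context {R : realType} {l : nat}.
Local Notation V := 'rV[R]_l.+1.
Variable W : set V.
Hypothesis cW : compact W.
Context d (T : measurableType d) (H : T -> word -> hyperplane R l).
Hypothesis mH : forall e, measurable_fun setT (H ^~ e).
Implicit Types (e : word) (h : T -> hyperplane R l).

Lemma measurable_excess b h x : measurable_fun setT h ->
  measurable_fun setT (fun t => excess b (h t) x).
Proof.
move=> mh; have m1 : measurable_fun setT (fun t => offset (h t)).
  by apply: (measurableT_comp (@measurable_offset R l)).
have m2 : measurable_fun setT (fun t => dot x (normal (h t))).
  by apply: (measurableT_comp (@measurable_dot_normal R l x)).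
by case: b; exact: measurable_funB.
Qed.

Lemma measurable_penalty e x : measurable_fun setT (fun t => penalty (H t) e x).
Proof.
elim: e => [|b e ih] /=; first exact: measurable_cst.
apply: measurable_funD => //; apply: measurable_maxr; first exact: measurable_cst.
exact: measurable_excess.
Qed.

(** Membership in the cell and vanishing of [g] are combined into one equation on [W]: the sum of
    the penalty and of [g] is 0. *)
Lemma measurable_cell_meets e (A : set V) (g : T -> V -> R) :
  closed A -> (forall t, continuous (g t)) -> (forall x, measurable_fun setT (g ^~ x)) ->
  (forall t x, 0 <= g t x) ->
  measurable [set t | exists2 x, A x /\ tree_cell W (H t) e x & g t x = 0].
Proof.
move=> cA cg mg g0.
rewrite [X in measurable X](_ : _ =
  [set t | exists2 x, (W `&` A) x & penalty (H t) e x + g t x = 0]).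
  apply: measurable_exists_compact.
  - exact: compact_closedI.
  - by move=> t x; exact: (cvgD (@continuous_penalty R l (H t) e x) (cg t x)).
  - by move=> x; apply: measurable_funD => //; exact: measurable_penalty.
  - by move=> t x; rewrite addr_ge0// penalty_ge0.
apply/seteqP; split => t /= -[x].
  rewrite tree_cellE => -[Ax [Wx /= p0]] gx; exists x => //.
  by rewrite p0 gx addr0.
move=> [Wx Ax] /eqP; rewrite paddr_eq0 ?penalty_ge0// => /andP[/eqP p0 /eqP gx].
by exists x => //; split => //; rewrite tree_cellE.
Qed.

Lemma measurable_hits_cell e h : measurable_fun setT h ->
  measurable [set t | hits (tree_cell W (H t) e) (h t)].
Proof.
move=> mh; rewrite [X in measurable X](_ : _ = [set t | exists2 x,
    setT x /\ tree_cell W (H t) e x & `|excess false (h t) x| = 0]).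
  apply: measurable_cell_meets => //.
  - move=> t x; apply: (@continuous_comp _ _ _ (excess false (h t)) Num.norm).
      exact: continuous_excess.
    exact: norm_continuous.
  - by move=> x; apply: measurableT_comp => //; exact: measurable_excess.
apply/seteqP; split => t /= -[x].
  by move=> [/= hx Cx]; exists x => //; rewrite /excess hx subrr normr0.
by move=> [_ Cx] /eqP; rewrite normr_eq0 subr_eq0 => /eqP hx; exists x.
Qed.

Lemma measurable_side_cell b e h : measurable_fun setT h ->
  measurable [set t | exists2 x, tree_cell W (H t) e x & excess b (h t) x < 0].
Proof.
move=> mh.
(* A strict inequality is a countable union of inequalities with margin 1/(k+1), each of which is
   the vanishing of a positive part. *)
rewrite [X in measurable X](_ : _ = \bigcup_k [set t | exists2 x,
    setT x /\ tree_cell W (H t) e x & Num.max 0 (excess b (h t) x + k.+1%:R^-1) = 0]).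
  apply: bigcupT_measurable => k; apply: measurable_cell_meets.
  - exact: closedT.
  - move=> t x; apply: (@continuous_max _ _ (fun=> 0)
      (fun x => excess b (h t) x + k.+1%:R^-1)); first exact: cst_continuous.
    exact: (cvgD (@continuous_excess R l b (h t) x) (cvg_cst _)).
  - move=> x; apply: measurable_maxr => //.
    by apply: measurable_funD => //; exact: measurable_excess.
  - by move=> t x; rewrite le_max lexx.
apply/seteqP; split => t /= => [[x Cx hx]|[k _ [x [_ Cx] /max_idPl hx]]]; last first.
  by exists x => //; rewrite (lt_le_trans _ hx)// ltrDl invr_gt0.
exists (Num.truncn (- excess b (h t) x)^-1) => //; exists x => //.
apply/max_idPl; rewrite -lerBrDr sub0r lerNr.
apply: ltW; rewrite invf_plt ?posrE ?oppr_gt0//; exact: truncnS_gt.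
Qed.

Lemma measurable_cuts_cell e h : measurable_fun setT h ->
  measurable [set t | cuts (tree_cell W (H t) e) (h t)].
Proof.
move=> mh; pose S b := [set t | exists2 x, tree_cell W (H t) e x & excess b (h t) x < 0].
rewrite [X in measurable X](_ : _ = S false `&` S true).
  by apply: measurableI; exact: measurable_side_cell.
apply/seteqP; split => t /=; first by move=> ct; split; exact: ct.
by move=> [h1 h2] [].
Qed.

Lemma measurable_boundary_meets e (A : set V) : closed A ->
  measurable [set t | boundary (tree_cell W (H t) e) `&` A !=set0].
Proof.
move=> cA; have clW : closed W by apply: compact_closed => //; exact: norm_hausdorff.
rewrite [X in measurable X](_ : _ = [set t | exists2 x, (A `&` (W `\` interior W)) x /\
    tree_cell W (H t) e x & (0 : R) = 0] `|`
  \bigcup_(f in [set` ancestors e]) [set t | exists2 x, A x /\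
    tree_cell W (H t) e x & `|excess false (H t f) x| = 0]).
  apply: measurableU.
    apply: measurable_cell_meets => //; last by move=> t x; exact: cst_continuous.
    apply: closedI => //; apply: closedI => //.
    by apply: open_closedC; exact: open_interior.
  apply: fin_bigcup_measurable => // f fe; apply: measurable_cell_meets => //.
  - move=> t x; apply: (@continuous_comp _ _ _ (excess false (H t f)) Num.norm).
      exact: continuous_excess.
    exact: norm_continuous.
  - by move=> x; apply: measurableT_comp => //; exact: measurable_excess.
apply/seteqP; split => t /=.
  rewrite tree_cell_boundary// => -[x [[[cx Wx]|[f fe [cx hx]]] Ax]].
    by left; exists x.
  right; exists f => //; exists x => //.
  by move: hx; rewrite /hpset /excess /= => ->; rewrite subrr normr0.
rewrite tree_cell_boundary// => -[[x [[Ax Wx] cx] _]|[f fe [x [Ax cx] /eqP]]].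
  by exists x; split => //; left.
rewrite normr_eq0 subr_eq0 => /eqP hx.
by exists x; split => //; right; exists f.
Qed.

End random_cells.

(** * The measure of the hyperplanes that hit a compact set *)

Section hitting_measure.
Context {R : realType} {l : nat}.
Local Notation V := 'rV[R]_l.+1.
Variable Lam : {measure set (hyperplane R l) -> \bar R}.
Hypothesis Lam_neq0 : Lam setT <> 0%E.
Hypothesis Lam_inv : translation_invariant Lam.
Hypothesis Lam_fin : locally_finite Lam.
Implicit Types (C K : set V) (h : hyperplane R l).

Lemma sub_hits C K : C `<=` K -> hits C `<=` hits K.
Proof. by move=> CK h [x [hx Cx]]; exists x; split => //; exact: CK. Qed.

Lemma measurable_hits K : compact K -> measurable (hits K).
Proof.
move=> cK; rewrite [X in measurable X](_ : _ = [set h | hits (tree_cell K (fun=> h) [::]) h])//.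
exact: (measurable_hits_cell cK (H := fun h _ => h)).
Qed.

Lemma measurable_translate (v : V) : measurable_fun setT (@translate R l v).
Proof.
apply: (@measurability _ _ (hyperplane R l) (hyperplane R l) setT (translate v)
  (@open (R * half_sphere R l)%type)) => //.
move=> _ [B oB <-]; rewrite setTI; apply: sub_sigma_algebra.
apply: (@open_comp _ _ (@translate R l v : R * half_sphere R l -> R * half_sphere R l)) => //.
have c1 : continuous (fun p : R * half_sphere R l => p.1 + dot v (\val p.2)).
  have c2 : continuous (fun p : R * half_sphere R l => dot v (\val p.2)).
    apply: continuous_big => [|i _]; first exact: add_continuous.
    move=> -[a' u']; apply: cvgM; first exact: cvg_cst.
    apply: (cvg_comp (snd : R * half_sphere R l -> _)
      (fun u : half_sphere R l => (\val u : V) ord0 i)); first exact: cvg_snd.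
    apply: (cvg_comp (set_val : half_sphere R l -> V) (fun x : V => x ord0 i)).
      exact: continuous_val_half_sphere.
    exact: coord_continuous.
  by move=> p; exact: (cvgD cvg_fst (c2 p)).
by move=> p _; exact: (cvg_pair (c1 p) cvg_snd).
Qed.

Lemma hits_ltoo K : compact K -> (Lam (hits K) < +oo)%E.
Proof.
move=> cK; apply: Lam_fin; last exact: measurable_hits.
  have clK : closed K by apply: compact_closed => //; exact: norm_hausdorff.
  rewrite -(setCK K); apply: sigma_algebraC; apply: sub_sigma_algebra.
  exact: closed_openC.
exact: compact_bounded.
Qed.

Lemma closed_ball_compact (x : V) (r : R) : 0 < r -> compact (closed_ball x r).
Proof.
move=> r0; apply: bounded_closed_compact; last exact: closed_ball_closed.
exists (`|x| + r); split; first exact: num_real.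
move=> M M1 y; rewrite closed_ballE// /closed_ball_ /= => xy.
apply: le_trans (ltW M1); rewrite -[y](subrK x) (le_trans (ler_normD _ _))//.
by rewrite addrC lerD2l distrC.
Qed.

Lemma hits_closed_ball_translate (x v : V) (r : R) : 0 < r ->
  translate v @^-1` hits (closed_ball (x + v) r) = hits (closed_ball x r).
Proof.
move=> r0; rewrite !closed_ballE//; apply/seteqP; split => h /= [y [hy xy]].
  move: hy; rewrite hpset_translate => -[z hz zy]; exists z; split => //.
  by move: xy; rewrite /closed_ball_ /= -zy opprD addrACA subrr addr0.
exists (y + v); split; first by rewrite hpset_translate; exists y.
by move: xy; rewrite /closed_ball_ /= opprD addrACA subrr addr0.
Qed.

(** Otherwise some ball in [C], and by translation invariance every ball of that radius, would be
    hit by a null set of hyperplanes. Countably many such balls cover the space and every hyperplane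
    meets one of them, so [Lam] would be 0. *)
Lemma hits_gt0 C : compact C -> interior C !=set0 -> (0 < Lam (hits C))%E.
Proof.
move=> cC [x0 /nbhs_closedballP[r' x0C']].
have [r r0 x0C] : exists2 r : R, 0 < r & closed_ball x0 r `<=` C by exists r'%:num.
rewrite lt_neqAle measure_ge0 andbT eq_sym; apply/eqP => LC.
have mb (x : V) : measurable (hits (closed_ball x r)).
  by apply: measurable_hits; exact: closed_ball_compact.
have L0 : Lam (hits (closed_ball x0 r)) = 0%E.
  apply/eqP; rewrite eq_le measure_ge0 andbT -LC.
  by apply: measure_mono; [|exact: measurable_hits|exact: sub_hits].
have Lv v : Lam (hits (closed_ball v r)) = 0%E.
  rewrite -L0 -(@hits_closed_ball_translate x0 (v - x0) r r0) Lam_inv; last exact: mb.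
  by rewrite subrKC.
have LN (N : nat) : Lam.-negligible (hits (closed_ball (0 : V) N.+1%:R)).
  have [D [_ HD]] := compact_finite_net (@closed_ball_compact 0 N.+1%:R (ltr0Sn R N)) r0.
  apply: (@negligibleS _ _ _ _ (\bigcup_i hits (closed_ball (nth 0 D i) r))); last first.
    by apply: negligible_bigcup => i; apply/negligibleP; [exact: mb|exact: Lv].
  move=> h [x [hx /HD [y /= yD yx]]]; exists (index y D) => //.
  by rewrite nth_index//; exists x; split => //; exact: subset_closed_ball.
apply: Lam_neq0; apply: measure_negligible => //.
apply: negligibleS (negligible_bigcup LN) => h _.
(* The foot of the perpendicular from the origin, a point that every hyperplane has. *)
pose x : V := offset h *: normal h.
exists (Num.truncn `|x|) => //; exists x; split.
  by rewrite /hpset /= dotZl dot_normal_gt0 mulr1.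
rewrite closed_ballE//= /closed_ball_ /= sub0r normrN; apply: ltW; exact: truncnS_gt.
Qed.

(* Translates of [A] by different multiples of a fixed vector are disjoint    *)
(* where the normal is not orthogonal to that vector, and infinitely many of  *)
(* them meet a common ball.                                                   *)
Lemma measure_offset_graph0 (A : set (hyperplane R l)) K :
  measurable A -> compact K -> A `<=` hits K ->
  (forall h h', A h -> A h' -> h.2 = h'.2 -> h.1 = h'.1) -> Lam A = 0%E.
Proof.
move=> mA cK AK uA.
pose v (i : 'I_l.+1) : V := delta_mx ord0 i.
have dv i h : dot (v i) (normal h) = normal h ord0 i.
  rewrite /dot (bigD1 i)//= big1 ?addr0 => [|j /negPf ji].
    by rewrite !mxE !eqxx mul1r.
  by rewrite !mxE ji andbF mul0r.
pose Ai i := A `&` [set h | normal h ord0 i != 0].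
have mAi i : measurable (Ai i).
  apply: measurableI => //.
  rewrite (_ : [set h | _] = ~` [set h | dot (v i) (normal h) = 0]).
    apply: measurableC; rewrite -[X in measurable X]setTI.
    exact: (measurable_dot_normal (v i) measurableT (measurable_set1 0)).
  by apply/seteqP; split => h /=; rewrite dv; move/eqP.
suff Ai0 i : Lam.-negligible (Ai i).
  apply: measure_negligible => //.
  apply: (@negligibleS _ _ _ _ (\bigcup_k (if insub k is Some i then Ai i else set0))); last first.
    by apply: negligible_bigcup => k; case: insub => // ; exact: negligible_set0.
  move=> h Ah; have [i hi] : exists i, normal h ord0 i != 0.
    apply/existsP; apply: contrapT => /negP; rewrite negb_exists => /forallP n0.
    have := dot_normal_gt0 h; rewrite /dot big1 => [/eqP|i _].
      by rewrite eq_sym oner_eq0.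
    by have := n0 i; rewrite negbK => /eqP ->; rewrite mul0r.
  by exists (nat_of_ord i) => //; rewrite valK.
apply/negligibleP => //.
pose s (k : nat) : R := k.+1%:R^-1.
pose F k := translate (s k *: v i) @^-1` Ai i.
have mF k : measurable (F k).
  by rewrite -[X in measurable X]setTI; exact: measurable_translate.
have LF k : Lam (F k) = Lam (Ai i) by exact: Lam_inv.
have tF : trivIset setT F.
  move=> k m _ _ [h [[Ak nk] [Am nm]]].
  have := uA _ _ Ak Am erefl; rewrite /= => /addrI; rewrite !dotZl dv => /(mulIf nk).
  by move/invr_inj/eqP; rewrite eqr_nat => /eqP[].
have [M [_ HM]] := compact_bounded cK.
pose B := closed_ball (0 : V) (`|M| + 2).
have B0 : 0 < `|M| + 2 by rewrite ltr_wpDl.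
have FB : \bigcup_k F k `<=` hits B.
  move=> h [k _ [/AK [y [hy Ky]] _]].
  move: hy; rewrite hpset_translate => -[z hz zy]; exists z; split => //.
  rewrite /B closed_ballE// /closed_ball_ /= sub0r normrN.
  have -> : z = y - s k *: v i by rewrite -zy addrK.
  rewrite (le_trans (ler_normB _ _))// (_ : `|M| + 2 = (`|M| + 1) + 1); last by ring.
  apply: lerD.
    by apply: HM => //; rewrite (le_lt_trans (ler_norm _))// ltrDl.
  rewrite normrZ mulr_ile1//.
    by rewrite ger0_norm ?invr_ge0// invf_le1// ler1n.
  rewrite /Num.norm/= mx_normrE; apply: bigmax_le => // -[a b] _ /=.
  by rewrite mxE; case: (_ && _); rewrite ?normr1 ?normr0.
have Lfin : (Lam (\bigcup_k F k) < +oo)%E.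
  apply: (@le_lt_trans _ _ (Lam (hits B))); last by apply: hits_ltoo; exact: closed_ball_compact.
  apply: measure_mono => //; first exact: bigcupT_measurable.
  by apply: measurable_hits; exact: closed_ball_compact.
move: Lfin; rewrite measure_semi_bigcup//; last exact: bigcupT_measurable.
have [L00 _|L0] := eqVneq (Lam (Ai i)) 0%E; first exact: L00.
rewrite (eq_eseriesr (g := fun=> Lam (Ai i))); last by move=> k _; exact: LF.
set L := (\sum_(_ <oo) _)%E => Lfin.
have Lc N : (\sum_(0 <= k < N) Lam (Ai i) <= L)%E by exact: nneseries_lim_ge.
have rE : (fine (Lam (Ai i)))%:E = Lam (Ai i).
  rewrite fineK// ge0_fin_numE//; apply: le_lt_trans Lfin.
  by rewrite (le_trans _ (Lc 1%N))// big_nat1.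
have LE : (fine L)%:E = L.
  by rewrite fineK// ge0_fin_numE// (le_trans _ (Lc 0%N))// big_geq.
set r := fine (Lam (Ai i)) in rE *; have r0 : 0 < r.
  by rewrite lt_neqAle fine_ge0// andbT eq_sym -eqe rE.
have := Lc (Num.truncn (fine L / r)).+1.
rewrite -rE sumEFin -LE lee_fin sumr_const_nat subn0 -mulr_natr mulrC -ler_pdivlMr//.
by rewrite leNgt truncnS_gt.
Qed.

(** A hyperplane that meets [C] but leaves no point of [C] strictly on one side is a supporting one.
    For each normal and each side there is only one such offset, so [measure_offset_graph0] applies
    to either side. *)
Lemma touch_null C : compact C -> Lam (hits C `\` cuts C) = 0%E.
Proof.
move=> cC; have mC b : measurable [set h | exists2 x, C x & excess b h x < 0].
  exact: (@measurable_side_cell _ _ C cC _ _ (fun h _ => h) _ b [::] id).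
pose A b := hits C `\` [set h | exists2 x, C x & excess b h x < 0].
have mA b : measurable (A b) by apply: measurableD => //; exact: measurable_hits.
have A0 b : Lam (A b) = 0%E.
  apply: (measure_offset_graph0 (mA b) cC) => [h []//|h h' [[x [/= hx Cx]] nh] [[x' [/= hx' Cx']] nh'] hh].
  have ge0 y : C y -> 0 <= excess b h y by move=> Cy; rewrite leNgt; apply/negP => hy; apply: nh; exists y.
  have ge0' y : C y -> 0 <= excess b h' y by move=> Cy; rewrite leNgt; apply/negP => hy; apply: nh'; exists y.
  have nn : normal h' = normal h by rewrite /normal hh.
  have := ge0 _ Cx'; have := ge0' _ Cx; rewrite /excess -nn; move: hx hx'; rewrite /hpset /= -nn => -> ->.
  rewrite -/(offset h) -/(offset h').
  by case: (b); rewrite !subr_ge0 => h1 h2; apply/eqP; rewrite eq_le; apply/andP.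
apply/eqP; rewrite eq_le measure_ge0 andbT.
have AU : (Lam (A false `|` A true) <= 0)%E.
  apply: le_trans; first exact: (measureU2 Lam (mA false) (mA true)).
  rewrite -[leRHS](adde0 0%E).
  by apply: leeD; rewrite le_eqVlt; apply/orP; left; apply/eqP; exact: A0.
apply: (le_trans _ AU).
apply: measure_mono; [|exact: measurableU|].
  apply: measurableD; first exact: measurable_hits.
  rewrite (_ : cuts C = [set h | cuts (tree_cell C (fun=> h) [::]) h])//.
  exact: (@measurable_cuts_cell _ _ C cC _ _ (fun h _ => h) _ [::] id).
move=> h [hC nc]; have [[x Cx hx]|n0] := pselect (exists2 x, C x & excess false h x < 0); last by left.
by right; split => // -[y Cy hy]; apply: nc => -[]; [exists y|exists x].
Qed.

End hitting_measure.

(** * Sequences of splits and their law *)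

Section measurable_countable.
Context d (T : measurableType d).

Lemma measurable_countable_fiber (I : countType) (c : T -> I) (A : I -> set T) :
  (forall i, measurable [set t | c t = i]) -> (forall i, measurable (A i)) ->
  measurable [set t | A (c t) t].
Proof.
move=> mc mA; rewrite [X in measurable X](_ : _ = \bigcup_i ([set t | c t = i] `&` A i)).
  by apply: countable_bigcupT_measurable => // i; exact: measurableI.
by apply/seteqP; split => t /=; [move=> At; exists (c t)|move=> [i _ [<-]]].
Qed.

Lemma measurable_fun_countable_fiber (I : countType) d' (Y : measurableType d')
    (c : T -> I) (f : I -> T -> Y) :
  (forall i, measurable [set t | c t = i]) -> (forall i, measurable_fun setT (f i)) ->
  measurable_fun setT (fun t => f (c t) t).
Proof.
move=> mc mf _ B mB; rewrite setTI.
apply: (measurable_countable_fiber (A := fun i => f i @^-1` B)) => // i.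
by rewrite -[X in measurable X]setTI; exact: mf.
Qed.

Lemma measurable_countable_pred (I : countType) (c : T -> I) (Q : set I) :
  (forall i, measurable [set t | c t = i]) -> measurable [set t | Q (c t)].
Proof.
move=> mc; apply: (measurable_countable_fiber (A := fun i => [set _ | Q i])) => // i.
by case: (pselect (Q i)) => Qi; [rewrite (_ : [set _ | _] = setT)|rewrite (_ : [set _ | _] = set0)] => //;
  apply/seteqP; split.
Qed.

End measurable_countable.

(** A path lists the successive splits: word of the split cell, hyperplane, waiting time before the
    split. Both processes will be written as functions of such a path. *)
Definition path_space (R : realType) (l : nat) : Type :=
  nat -> word * hyperplane R l * R.

HB.instance Definition _ R l := gen_eqMixin (path_space R l).
HB.instance Definition _ R l := gen_choiceMixin (path_space R l).
HB.instance Definition _ R l := isPointed.Build (path_space R l) (fun=> ([::], point, 0)).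

(** * The leaves of the tree after successive splits *)

Section word_trees.

Fixpoint leaves (ws : nat -> word) (n : nat) : seq word :=
  if n is m.+1 then [:: false :: ws m, true :: ws m & rem (ws m) (leaves ws m)]
  else [:: [::]].

Definition valid_words (ws : nat -> word) n := forall i, (i < n)%N -> ws i \in leaves ws i.

Lemma valid_wordsS ws n : valid_words ws n.+1 -> valid_words ws n /\ ws n \in leaves ws n.
Proof. by move=> v; split => [i iN|]; [apply: v; exact: ltnW|exact: v]. Qed.

Lemma valid_words_le ws m n : (m <= n)%N -> valid_words ws n -> valid_words ws m.
Proof. by move=> mn v i im; apply: v; exact: leq_trans mn. Qed.

(** The three facts need each other: a successor of a leaf cannot already be a leaf, as its
    predecessor would then have been split before. They imply that no word is split twice and that
    the cell of a leaf is final. *)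
Lemma leaves_invariant ws n : valid_words ws n ->
  [/\ uniq (leaves ws n),
      (forall e f, e \in leaves ws n -> f \in ancestors e -> exists2 i, (i < n)%N & f = ws i) &
      (forall i, (i < n)%N -> ws i \notin leaves ws n)].
Proof.
elim/ltn_ind: n => -[_ _|n ih]; first by split => // e f; rewrite inE => /eqP ->.
move=> /valid_wordsS[v wn]; have [u a w] := ih n (ltnSn n) v.
have fresh b : b :: ws n \notin leaves ws n.
  apply/negP => wb; have [|i iN wi] := a (b :: ws n) (ws n) wb; first by rewrite /= mem_head.
  by have := w i iN; rewrite -wi wn.
have awn f : f \in ancestors (ws n) -> exists2 i, (i < n.+1)%N & f = ws i.
  by move=> fw; have [i iN ->] := a _ _ wn fw; exists i => //; exact: ltnW.
have aa b f : f \in ancestors (b :: ws n) -> exists2 i, (i < n.+1)%N & f = ws i.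
  by rewrite /= inE => /orP[/eqP ->|]; [exists n|exact: awn].
split => /=.
- have nf b : b :: ws n \notin rem (ws n) (leaves ws n).
    by apply/negP => /mem_rem; apply/negP; exact: fresh.
  by rewrite rem_uniq// andbT inE negb_or !nf.
- move=> e f; rewrite !inE => /orP[/eqP ->|/orP[/eqP ->|/mem_rem en]]; [exact: aa|exact: aa|].
  by move=> fe; have [i iN ->] := a _ _ en fe; exists i => //; exact: ltnW.
- move=> i; rewrite ltnS leq_eqVlt => iN.
  have ib b : ws i != b :: ws n.
    apply/negP => /eqP wi; case/orP: iN => [/eqP iN|iN].
      by move: wi; rewrite iN => /(congr1 size) /= /eqP; rewrite eqn_leq ltnn andbF.
    have [_ ai _] := ih i (ltnW iN) (valid_words_le (ltnW iN) v).
    have [|j ji wj] := ai (ws i) (ws n) (v i iN); first by rewrite wi /= mem_head.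
    by have := w j (ltn_trans ji iN); rewrite -wj wn.
  rewrite !inE !(negPf (ib _)) /=.
  case/orP: iN => [/eqP ->|iN]; first by rewrite mem_rem_uniqF.
  by apply/negP => /mem_rem; apply/negP; exact: w.
Qed.

Lemma valid_words_inj ws n i j : valid_words ws n -> (i < n)%N -> (j < n)%N -> ws i = ws j -> i = j.
Proof.
move=> v iN jN wij; wlog ij : i j iN jN wij / (i < j)%N.
  by move=> h; case: (ltngtP i j) => // ij; [exact: h|apply/esym; exact: h].
have [_ _ /(_ i ij)] := leaves_invariant (valid_words_le (ltnW jN) v).
by rewrite wij v.
Qed.

Lemma size_leaves ws n : valid_words ws n -> size (leaves ws n) = n.+1.
Proof.
elim: n => // n ih /valid_wordsS[v wn] /=; rewrite size_rem// ih//.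
Qed.

Lemma eq_leaves ws ws' n : (forall i, (i < n)%N -> ws i = ws' i) -> leaves ws n = leaves ws' n.
Proof.
elim: n => //= n ih h; rewrite ih => [|i iN]; last by apply: h; exact: ltnW.
by rewrite h.
Qed.

End word_trees.

Section path_space_theory.
Context {R : realType} {l : nat}.
Local Notation V := 'rV[R]_l.+1.
Local Notation path := (path_space R l).
Implicit Types (x : path) (n i : nat) (e f : word).

Definition pword x i : word := (x i).1.1.
Definition phyp x i : hyperplane R l := (x i).1.2.
Definition pwait x i : R := (x i).2.

(** Words form a countable set and carry all their subsets as events. The word, the hyperplane and
    the waiting time have separate generators, which keeps later verifications on generators
    simple. *)
Definition coord_events i : set (set path) := [set A |
  [\/ exists Q : set word, A = [set x | Q (pword x i)],
      exists2 B, measurable B & A = [set x | B (phyp x i)] |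
      exists2 B, measurable B & A = [set x | B (pwait x i)]]].

Definition events_before n : set (set path) := \bigcup_(i in `I_n) coord_events i.
Definition path_gen : set (set path) := \bigcup_i coord_events i.

Definition path_before n := g_sigma_algebraType (events_before n).
Definition paths := g_sigma_algebraType path_gen.

Lemma events_before_sub n : events_before n `<=` (@measurable _ paths).
Proof. by move=> A [i _ Ai]; apply: sub_sigma_algebra; exists i. Qed.

Lemma events_before_le m n : (m <= n)%N -> events_before m `<=` events_before n.
Proof. by move=> mn A [i im Ai]; exists i => //; exact: leq_trans mn. Qed.

Lemma measurable_pword n i (Q : set word) : (i < n)%N ->
  measurable ([set x | Q (pword x i)] : set (path_before n)).
Proof.
by move=> iN; apply: sub_sigma_algebra; exists i => //; apply: Or31; exists Q.
Qed.

Lemma measurable_phyp n i : (i < n)%N ->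
  measurable_fun setT ((fun x => phyp x i) : path_before n -> hyperplane R l).
Proof.
move=> iN _ B mB; rewrite setTI; apply: sub_sigma_algebra; exists i => //.
by apply: Or32; exists B.
Qed.

Lemma measurable_pwait n i : (i < n)%N ->
  measurable_fun setT ((fun x => pwait x i) : path_before n -> R).
Proof.
move=> iN _ B mB; rewrite setTI; apply: sub_sigma_algebra; exists i => //.
by apply: Or33; exists B.
Qed.

Definition pwords n x : seq word := mkseq (pword x) n.

Lemma measurable_pwords n (ws : seq word) :
  measurable ([set x | pwords n x = ws] : set (path_before n)).
Proof.
have [sw|sw] := eqVneq (size ws) n; last first.
  rewrite (_ : [set x | _] = set0)//; apply/seteqP; split => x //= h.
  by move: sw; rewrite -h size_mkseq eqxx.
rewrite (_ : [set x | _] = \bigcap_(i in `I_n) [set x | pword x i = nth [::] ws i]).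
  apply: fin_bigcap_measurable => // i iN.
  exact: (measurable_pword (fun w => w = nth [::] ws i)).
apply/seteqP; split => x /=; first by move=> <- i iN; rewrite nth_mkseq.
move=> h; apply: (@eq_from_nth _ [::]); first by rewrite size_mkseq.
by move=> i; rewrite size_mkseq => iN; rewrite nth_mkseq// h.
Qed.

(** The hyperplane of the latest among the first [n] splits that was made at the given word, and a
    default where there was none; a total function of the word, as [tree_cell] expects. *)
Fixpoint hyp_at n x : word -> hyperplane R l :=
  if n is m.+1 then fun f => if f == pword x m then phyp x m else hyp_at m x f
  else fun=> point.

Lemma measurable_hyp_at n f :
  measurable_fun setT ((fun x => hyp_at n x f) : path_before n -> hyperplane R l).
Proof.
elim: n => [|n ih] /=; first exact: measurable_cst.
apply: measurable_fun_if => //.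
- apply: (measurable_fun_bool true); rewrite setTI.
  rewrite (_ : _ @^-1` _ = [set x | [set w | f == w] (pword x n)]); first exact: measurable_pword.
  by apply/seteqP; split.
- by apply: measurable_funTS; exact: measurable_phyp.
- apply: measurable_funTS.
  apply: (@measurable_fun_gen_le _ paths (events_before n)) => // A /events_before_le h.
  by apply: sub_sigma_algebra; exact: h.
Qed.

Definition pleaves n x := leaves (pword x) n.

Lemma measurable_pleaves n (E : seq word) :
  measurable ([set x | pleaves n x = E] : set (path_before n)).
Proof.
have := @measurable_countable_pred _ (path_before n) _ (pwords n)
  [set ws | leaves (nth [::] ws) n = E] (@measurable_pwords n).
congr measurable; apply/seteqP; split => x /=;
  by rewrite (@eq_leaves _ (pword x))// => i iN; rewrite nth_mkseq.
Qed.

Lemma hyp_atE n x i : valid_words (pword x) n -> (i < n)%N -> hyp_at n x (pword x i) = phyp x i.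
Proof.
elim: n => // n ih /[dup] v /valid_wordsS[v' wn].
rewrite ltnS leq_eqVlt /= => /orP[/eqP ->|iN]; first by rewrite eqxx.
case: eqP => [wi|_]; last exact: ih.
by have := valid_words_inj v (ltnW iN) (ltnSn n) wi => iE; rewrite iE ltnn in iN.
Qed.

End path_space_theory.

(** * The tessellations described by a path *)

Section path_tessellations.
Context {R : realType} {l : nat}.
Local Notation V := 'rV[R]_l.+1.
Local Notation path := (path_space R l).
Variable W : set V.
Hypothesis W_window : window W.
Implicit Types (x : path) (n i : nat) (e f : word).

Definition pcell n x e := tree_cell W (hyp_at n x) e.

Definition good n x := valid_words (pword x) n /\
  forall i, (i < n)%N -> cuts (pcell i x (pword x i)) (phyp x i) /\ 0 < pwait x i.

Definition ptess n x : set (set V) := [set pcell n x e | e in [set` pleaves n x]].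

Lemma goodS n x : good n.+1 x <-> [/\ good n x, pword x n \in pleaves n x,
  cuts (pcell n x (pword x n)) (phyp x n) & 0 < pwait x n].
Proof.
split=> [[/valid_wordsS[v wn] h]|[[v h] wn c p]].
  have [c p] := h n (ltnSn n); split => //; split => // i iN.
  by apply: h; exact: ltnW.
split=> i; rewrite ltnS leq_eqVlt => /orP[/eqP ->//|iN]; [exact: v|exact: h].
Qed.

Lemma good_le m n x : (m <= n)%N -> good n x -> good m x.
Proof.
move=> mn [v h]; split; first exact: valid_words_le v.
by move=> i im; apply: h; exact: leq_trans mn.
Qed.

(** The cell of a leaf involves only the hyperplanes of its ancestors, all of which were split
    before and none of which is split again. *)
Lemma pcell_stable n x e : valid_words (pword x) n.+1 -> e \in pleaves n x ->
  pcell n.+1 x e = pcell n x e.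
Proof.
move=> /valid_wordsS[v wn] en; apply: eq_tree_cell => f fe /=; case: eqP => // fw.
have [_ a w] := leaves_invariant v; have [i iN fi] := a _ _ en fe.
by have := w i iN; rewrite -fi fw wn.
Qed.

Lemma pcell_split n x b : valid_words (pword x) n.+1 ->
  pcell n.+1 x (b :: pword x n) = pcell n x (pword x n) `&` half b (phyp x n).
Proof.
move=> /[dup] v /valid_wordsS[_ wn].
rewrite /pcell /= -/(hyp_at n.+1 x) -/(pcell n.+1 x (pword x n)) pcell_stable//.
by rewrite eqxx.
Qed.

Let W_compact : compact W := polytope_compact W_window.1.

Lemma pcell_compact n x e : compact (pcell n x e).
Proof. exact: tree_cell_compact. Qed.

Lemma pcell_sub n x e : pcell n x e `<=` W.
Proof. exact: tree_cell_sub. Qed.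

Lemma pleavesS n x : pleaves n.+1 x =
  [:: false :: pword x n, true :: pword x n & rem (pword x n) (pleaves n x)].
Proof. by []. Qed.

Lemma good_window n x e : good n x -> e \in pleaves n x -> window (pcell n x e).
Proof.
elim: n e => [e _|n ih e /[dup] g /goodS[gn wn c p]]; first by rewrite inE => /eqP ->.
have hb b : window (pcell n.+1 x (b :: pword x n)).
  by rewrite pcell_split; [apply: window_cut => //; exact: ih|case: g].
rewrite pleavesS !inE => /orP[/eqP ->//|/orP[/eqP ->//|/mem_rem en]].
by rewrite pcell_stable; [exact: ih|case: g|].
Qed.

Lemma good_disjoint n x e f : good n x -> e \in pleaves n x -> f \in pleaves n x -> e != f ->
  interior (pcell n x e) `&` interior (pcell n x f) = set0.
Proof.
elim: n e f => [e f _|n ih e f /[dup] g /goodS[gn wn c p]].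
  by rewrite !inE => /eqP -> /eqP ->; rewrite eqxx.
have v : valid_words (pword x) n.+1 by case: g.
have [u _ _] := leaves_invariant (valid_wordsS v).1.
have rest b k : k \in rem (pword x n) (pleaves n x) ->
    interior (pcell n.+1 x (b :: pword x n)) `&` interior (pcell n.+1 x k) = set0.
  move=> /[dup] /mem_rem kn; rewrite mem_rem_uniq// inE => /andP[kw _].
  rewrite pcell_split// pcell_stable// -subset0 -(ih _ _ gn wn kn) 1?eq_sym//.
  by apply: setSI; apply: interiorS; exact: subIsetl.
have sib : interior (pcell n.+1 x (false :: pword x n)) `&`
    interior (pcell n.+1 x (true :: pword x n)) = set0.
  by rewrite !pcell_split//; exact: interior_halves.
rewrite pleavesS !inE.
move=> /orP[/eqP ->|/orP[/eqP ->|en]] /orP[/eqP ->|/orP[/eqP ->|fn]];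
  rewrite ?eqxx//; try by [rewrite rest|rewrite setIC rest|rewrite setIC].
move=> ef; rewrite !pcell_stable// ?(mem_rem en) ?(mem_rem fn)//.
by apply: ih => //; [exact: mem_rem en|exact: mem_rem fn].
Qed.

Lemma good_cover n x : good n x -> \bigcup_(e in [set` pleaves n x]) pcell n x e = W.
Proof.
elim: n => [_|n ih /[dup] g /goodS[gn wn c p]].
  by apply/seteqP; split => [y [e] //=|y Wy]; [rewrite inE => /eqP -> |exists [::]].
have v : valid_words (pword x) n.+1 by case: g.
rewrite -(ih gn); apply/seteqP; split => y [e /=].
  rewrite pleavesS !inE => /orP[/eqP ->|/orP[/eqP ->|/mem_rem en]].
  - by rewrite pcell_split// => -[? _]; exists (pword x n).
  - by rewrite pcell_split// => -[? _]; exists (pword x n).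
  - by rewrite pcell_stable// => ?; exists e.
move=> en ye; have [ew|ew] := eqVneq e (pword x n); last first.
  exists e; last by rewrite pcell_stable.
  by rewrite /= pleavesS !inE; apply/orP; right; apply/orP; right;
    rewrite mem_rem_uniq ?inE ?ew//; have [u _ _] := leaves_invariant (valid_wordsS v).1.
move: ye; rewrite ew -[X in X y](setI_halves (pcell n x (pword x n)) (phyp x n)) => -[yb|yb].
  by exists (false :: pword x n); [rewrite /= pleavesS mem_head|rewrite pcell_split].
by exists (true :: pword x n); [rewrite /= pleavesS inE mem_head orbT|rewrite pcell_split].
Qed.

Lemma pcell_inj n x e f : good n x -> e \in pleaves n x -> f \in pleaves n x ->
  pcell n x e = pcell n x f -> e = f.
Proof.
move=> g en fn ef; apply/eqP; apply: contrapT => /negP nef.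
have := good_disjoint g en fn nef; rewrite -ef setIid => i0.
by have [_ [y]] := good_window g en; rewrite i0.
Qed.

Lemma good_tessellation n x : good n x -> tessellation W (ptess n x).
Proof.
move=> g; split.
- exact: finite_image.
- by move=> _ [e en <-]; exact: good_window.
- move=> _ _ [e en <-] [f fn <-] h; congr (pcell n x _); apply/eqP; apply: contrapT => /negP nef.
  by move: h => [y yy]; have := good_disjoint g en fn nef; rewrite -subset0 => /(_ y yy).
- by rewrite bigcup_image good_cover.
Qed.

Lemma measurable_good n : measurable (good n : set (path_before n)).
Proof.
elim: n => [|n ih]; first by rewrite (_ : good 0 = setT)//; apply/seteqP; split.
have up A : measurable (A : set (path_before n)) -> measurable (A : set (path_before n.+1)).
  exact: (@gen_mono _ paths _ _ (events_before_le (leqnSn n))).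
rewrite (_ : good n.+1 = good n `&` [set x | pword x n \in pleaves n x] `&`
    ([set x | cuts (pcell n x (pword x n)) (phyp x n)] `&` [set x | 0 < pwait x n])); last first.
  by apply/seteqP; split => x; [move=> /goodS[]|move=> [[? ?] [? ?]]; apply/goodS].
have mw w : measurable ([set x | pword x n = w] : set (path_before n.+1)).
  exact: (measurable_pword (fun v => v = w)).
apply: measurableI; apply: measurableI.
- exact: up.
- apply: (@measurable_countable_fiber _ (path_before n.+1) _ (fun x => pword x n)
    (fun w => [set x | w \in pleaves n x])) => // w.
  apply: up; apply: (@measurable_countable_pred _ (path_before n) _ (pleaves n)
    (fun E => w \in E)) => E; exact: measurable_pleaves.
- apply: (@measurable_countable_fiber _ (path_before n.+1) _ (fun x => pword x n)
    (fun w => [set x | cuts (pcell n x w) (phyp x n)])) => // w.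
  apply: measurable_cuts_cell => //; last exact: measurable_phyp.
  move=> e; apply: (@measurable_fun_gen_le _ paths (events_before n)).
    by move=> A h; apply: sub_sigma_algebra; apply: events_before_le h.
  exact: measurable_hyp_at.
- by apply: measurable_gt_cst; exact: measurable_pwait.
Qed.

(** A generator requires the cell boundaries to avoid a compact set. Its complement is, for each
    list of leaves, a finite union of the events of [measurable_boundary_meets]. *)
Lemma measurable_ptess n :
  measurable_fun (good n : set (path_before n)) (ptess n : path_before n -> tess_space W).
Proof.
apply: (@measurability _ _ (path_before n) (tess_space W) _ _ (tess_generator W)) => //.
move=> _ [_ [A [cA AW] <-] <-].
rewrite (_ : _ `&` _ = good n `&` ~` [set x | exists2 e, e \in pleaves n x &
  boundary (pcell n x e) `&` A !=set0]).
  apply: measurableI; first exact: measurable_good.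
  apply: measurableC.
  apply: (@measurable_countable_fiber _ (path_before n) _ (pleaves n)
    (fun E => [set x | exists2 e, e \in E & boundary (pcell n x e) `&` A !=set0])).
    exact: measurable_pleaves.
  move=> E; rewrite (_ : [set x | _] = \bigcup_(e in [set` E])
     [set x | boundary (pcell n x e) `&` A !=set0]); last first.
    by apply/seteqP; split => x; move=> [e ? ?]; exists e.
  apply: fin_bigcup_measurable => // e _; apply: measurable_boundary_meets => //.
    exact: measurable_hyp_at.
  by apply: compact_closed => //; exact: norm_hausdorff.
apply/seteqP; split => x [g] /=.
  move=> [_ b0]; split => //; move=> [e en [y [ye Ay]]].
  suff : (tess_boundary (ptess n x) `&` A) y by rewrite b0.
  by split => //; exists (pcell n x e) => //; exists e.
move=> h; split => //; split; first exact: good_tessellation.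
rewrite -subset0 => y [[_ [e en <-] ye] Ay]; apply: h; exists e => //.
by exists y.
Qed.

End path_tessellations.

Lemma measurable_inv_ge0 d (T : measurableType d) (R : realType) (f : T -> R) :
  measurable_fun setT f -> (forall t, 0 <= f t) -> measurable_fun setT (fun t => (f t)^-1).
Proof.
move=> mf f0; rewrite (_ : (fun t => _) = (fun t => f t `^ (-1))).
  by apply: (measurableT_comp (measurable_powR (-1))).
by apply/funext => t; rewrite powR_inv1.
Qed.

(** * Intensities of the cells and the transition kernel *)

Section intensities.
Context {R : realType} {l : nat}.
Local Notation V := 'rV[R]_l.+1.
Local Notation path := (path_space R l).
Local Notation paths := (@paths R l).
Variable Lam : {measure set (hyperplane R l) -> \bar R}.
Hypothesis Lam_neq0 : Lam setT <> 0%E.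
Hypothesis Lam_inv : translation_invariant Lam.
Hypothesis Lam_fin : locally_finite Lam.
Variable W : set V.
Hypothesis W_window : window W.
Implicit Types (x : path) (n i : nat) (e f w : word) (C : set V).

Let W_compact : compact W := polytope_compact W_window.1.
Let mhW : measurable (hits W) := measurable_hits W_compact.

(** Only hyperplanes that hit [W] occur. There [Lam] is finite, so the measurability of sections for
    finite measures applies. *)
Lemma measurable_Lam_section d (T : measurableType d) (M : set (T * hyperplane R l)) :
  measurable M -> M `<=` [set p | hits W p.2] ->
  measurable_fun setT (fun t => Lam [set h | M (t, h)]).
Proof.
move=> mM MW.
pose LW : {finite_measure set (hyperplane R l) -> \bar R} :=
  mfrestr mhW (hits_ltoo Lam_fin W_compact).
rewrite (_ : (fun t => _) = (fun t => LW (xsection M t))).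
  exact: measurable_fun_xsection.
apply/funext => t; rewrite /LW /= /mfrestr /mrestr; congr (Lam _).
apply/seteqP; split => h /=.
  by move=> Mth; split; [exact: mem_set|exact: (MW (t, h))].
by move=> [/set_mem].
Qed.

Lemma measurable_Lam_hits d (T : measurableType d) (H : T -> word -> hyperplane R l) A e :
  (forall f, measurable_fun setT (H ^~ f)) -> measurable A ->
  measurable_fun setT (fun t => Lam (A `&` hits (tree_cell W (H t) e))).
Proof.
move=> mH mA.
apply: (measurable_Lam_section (M := [set p | A p.2 /\ hits (tree_cell W (H p.1) e) p.2])).
  apply: measurableI.
    by rewrite -[X in measurable X]setTI; exact: (measurable_snd measurableT).
  apply: (@measurable_hits_cell _ _ _ W_compact _ _ (fun p : T * hyperplane R l => H p.1)).
    by move=> f; exact: (measurableT_comp (mH f) measurable_fst).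
  exact: measurable_snd.
by move=> p [_]; apply: sub_hits; exact: tree_cell_sub.
Qed.

Lemma Lam_hits_fin C (A : set (hyperplane R l)) : compact C -> measurable A ->
  Lam (A `&` hits C) \is a fin_num.
Proof.
move=> cC mA; rewrite ge0_fin_numE//; apply: le_lt_trans (hits_ltoo Lam_fin cC).
apply: measure_mono; [apply: measurableI => //|..|exact: subIsetr]; exact: measurable_hits.
Qed.

Definition pzeta n x : \bar R := (\sum_(e <- pleaves n x) Lam (hits (pcell W n x e)))%E.
Definition zt n x : R := fine (pzeta n x).

Lemma pzeta_fin n x : pzeta n x \is a fin_num.
Proof.
rewrite /pzeta sum_fin_num; apply/allP => _ /mapP[e _ ->].
by have := Lam_hits_fin (@pcell_compact R l W W_window n x e) measurableT; rewrite setTI.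
Qed.

Lemma measurable_pzeta n : measurable_fun setT (pzeta n : path_before n -> \bar R).
Proof.
apply: (@measurable_fun_countable_fiber _ (path_before n) _ _ _ (pleaves n)
  (fun E x => \sum_(e <- E) Lam (hits (pcell W n x e)))%E).
  exact: measurable_pleaves.
move=> E; apply: emeasurable_sum => e.
have := @measurable_Lam_hits _ (path_before n) (@hyp_at R l n) setT e (@measurable_hyp_at R l n) measurableT.
by under eq_fun do rewrite setTI.
Qed.

Lemma measurable_zt n : measurable_fun setT (zt n : path_before n -> R).
Proof. by apply: measurableT_comp => //; exact: measurable_pzeta. Qed.

Lemma pcell_Lam_gt0 n x e : good W n x -> e \in pleaves n x ->
  (0 < Lam (hits (pcell W n x e)))%E.
Proof.
move=> g en; apply: hits_gt0 => //; first exact: pcell_compact.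
by have [] := good_window W_window g en.
Qed.

Lemma zt_gt0 n x : good W n x -> 0 < zt n x.
Proof.
move=> g; rewrite /zt fine_gt0//; apply/andP; split; last by rewrite -ge0_fin_numE ?pzeta_fin//; apply: sume_ge0.
rewrite /pzeta; have := size_leaves g.1; rewrite -/(pleaves n x).
case E : (pleaves n x) => [//|e s] _; rewrite big_cons.
apply: (@lt_le_trans _ _ (Lam (hits (pcell W n x e)))); last by rewrite leeDl// sume_ge0.
by apply: pcell_Lam_gt0 => //; rewrite E mem_head.
Qed.

(** There are n + 1 leaves, and each of their cells lies in [W]. This linear growth is what prevents
    infinitely many splits in finite time. *)
Lemma zt_le n x : good W n x -> zt n x <= n.+1%:R * fine (Lam (hits W)).
Proof.
move=> g; have WF : Lam (hits W) \is a fin_num.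
  by have := Lam_hits_fin W_compact measurableT; rewrite setTI.
rewrite -lee_fin EFinM !fineK ?pzeta_fin// /pzeta.
apply: (@le_trans _ _ (\sum_(e <- pleaves n x) Lam (hits W))%E).
  apply: lee_sum => e _; apply: measure_mono => //.
    exact: (measurable_hits (@pcell_compact R l W W_window n x e)).
  by apply: sub_hits; exact: pcell_sub.
rewrite -{1}(fineK WF) sumEFin big_const_seq count_predT (size_leaves g.1).
by rewrite iter_addr_0 -[X in (X * _)%E]/(n.+1%:R%:E) -{2}(fineK WF) -EFinM lee_fin mulr_natl.
Qed.

(** Distinct leaves have distinct cells, since the interiors are nonempty and disjoint; sums over
    the tessellation, a set, are therefore sums over the list of leaves. *)
Lemma fsum_ptess n x (F : set V -> \bar R) : good W n x ->
  (\sum_(C \in ptess W n x) F C)%E = (\sum_(e <- pleaves n x) F (pcell W n x e))%E.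
Proof.
move=> g; rewrite fsbig_image; last first.
  by move=> e f /set_mem /= en /set_mem /= fn; exact: (pcell_inj W_window g en fn).
by rewrite -fsbig_seq//; have [] := leaves_invariant g.1.
Qed.

Lemma zeta_ptess n x : good W n x -> zeta Lam (ptess W n x) = zt n x.
Proof. by move=> g; rewrite /zeta fsum_ptess. Qed.

Lemma Gam_ptess n x A : good W n x ->
  Gam Lam (ptess W n x) A = (\sum_(e <- pleaves n x) Lam (A `&` hits (pcell W n x e)))%E.
Proof. by move=> g; rewrite /Gam fsum_ptess. Qed.

(* Conditionally on the first [n] splits, the probability that the next one   *)
(* is of the cell [w], by a hyperplane in [A], after a waiting time > [s].    *)
Definition kern n w (A : set (hyperplane R l)) (s : R) x : \bar R :=
  if w \in pleaves n x
  then (Lam (A `&` hits (pcell W n x w)) * ((zt n x)^-1 * expR (- (s * zt n x)))%:E)%E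
  else 0%E.

Lemma zt_ge0 n x : 0 <= zt n x.
Proof. by rewrite /zt fine_ge0// /pzeta sume_ge0. Qed.

Lemma kern_ge0 n w A s x : (0 <= kern n w A s x)%E.
Proof.
rewrite /kern; case: ifP => // _; rewrite mule_ge0// lee_fin mulr_ge0 ?expR_ge0//.
by rewrite invr_ge0 zt_ge0.
Qed.

Lemma measurable_kern n w A s : measurable A ->
  measurable_fun setT (kern n w A s : path_before n -> \bar R).
Proof.
move=> mA; apply: measurable_fun_if => //.
- apply: (measurable_fun_bool true); rewrite setTI.
  apply: (@measurable_countable_pred _ (path_before n) _ (pleaves n) (fun E => w \in E)).
  exact: measurable_pleaves.
- apply: measurable_funTS; apply: emeasurable_funM.
    by apply: measurable_Lam_hits => //; exact: measurable_hyp_at.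
  apply/measurable_EFinP; apply: measurable_funM.
    by apply: measurable_inv_ge0; [exact: measurable_zt|exact: zt_ge0].
  apply: measurableT_comp => //; apply: measurable_funN; apply: measurable_funM => //.
  exact: measurable_zt.
Qed.

Definition cylinder n w (A : set (hyperplane R l)) (s : R) : set path :=
  [set x | [/\ pword x n = w, A (phyp x n) & s < pwait x n]].

Lemma measurable_setI_cylinder n (D : set path) w (A : set (hyperplane R l)) s :
  measurable (D : set (path_before n)) -> measurable A ->
  measurable (D `&` cylinder n w A s : set (path_before n.+1)).
Proof.
move=> mD mA; apply: measurableI.
  by apply: (@gen_mono _ paths _ _ _ _ mD); exact: events_before_le.
rewrite (_ : cylinder _ _ _ _ = [set x | pword x n = w] `&`
   ([set x | A (phyp x n)] `&` [set x | s < pwait x n])); last first.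
  by apply/seteqP; split => x /=; [move=> []|move=> [? []]].
apply: measurableI; first exact: (measurable_pword (fun e => e = w)).
apply: measurableI; rewrite -[X in measurable X]setTI; first exact: measurable_phyp.
have -> : [set x | s < pwait x n] = (fun x : path => pwait x n) @^-1` `]s, +oo[%classic.
  by apply/seteqP; split => x /=; rewrite in_itv/= andbT.
exact: measurable_pwait.
Qed.

(** The property shared by the laws of both paths: given a good past, [kern] is the conditional
    probability of each cylinder of the next split. Waiting times are tested through their tails. *)
Definition split_chain (mu : {measure set paths -> \bar R}) : Prop :=
  forall n (D : set path) w A s, measurable (D : set (path_before n)) -> D `<=` good W n ->
    measurable A -> 0 <= s ->
    mu (D `&` cylinder n w A s) = (\int[mu]_(x in (D : set paths)) kern n w A s x)%E.

End intensities.

(** * The kernels determine the law of the path *)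

Section path_law.
Context {R : realType} {l : nat}.
Local Notation V := 'rV[R]_l.+1.
Local Notation path := (path_space R l).
Local Notation paths := (@paths R l).
Variable Lam : {measure set (hyperplane R l) -> \bar R}.
Hypothesis Lam_fin : locally_finite Lam.
Variable W : set V.
Hypothesis W_window : window W.
Implicit Types (x : path) (n i : nat) (e f w : word).

Lemma measurable_before_path n A : measurable (A : set (@path_before R l n)) -> measurable (A : set paths).
Proof. by apply: (@gen_sub_measurable _ paths); exact: events_before_sub. Qed.

Lemma measure_setI_full d (T : measurableType d) (mu : probability T R) (F A : set T) :
  measurable F -> measurable A -> mu F = 1%E -> mu (A `&` F) = mu A.
Proof.
move=> mF mA muF; rewrite -[in RHS](setIT A) -(setUv F) setIUr measureU//; last 3 first.
- exact: measurableI.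
- by apply: measurableI => //; exact: measurableC.
- by rewrite setIACA setICr setI0.
rewrite [X in (_ + X)%E](_ : _ = 0%E) ?adde0//.
apply/eqP; rewrite eq_le measure_ge0 andbT.
apply: (@le_trans _ _ (mu (~` F))).
  by apply: measure_mono; [apply: measurableI => //; exact: measurableC|exact: measurableC|exact: subIsetr].
have := probability_setC mu mF; rewrite muF => ->; by rewrite subee.
Qed.

Variables mu1 mu2 : probability paths R.
Hypothesis mu_good : forall n, mu1 (good W n) = 1%E /\ mu2 (good W n) = 1%E.
Hypothesis mu_chain : split_chain Lam W mu1 /\ split_chain Lam W mu2.

Let mgood n : measurable (good W n : set paths).
Proof. by apply: measurable_before_path; exact: measurable_good. Qed.

Let mcoordw n (Q : set word) : measurable ([set x | Q (pword x n)] : set paths).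
Proof. by apply: (@measurable_before_path n.+1); exact: measurable_pword. Qed.

Let mcoordh n : measurable_fun setT ((fun x => phyp x n) : paths -> hyperplane R l).
Proof.
apply: (@measurable_fun_gen _ paths (events_before n.+1)); first exact: events_before_sub.
exact: measurable_phyp.
Qed.

Let mcoords n : measurable_fun setT ((fun x => pwait x n) : paths -> R).
Proof.
apply: (@measurable_fun_gen _ paths (events_before n.+1)); first exact: events_before_sub.
exact: measurable_pwait.
Qed.

Let pi_events n : set (set path) := [set A | exists D Q A1 B,
  [/\ measurable (D : set (@path_before R l n)), measurable A1, measurable B &
   A = D `&` ([set x | Q (pword x n)] `&` ([set x | A1 (phyp x n)] `&` [set x | B (pwait x n)]))]].

Let coord_sub n A1 B (D : set paths) Q : measurable D -> measurable A1 -> measurable B ->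
  measurable (D `&` ([set x | Q (pword x n)] `&` ([set x | A1 (phyp x n)] `&` [set x | B (pwait x n)])) : set paths).
Proof.
move=> mD mA mB; apply: measurableI => //; apply: measurableI; first exact: mcoordw.
apply: measurableI; rewrite -[X in measurable X]setTI; [exact: mcoordh|exact: mcoords].
Qed.

Let agree n := forall A, measurable (A : set (@path_before R l n)) -> mu1 A = mu2 A.

(** The kernel of split [n] is a function of the past. As both laws agree on the past, they give it
    the same integral. *)
Let agree_tail n D w A1 (s : R) : agree n -> measurable (D : set (@path_before R l n)) ->
  D `<=` good W n -> measurable A1 ->
  mu1 (D `&` cylinder n w A1 s) = mu2 (D `&` cylinder n w A1 s).
Proof.
move=> ag mD Dg mA1.
have mcyl r : measurable (cylinder n w A1 r : set paths).
  rewrite (_ : cylinder n w A1 r = setT `&` ([set x | [set w] (pword x n)] `&` ([set x | A1 (phyp x n)] `&`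
     [set x | `]r, +oo[%classic (pwait x n)]))); first exact: coord_sub.
  by apply/seteqP; split => x /=; rewrite in_itv/= andbT; [move=> []|move=> [_ [? []]]].
have mD' := measurable_before_path mD.
have pos r : 0 <= r -> mu1 (D `&` cylinder n w A1 r) = mu2 (D `&` cylinder n w A1 r).
  move=> r0; rewrite mu_chain.1// mu_chain.2//.
  apply: (@measure_eq_gen_integral _ paths R (events_before n)) => //.
  - exact: events_before_sub.
  - by apply: measurable_kern.
  - by move=> x; exact: kern_ge0.
have [s0|s0] := leP 0 s; first exact: pos.
(* Waiting times are positive on good paths, so a negative tail level may be replaced by 0. *)
have red (mu : probability paths R) : mu (good W n.+1) = 1%E ->
    mu (D `&` cylinder n w A1 s) = mu (D `&` cylinder n w A1 0).
  move=> g1; rewrite -(measure_setI_full (mgood n.+1) _ g1); last exact: measurableI.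
  rewrite -[RHS](measure_setI_full (mgood n.+1) _ g1); last exact: measurableI.
  congr (mu _); apply/seteqP; split => x /= [[Dx [xw xA xs]] g]; split => //; split => //; split => //.
    by have /goodS[] := g.
  exact: lt_trans xs.
by rewrite !red ?(mu_good n.+1).1 ?(mu_good n.+1).2// pos.
Qed.

(** Tails form a pi-system that generates the Borel sets of waiting times. *)
Let agree_word n D w A1 B : agree n -> measurable (D : set (@path_before R l n)) ->
  D `<=` good W n -> measurable A1 -> measurable B ->
  let X := D `&` ([set x | pword x n = w] `&` ([set x | A1 (phyp x n)] `&` [set x | B (pwait x n)])) in
  mu1 X = mu2 X.
Proof.
move=> ag mD Dg mA1 mB X.
have mD' := measurable_before_path mD.
pose Y : set paths := D `&` ([set x | pword x n = w] `&` [set x | A1 (phyp x n)]).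
have mY : measurable Y.
  apply: measurableI => //; apply: measurableI; first exact: (@mcoordw n [set w]).
  by rewrite -[X in measurable X]setTI; exact: mcoordh.
pose m (mu : probability paths R) : {measure set R -> \bar R} :=
  @measure_function_pushforward__canonical__measure_function_Measure _ _ _ _ _
    (mrestr mu mY) _ (mcoords n).
have mE (mu : probability paths R) C : m mu C = mu ([set x | C (pwait x n)] `&` Y) by [].
have XE (C : set R) : [set x | C (pwait x n)] `&` Y =
    D `&` ([set x | pword x n = w] `&` ([set x | A1 (phyp x n)] `&` [set x | C (pwait x n)])).
  by apply/seteqP; split => x /=; [move=> [? [? []]]|move=> [? [? []]]].
suff : m mu1 B = m mu2 B by rewrite !mE XE.
apply: (measure_unique (@RGenOInfty.G R) (fun k : nat => `](- k%:R), +oo[%classic)) => //.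
- exact: RGenOInfty.measurableE.
- move=> _ _ [a ->] [b ->]; exists (Num.max a b).
  by apply/seteqP; split => y /=; rewrite !in_itv/= !andbT gt_max; [move=> [-> ->]|move=> /andP].
- by move=> k; exists (- k%:R).
- rewrite -subTset => y _; exists (Num.truncn `|y|).+1 => //=.
  rewrite in_itv/= andbT ltrNl; apply: le_lt_trans (truncnS_gt `|y|).
  by rewrite -normrN ler_norm.
- move=> _ [s ->]; rewrite !mE.
  have -> : [set x | `]s, +oo[%classic (pwait x n)] `&` Y = D `&` cylinder n w A1 s.
    by apply/seteqP; split => x /=; rewrite in_itv/= andbT; [move=> [? [? []]]|move=> [? []]].
  exact: agree_tail.
- move=> k; rewrite mE; apply: (@le_lt_trans _ _ 1%E); last exact: ltry.
  by apply: probability_le1; rewrite XE; exact: (@coord_sub n A1 _ D [set w]).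
Qed.

(** The next word takes countably many values; each value is covered by [agree_word]. *)
Let agree_pi n A : agree n -> pi_events n A -> mu1 A = mu2 A.
Proof.
move=> ag [D [Q [A1 [B [mD mA1 mB ->]]]]].
have mD' := measurable_before_path mD.
pose S w : set paths := (D `&` good W n) `&` ([set x | pword x n = w] `&` ([set x | A1 (phyp x n)] `&` [set x | B (pwait x n)])).
pose F (k : nat) : set paths :=
  if @pickle_inv (seq bool) k is Some w then if `[< Q w >] then S w else set0 else set0.
set X := D `&` _.
have mF k : measurable (F k).
  rewrite /F; case: pickle_inv => // w; case: ifP => // _.
  by apply: (@coord_sub n A1 B _ [set w]) => //; exact: measurableI.
have FE k x : F k x -> k = choice.pickle (pword x n) /\ X x /\ good W n x.
  rewrite /F; have := @pickle_invK (seq bool) k.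
  case: pickle_inv => //= w <-; case: asboolP => // Qw [[Dx gx] [/= wE h]].
  by rewrite wE; split => //; split => //; split => //; split; rewrite /= ?wE.
have XF : X `&` good W n = \bigcup_k F k.
  apply/seteqP; split => x /=; last by move=> [k _ /FE[]].
  move=> [[Dx [Qx Ax]] gx]; exists (choice.pickle (pword x n)) => //.
  by rewrite /F pickleK_inv asboolT.
have tF : trivIset setT F by move=> i j _ _ [x [/FE[-> _] /FE[-> _]]].
have mX : measurable (X : set paths) by exact: coord_sub.
rewrite -(measure_setI_full (mgood n) mX (mu_good n).1) -(measure_setI_full (mgood n) mX (mu_good n).2).
rewrite XF !measure_semi_bigcup//; try exact: bigcupT_measurable.
apply: eq_eseriesr => k _; rewrite /F; case: pickle_inv => [w|]; last by rewrite !measure0.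
case: ifP => _; last by rewrite !measure0.
apply: (@agree_word n (D `&` good W n) w A1 B) => //.
by apply: measurableI => //; exact: measurable_good.
Qed.

Let agree_all n : agree n.
Proof.
elim: n => [|n ih].
  move=> A A0; apply: (@measure_eq_gen _ paths R [set setT]) => //.
  - by move=> _ ->.
  - by move=> _ _ -> ->; rewrite setIT.
  - by move=> _ ->; exact: (etrans (probability_setT mu1) (esym (probability_setT mu2))).
  - by rewrite ltey_eq fin_num_measure.
  - apply: (@gen_le_gen _ paths _ _ _ A A0) => B [i]; by rewrite /= ltn0.
have piT : pi_events n setT.
  exists setT, setT, setT, setT; split => //.
  by apply/seteqP; split.
move=> A mA; apply: (@measure_eq_gen _ paths R (pi_events n)) => //.
- by move=> _ [D [Q [A1 [B [mD mA1 mB ->]]]]]; apply: coord_sub => //; exact: measurable_before_path.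
- move=> _ _ [D [Q [A1 [B [mD mA1 mB ->]]]]] [D' [Q' [A1' [B' [mD' mA1' mB' ->]]]]].
  exists (D `&` D'), (Q `&` Q'), (A1 `&` A1'), (B `&` B'); split; try exact: measurableI.
  by apply/seteqP; split => x /=; [move=> [[? [? [? ?]]] [? [? [? ?]]]]|
    move=> [[? ?] [[? ?] [[? ?] [? ?]]]]].
- by move=> B; exact: agree_pi.
- by rewrite ltey_eq fin_num_measure.
- apply: (@gen_le_gen _ paths _ _ _ A mA) => B [i]; rewrite /= ltnS leq_eqVlt => /orP[/eqP ->|iN] Bi.
    apply: sub_sigma_algebra; case: Bi => [[Q ->]|[A1 mA1 ->]|[A1 mA1 ->]].
    + by exists setT, Q, setT, setT; split => //; apply/seteqP; split => x //= [_ []].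
    + by exists setT, setT, A1, setT; split => //; apply/seteqP; split => x //= [_ [_ []]].
    + by exists setT, setT, setT, A1; split => //; apply/seteqP; split => x //= [_ [_ [_]]].
  apply: sub_sigma_algebra; exists B, setT, setT, setT; split => //.
    by apply: sub_sigma_algebra; exists i.
  by apply/seteqP; split => x //= [].
Qed.

(** By induction on n the two laws agree on the events of the first n splits, the kernel giving the
    passage from n to n + 1. Events of finitely many splits form a pi-system that generates all
    events of paths. *)
Theorem split_chain_unique (A : set paths) : measurable A -> mu1 A = mu2 A.
Proof.
pose G : set (set path) := fun A0 => exists n, @measurable _ (@path_before R l n) A0.
move=> mA; apply: (@measure_eq_gen _ paths R G) => //.
- by move=> B [n]; exact: measurable_before_path.
- move=> B C [n mB] [m mC]; exists (maxn n m).
  apply: measurableI; [apply: (@gen_mono _ paths _ _ _ B mB)|apply: (@gen_mono _ paths _ _ _ C mC)];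
    apply: events_before_le; [exact: leq_maxl|exact: leq_maxr].
- by exists 0%N.
- by move=> B [n]; exact: agree_all.
- by rewrite ltey_eq fin_num_measure.
- apply: (@gen_le_gen _ paths _ _ _ A mA) => B [i _ Bi]; apply: sub_sigma_algebra.
  by exists i.+1; apply: sub_sigma_algebra; exists i => //=.
Qed.

End path_law.

(** * From paths to tessellation-valued processes *)

Section path_process.
Context {R : realType} {l : nat}.
Local Notation V := 'rV[R]_l.+1.
Local Notation path := (path_space R l).
Local Notation paths := (@paths R l).
Variable W : set V.
Hypothesis W_window : window W.
Implicit Types (x : path) (n i : nat) (t : R).

Definition ptime n x : R := \sum_(i < n) pwait x i.

Definition path_process x t : set (set V) :=
  \bigcup_(n in [set n | ptime n x <= t < ptime n.+1 x]) ptess W n x.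

Definition good_path x := (forall n, good W n x) /\ forall M : nat, exists n, M%:R < ptime n x.

Lemma ptimeS n x : ptime n.+1 x = ptime n x + pwait x n.
Proof. by rewrite /ptime big_ord_recr. Qed.

Lemma ptime_lt m n x : (forall n, good W n x) -> (m < n)%N -> ptime m x < ptime n x.
Proof.
move=> g; elim: n => // n ih; rewrite ltnS leq_eqVlt ptimeS => /orP[/eqP ->|mn].
  by rewrite ltrDl; have /goodS[] := g n.+1.
by apply: (lt_trans (ih mn)); rewrite ltrDl; have /goodS[] := g n.+1.
Qed.

(** The split times increase strictly and are unbounded, so exactly one interval between consecutive
    ones contains [t]. *)
Lemma good_path_process x t : good_path x -> 0 <= t ->
  exists2 n, ptime n x <= t < ptime n.+1 x & path_process x t = ptess W n x.
Proof.
move=> [g ex] t0.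
have [n tn] : exists n, t < ptime n x.
  have [n Mn] := ex (Num.truncn t).+1; exists n; exact: lt_trans (truncnS_gt t) Mn.
have [[|m] tm mmin] := ex_minnP (ex_intro (fun n => t < ptime n x) n tn).
  by move: tm; rewrite /ptime big_ord0 ltNge t0.
have mt : ptime m x <= t by rewrite leNgt; apply/negP => /mmin; rewrite ltnn.
exists m; first by rewrite mt.
apply/seteqP; split => C; last by move=> mC; exists m => //=; rewrite mt.
move=> [k /= /andP[kt tk] kC]; suff -> : m = k by [].
apply/eqP; rewrite eqn_leq; apply/andP; split; rewrite leqNgt; apply/negP => h.
  have [e|h'] := eqVneq k.+1 m.
    by move: tk; rewrite e ltNge mt.
  have := ptime_lt g (_ : (k.+1 < m)%N); rewrite ltn_neqAle h' h => /(_ isT) /lt_le_trans /(_ mt).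
  by rewrite ltNge ltW.
have [e|h'] := eqVneq m.+1 k.
  by move: tm; rewrite e ltNge kt.
have := ptime_lt g (_ : (m.+1 < k)%N); rewrite ltn_neqAle h' h => /(_ isT) /lt_le_trans /(_ kt).
by rewrite ltNge ltW.
Qed.

Lemma good_path_tess x : good_path x -> tess_paths W (path_process x).
Proof.
move=> g t t0; have [n _ ->] := good_path_process g t0.
by apply: good_tessellation => //; case: g.
Qed.

Lemma measurable_ptime n : measurable_fun setT (ptime n : paths -> R).
Proof.
apply: measurable_sum => i.
apply: (@measurable_fun_gen _ paths (events_before i.+1)); first exact: events_before_sub.
exact: measurable_pwait.
Qed.

Lemma measurable_good_path : measurable (good_path : set paths).
Proof.
rewrite (_ : good_path = \bigcap_n (good W n : set paths) `&`
  \bigcap_(M : nat) \bigcup_n [set x | M%:R < ptime n x]); last first.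
  apply/seteqP; split => x.
    by move=> [g ex]; split => [n _ //|M _]; have [n] := ex M; exists n.
  by move=> [g ex]; split => [n|M]; [exact: g|have [n _] := ex M I; exists n].
apply: measurableI.
  apply: bigcapT_measurable => n.
  by apply: (@gen_sub_measurable _ paths _ (@events_before_sub R l n)); exact: measurable_good.
apply: bigcapT_measurable => M; apply: bigcupT_measurable => n.
by apply: measurable_gt_cst; exact: measurable_ptime.
Qed.

(** The sets of trajectories with measurable preimage form a sigma-algebra relative to [tess_paths];
    complements are taken within it, which good paths allow because they give tessellations at all
    times. For a single time, one sums over the number of splits made so far. *)
Lemma measurable_path_process (A : set (R -> set (set V))) : path_events W A ->
  measurable (good_path `&` [set x | A (path_process x)] : set paths).
Proof.
pose C : set (set (R -> set (set V))) :=
  [set A | measurable (good_path `&` [set x | A (path_process x)] : set paths)].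
suff : path_events W `<=` C by apply.
apply: smallest_sub.
  split.
  - by rewrite /C /= (_ : good_path `&` _ = set0)//; apply/seteqP; split => x // [].
  - move=> B CB; rewrite /C /= (_ : good_path `&` _ =
        good_path `\` (good_path `&` [set x | B (path_process x)])).
      by apply: measurableD => //; exact: measurable_good_path.
    apply/seteqP; split => x /= [g].
      by move=> [_ nB]; split => // -[].
    move=> h; split => //; split; first exact: good_path_tess.
    by move=> Bx; apply: h.
  - move=> F CF; rewrite /C /= (_ : good_path `&` _ =
        \bigcup_n (good_path `&` [set x | F n (path_process x)])).
      exact: bigcupT_measurable.
    apply/seteqP; split => x /=; first by move=> [g [n _ Fx]]; exists n.
    by move=> [n _ [g Fx]]; split => //; exists n.
move=> _ [t [B [t0 mB ->]]]; rewrite /C /=.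
rewrite (_ : good_path `&` _ = good_path `&` \bigcup_n
   ([set x | ptime n x <= t] `&` [set x | t < ptime n.+1 x] `&` (good W n `&` ptess W n @^-1` B))).
  apply: measurableI; first exact: measurable_good_path.
  apply: bigcupT_measurable => n; apply: measurableI.
    apply: measurableI; last by apply: measurable_gt_cst; exact: measurable_ptime.
    rewrite (_ : [set x | _] = ~` [set x | t < ptime n x]).
      by apply: measurableC; apply: measurable_gt_cst; exact: measurable_ptime.
    by apply/seteqP; split => x /=; rewrite leNgt => /negP.
  apply: (@gen_sub_measurable _ paths _ (@events_before_sub R l n)).
  apply: measurable_ptess => //; exact: measurable_good.
apply/seteqP; split => x /= [g].
  move=> [_ Bx]; split => //; have [n /andP[nt tn] nE] := good_path_process g t0.
  exists n => //; split => //; split; first by case: g.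
  by rewrite /= -nE.
move=> [n _ [[nt tn] [gn Bn]]]; split => //; split; first exact: good_path_tess.
have [m /andP[mt tm] ->] := good_path_process g t0.
suff -> : m = n by [].
apply/eqP; rewrite eqn_leq; apply/andP; split; rewrite leqNgt; apply/negP => h.
  have [e|h'] := eqVneq n.+1 m; first by move: tn; rewrite e /= ltNge mt.
  have := ptime_lt g.1 (_ : (n.+1 < m)%N); rewrite ltn_neqAle h' h => /(_ isT) /lt_le_trans /(_ mt).
  by rewrite ltNge ltW.
have [e|h'] := eqVneq m.+1 n; first by move: tm; rewrite e /= ltNge nt.
have := ptime_lt g.1 (_ : (m.+1 < n)%N); rewrite ltn_neqAle h' h => /(_ isT) /lt_le_trans /(_ nt).
by rewrite ltNge ltW.
Qed.

(** Up to null sets, the event for either process is the preimage of one and the same measurable set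
    of good paths. *)
Lemma same_law_paths d (Om : measurableType d) (P : probability Om R)
    d' (Om' : measurableType d') (P' : probability Om' R)
    (Y : R -> Om -> set (set V)) (Y' : R -> Om' -> set (set V))
    (X : {mfun Om >-> paths}) (X' : {mfun Om' >-> paths}) :
  {ae P, forall w, good_path (X w) /\ Y ^~ w = path_process (X w)} ->
  {ae P', forall w, good_path (X' w) /\ Y' ^~ w = path_process (X' w)} ->
  (forall A : set paths, measurable A -> P (X @^-1` A) = P' (X' @^-1` A)) ->
  same_law W P Y P' Y'.
Proof.
move=> [N [mN N0 YN]] [N' [mN' N0' YN']] PP' A pA.
have mE := measurable_path_process pA.
set E := (_ `&` _) in mE.
exists (X @^-1` E), (X' @^-1` E); split; last exact: PP'.
- split; first by rewrite -[X in measurable X]setTI; exact: measurable_funP.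
  exists N; split => // w /= h; apply: YN => -[g Yw]; move: h; rewrite /E /= Yw.
  by case=> -[]; [move=> h1; apply|move=> [_ h1]; apply].
- split; first by rewrite -[X in measurable X]setTI; exact: measurable_funP.
  exists N'; split => // w /= h; apply: YN' => -[g Yw]; move: h; rewrite /E /= Yw.
  by case=> -[]; [move=> h1; apply|move=> [_ h1]; apply].
Qed.

End path_process.

Section rv_events.
Context d (T : measurableType d) (R : realType) (P : probability T R).
Context d' (Y : measurableType d').

Lemma events_of_preimage (X : {RV P >-> Y}) B : measurable B -> events_of X (X @^-1` B).
Proof. by move=> mB; exists B => //; rewrite setTI. Qed.

Lemma events_of_measurable (X : {RV P >-> Y}) : events_of X `<=` measurable.
Proof. by move=> _ [B mB <-]; exact: measurable_funP. Qed.

Lemma events_ofT (X : {RV P >-> Y}) : events_of X setT.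
Proof. by exists setT => //; rewrite setTI. Qed.

Lemma events_ofI (X : {RV P >-> Y}) : setI_closed (events_of X).
Proof.
move=> _ _ [B mB <-] [C mC <-]; exists (B `&` C); first exact: measurableI.
by rewrite preimage_setI !setTI.
Qed.

Context (I : choiceType) (F : I -> set (set T)).

Lemma measurable_rv_join (J : set I) i (X : {RV P >-> Y}) : J i -> F i = events_of X ->
  measurable_fun setT (X : g_sigma_algebraType (join_events F J) -> Y).
Proof.
move=> Ji FX _ B mB; rewrite setTI; apply: sub_sigma_algebra; exists i => //.
by rewrite FX; exact: events_of_preimage.
Qed.

Hypothesis Fm : forall i, F i `<=` measurable.
Hypothesis FT : forall i, F i setT.
Hypothesis FI : forall i, setI_closed (F i).
Hypothesis ind : mutually_independent P F.

Lemma indep_rv (J : set I) j (X : {RV P >-> Y}) : ~ J j -> F j = events_of X ->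
  forall A B, <<s join_events F J >> A -> measurable B ->
  P (A `&` X @^-1` B) = (P A * distribution P X B)%E.
Proof.
move=> Jj FX A B JA mB; rewrite (indep_join_events Fm FT FI ind Jj JA)//.
by rewrite FX; exact: events_of_preimage.
Qed.

Lemma indep_rv_integral (J : set I) j (X : {RV P >-> Y})
    (f : g_sigma_algebraType (join_events F J) * Y -> \bar R) :
  ~ J j -> F j = events_of X ->
  measurable_fun setT f -> (forall z, 0 <= f z)%E ->
  (\int[P]_w f (w, X w) = \int[P]_w \int[distribution P X]_y f (w, y))%E.
Proof.
move=> Jj FX mf f0.
apply: (@indep_integral _ T R P _ Y (distribution P X) (join_events F J) X) => //.
- exact: join_events_measurable.
- by move=> A B; exact: indep_rv FX A B.
Qed.

End rv_events.

Section indicators.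
Context d (T : measurableType d) (R : realType) (P : {measure set T -> \bar R}).
Local Open Scope ereal_scope.

Lemma integral_indicM (A : set T) (f : T -> \bar R) : measurable A ->
  \int[P]_w ((\1_A w)%:E * f w) = \int[P]_(w in A) f w.
Proof.
move=> mA; rewrite [RHS]integral_mkcond; apply: eq_integral => w _.
by rewrite patchE indicE; case: ifPn => _; rewrite ?mul1e ?mul0e.
Qed.

Lemma measure_indic_integral (A : set T) : measurable A -> P A = \int[P]_w (\1_A w)%:E.
Proof. by move=> mA; rewrite integral_indic// setIT. Qed.

End indicators.

(** * The construction from the global sequences *)

Section slots.
Context {R : realType}.
Implicit Types (L : seq word) (u : R) (w : word).

Lemma in_slot_uniq L u w w' : uniq L -> w \in L -> w' \in L ->
  in_slot L u w -> in_slot L u w' -> w = w'.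
Proof.
move=> uL wL w'L /andP[h1 h2] /andP[h3 h4].
have s0 : (0 < size L)%N by case: (L) wL.
have s0' : 0 < (size L)%:R :> R by rewrite ltr0n.
have ii : index w L = index w' L.
  have := le_lt_trans h1 h4; have := le_lt_trans h3 h2.
  rewrite !ltr_pM2r ?invr_gt0// !ltr_nat !ltnS => i1 i2.
  by apply/eqP; rewrite eqn_leq i1 i2.
by rewrite -(nth_index [::] wL) -(nth_index [::] w'L) ii.
Qed.

Lemma head_slot L u w : uniq L -> w \in L -> in_slot L u w ->
  [seq e <- L | in_slot L u e] = [:: w].
Proof.
move=> uL wL uw; have -> : [seq e <- L | in_slot L u e] = [seq e <- L | e == w].
  apply: eq_in_filter => e eL; apply/idP/eqP => [ue|-> //].
  exact: in_slot_uniq ue uw.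
by rewrite filter_pred1_uniq.
Qed.

Lemma exists_slot L u : uniq L -> L != [::] -> 0 <= u < 1 -> exists2 w, w \in L & in_slot L u w.
Proof.
move=> uL L0 /andP[u0 u1].
have s0 : (0 < size L)%N by rewrite lt0n size_eq0.
have s0' : 0 < (size L)%:R :> R by rewrite ltr0n.
have us : 0 <= u * (size L)%:R by rewrite mulr_ge0.
pose k := Num.truncn (u * (size L)%:R).
have /andP[k1 k2] := truncn_itv us.
have kL : (k < size L)%N.
  by rewrite -(ltr_nat R); apply: (le_lt_trans k1); rewrite gtr_pMl.
exists (nth [::] L k); first exact: mem_nth.
by rewrite /in_slot index_uniq// ler_pdivrMr// ltr_pdivlMr// k1 k2.
Qed.

Lemma measurable_slot L w : measurable [set u : R | in_slot L u w].
Proof.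
rewrite (_ : [set u | _] = `[(index w L)%:R / (size L)%:R, (index w L).+1%:R / (size L)%:R[%classic)//.
Qed.

Lemma uniform_prob_itv (a b : R) : 0 <= a -> a < b -> b <= 1 ->
  uniform_prob (@ltr01 R) `[a, b[%classic = (b - a)%:E.
Proof.
move=> a0 ab b1; rewrite /uniform_prob (eq_integral (fun=> 1%E)); last first.
  move=> x /set_mem /=; rewrite in_itv/= => /andP[ax xb]; rewrite /uniform_pdf.
  by rewrite (le_trans a0 ax) (le_trans (ltW xb) b1) subr0 invr1.
by rewrite integral_cst//= mul1e lebesgue_measure_itv/= lte_fin ab.
Qed.

Lemma uniform_slot L w : uniq L -> w \in L ->
  uniform_prob (@ltr01 R) [set u : R | in_slot L u w] = ((size L)%:R^-1)%:E.
Proof.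
move=> uL wL.
have s0 : (0 < size L)%N by case: (L) wL.
have s0' : 0 < (size L)%:R :> R by rewrite ltr0n.
pose a : R := (index w L)%:R / (size L)%:R; pose b : R := (index w L).+1%:R / (size L)%:R.
have ab : a < b by rewrite ltr_pM2r ?invr_gt0// ltr_nat.
have a0 : 0 <= a by rewrite divr_ge0.
have b1 : b <= 1 by rewrite ler_pdivrMr// mul1r ler_nat index_mem.
rewrite (_ : [set u | _] = `[a, b[%classic)// uniform_prob_itv//.
by rewrite -mulrBl -natrB// subSnn mul1r.
Qed.

End slots.

Lemma measurable_fun_pair_in d d1 d2 (T : measurableType d) (T1 : measurableType d1)
    (T2 : measurableType d2) (D : set T) (f : T -> T1) (g : T -> T2) :
  measurable_fun D f -> measurable_fun D g -> measurable_fun D (fun t => (f t, g t)).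
Proof.
move=> mf mg mD.
apply: (@measurability _ _ T (T1 * T2)%type D _ [set A `*` B | A in measurable & B in measurable]) => //.
  exact: measurable_prod_measurableType.
move=> _ [_ [A mA [B mB <-]] <-].
rewrite (_ : _ `&` _ = (D `&` f @^-1` A) `&` (D `&` g @^-1` B)).
  by apply: measurableI; [exact: mf|exact: mg].
by apply/seteqP; split => t /=; [move=> [? []]|move=> [[? ?] []]].
Qed.

Lemma measurable_section2 d1 d2 (T1 : measurableType d1) (T2 : measurableType d2)
    (M : set (T1 * T2)) t : measurable M -> measurable [set y | M (t, y)].
Proof.
move=> mM; have := measurable_xsection t mM; congr measurable.
by apply/seteqP; split => h /=; [move/set_mem|move/mem_set].
Qed.

Section countable_sums.
Context d (T : measurableType d) (R : realType) (mu : {measure set T -> \bar R}).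
Local Open Scope ereal_scope.

Lemma measure_bigcupT (F : nat -> set T) : (forall k, measurable (F k)) -> trivIset setT F ->
  mu (\bigcup_k F k) = \sum_(k <oo) mu (F k).
Proof. by move=> mF tF; rewrite measure_bigcup//; apply: eq_eseriesl => k; rewrite in_setT. Qed.

(** Lets probabilities be computed piecewise over the values of a countable variable, as is done
    with the list of hit cells and with the order of splits. *)
Lemma measure_pickle (I : countType) (c : T -> I) (A : set T) : measurable A ->
  (forall i, measurable [set t | c t = i]) ->
  mu A = \sum_(k <oo) mu (A `&` [set t | choice.pickle (c t) = k]).
Proof.
move=> mA mc; rewrite -measure_bigcupT.
- congr (mu _); apply/seteqP; split => t; last by move=> [k _ []].
  by move=> At; exists (choice.pickle (c t)).
- by move=> k; apply: measurableI => //; exact: (measurable_countable_pred (fun i => choice.pickle i = k)).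
- by move=> i j _ _ [t [[_ /= <-] [_ /= <-]]].
Qed.

End countable_sums.

Section conditional_laws.
Context d (T : measurableType d) (R : realType) (P : probability T R).
Local Open Scope ereal_scope.

Lemma integral_setI_full (D A : set T) (f : T -> \bar R) : measurable D -> P D = 1 ->
  measurable A -> measurable_fun A f -> (forall x, A x -> 0 <= f x) ->
  \int[P]_(x in A) f x = \int[P]_(x in A `&` D) f x.
Proof.
move=> mD PD mA mf f0; have mC := measurableC mD.
rewrite (@ge0_negligible_integral _ _ _ P _ (~` D) f mC mA)//; first by rewrite setDE setCK.
by have := probability_setC P mD; rewrite PD subee.
Qed.

(** Both sides are measures in [K] and the left one is finite, so agreement on a pi-system is
    enough. *)
Lemma conditional_pi_lambda (G : set (set T)) (B : set T) (q : T -> \bar R) :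
  G `<=` measurable -> setI_closed G -> G setT -> measurable B ->
  measurable_fun setT q -> (forall x, 0 <= q x) ->
  (forall K, G K -> P (K `&` B) = \int[P]_(x in K) q x) ->
  forall K, <<s G >> K -> P (K `&` B) = \int[P]_(x in K) q x.
Proof.
move=> GM GI GT mB mq q0 GE.
pose dens A : \bar R := \int[P]_(x in A) q x.
have d0 : dens set0 = 0 by rewrite /dens integral_set0.
have dge A : 0 <= dens A by exact: integral_ge0.
have dadd : semi_sigma_additive dens.
  move=> A mA tA mU; rewrite /dens ge0_integral_bigcup//; last exact: measurable_funTS.
  by apply: is_cvg_nneseries => n _ _; exact: integral_ge0.
pose m2 : {measure set T -> \bar R} := HB.pack dens (isMeasure.Build _ _ _ dens d0 dge dadd).
pose m1 : {measure set T -> \bar R} := mrestr P mB.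
move=> K GK; apply: (@measure_eq_gen _ T R G m1 m2) => //.
- apply: (@le_lt_trans _ _ 1); last exact: ltry.
  by apply: probability_le1; exact: measurableI.
Qed.

End conditional_laws.

Lemma measurable_lt_fun d (T : measurableType d) (R : realType) (g h : T -> R) :
  measurable_fun setT g -> measurable_fun setT h -> measurable [set t | g t < h t].
Proof.
move=> mg mh; have -> : [set t | g t < h t] = [set t | 0 < h t - g t].
  by apply/seteqP; split => t /=; rewrite subr_gt0.
by apply: measurable_gt_cst; exact: measurable_funB.
Qed.

Lemma measurable_sum_in d (T : measurableType d) (R : realType) (I : eqType) (E : seq I) (g : I -> T -> R) :
  (forall e, e \in E -> measurable_fun setT (g e)) ->
  measurable_fun setT (fun t => \sum_(e <- E) g e t).
Proof.
move=> mg; rewrite (_ : (fun t => _) = (fun t => \sum_(e <- E) (if e \in E then g e t else 0))).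
  apply: measurable_sum => e; case: (boolP (e \in E)) => eE; [exact: mg|exact: measurable_cst].
by apply/funext => t; rewrite big_seq big_mkcond.
Qed.

Section measurable_bits.
Context d (T : measurableType d) (I : Type) (b : I -> T -> bool).
Hypothesis mb : forall e, measurable [set t | b e t].

(** A list of words filtered by random conditions depends on the outcome only through finitely many
    bits, hence takes its values in a countable set. *)
Lemma measurable_map_bits (E : seq I) (m : seq bool) :
  measurable [set t | [seq b e t | e <- E] = m].
Proof.
elim: E m => [|e E ih] [|a m] /=; try by rewrite (_ : [set t | _] = set0)//; apply/seteqP; split.
  by rewrite (_ : [set t | _] = setT)//; apply/seteqP; split.
rewrite (_ : [set t | _] = [set t | b e t = a] `&` [set t | [seq b e t | e <- E] = m]).
  apply: measurableI => //; case: (a); first exact: mb.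
  rewrite (_ : [set t | _] = ~` [set t | b e t]); first exact: measurableC.
  by apply/seteqP; split => t /=; [move=> ->|move/negP/negbTE].
by apply/seteqP; split => t /=; [move=> [-> ->]|move=> [-> ->]].
Qed.

End measurable_bits.

(** * Ranks of words in the total order *)

Section word_codes.
Implicit Types (e f : word) (s t : seq bool).

(** The rank of a word: [(word_code e).+1] is written in base 2 as the digit 1 followed by the
    letters of the word, so that longer words have larger ranks and equal lengths compare
    lexicographically. *)
Fixpoint word_code e : nat := if e is b :: e' then (word_code e').*2.+1 + b else 0%N.

Let val a s : nat := foldl (fun m (b : bool) => m.*2 + b)%N a s.

Let word_code_val e : (word_code e).+1 = val 1 (rev e).
Proof.
elim: e => //= b e ih; rewrite rev_cons /val foldl_rcons -/(val 1 (rev e)) -ih.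
by rewrite doubleS !addSn.
Qed.

Let val_bounds a s : (2 ^ size s * a <= val a s < 2 ^ size s * a.+1)%N.
Proof.
elim: s a => [|b s ih] a; first by rewrite /= !mul1n leqnn ltnSn.
have /andP[h1 h2] := ih (a.*2 + b)%N; rewrite /val /= -/(val _ s); apply/andP; split.
  apply: leq_trans h1; rewrite expnS mulnAC mulnC leq_mul2l -muln2 orbC.
  by rewrite mulnC muln2 leq_addr.
apply: (leq_trans h2); rewrite expnS -mulnA mulnCA leq_mul2l; apply/orP; right.
by case: (b); lia.
Qed.

Let val_lt a s t : size s = size t -> s != t -> ((s : seqlexi bool) <= t)%O ->
  (val a s < val a t)%N.
Proof.
elim: s a t => [|x s ih] a [|y t] //= [st]; rewrite lexi_cons.
have [->|xy] := eqVneq x y.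
  by rewrite eqseq_cons eqxx /= lexx /= => nst sl; exact: ih.
move=> _ /andP[xle _]; have {xy xle} [-> ->] : x = false /\ y = true by case: (x) (y) xy xle => -[].
rewrite /val /= -!/(val _ _) addn0 addn1.
have /andP[_ h1] := val_bounds a.*2 s; have /andP[h2 _] := val_bounds a.*2.+1 t.
by apply: (leq_trans h1); rewrite st.
Qed.

Lemma word_lt_word_code e f : word_lt e f -> (word_code e < word_code f)%N.
Proof.
suff h : word_lt e f -> (val 1 (rev e) < val 1 (rev f))%N by move=> /h; rewrite -!word_code_val ltnS.
rewrite /word_lt /word_le => /andP[ef /orP[sef|/andP[/eqP sef ef']]].
  have /andP[_ h1] := val_bounds 1 (rev e); have /andP[h2 _] := val_bounds 1 (rev f).
  apply: (leq_trans h1); apply: leq_trans h2; rewrite !size_rev muln1 -expnSr.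
  by rewrite leq_exp2l.
by apply: val_lt; rewrite ?size_rev// (inj_eq (can_inj (@revK _))).
Qed.

Lemma word_ltE e f : word_lt e f = (word_code e < word_code f)%N.
Proof.
apply/idP/idP; first exact: word_lt_word_code.
move=> h; apply/negPn/negP => nl; have : word_lt f e.
  move: nl; rewrite /word_lt /word_le !negb_and negbK !negb_or => /orP[/eqP ef|].
    by rewrite ef ltnn in h.
  have ef : e != f by apply: contraTneq h => ->; rewrite ltnn.
  rewrite -leqNgt leq_eqVlt => /andP[/orP[/eqP sef|->]]; last by rewrite (eq_sym f e) ef.
  rewrite sef eqxx /= => nle; rewrite (eq_sym f e) ef ltnn /=.
  by have := le_total (rev e : seqlexi bool) (rev f : seqlexi bool); rewrite (negPf nle).
by move=> /word_lt_word_code /(ltn_trans h); rewrite ltnn.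
Qed.

Lemma word_code_inj : injective word_code.
Proof.
elim=> [|b e ih] [|c f] //=; rewrite ?addSn//.
move=> h; have [ef bc] : word_code e = word_code f /\ b = c by case: (b) (c) h => -[]; lia.
by rewrite (ih _ ef) bc.
Qed.

Lemma word_code_surj n : exists e, word_code e = n.
Proof.
elim/ltn_ind: n => -[_|n ih]; first by exists [::].
have [|e en] := ih n./2; first by rewrite ltnS -{2}(odd_double_half n) -addnn addnA leq_addl.
exists (odd n :: e) => /=; rewrite en addSn; congr _.+1.
by rewrite addnC odd_double_half.
Qed.

Definition nth_word n : word := xget [::] [set e | word_code e = n].

Lemma nth_wordK n : word_code (nth_word n) = n.
Proof. by rewrite /nth_word; case: xgetP => // h; have [e en] := word_code_surj n; case: (h e). Qed.

Lemma word_codeK e : nth_word (word_code e) = e.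
Proof. by apply: word_code_inj; exact: nth_wordK. Qed.

Lemma ancestor_word_code e f : f \in ancestors e -> (word_code f < word_code e)%N.
Proof.
elim: e => //= b e ih; rewrite inE => /orP[/eqP ->|/ih h].
  by case: (b); lia.
by apply: (ltn_trans h); case: (b); lia.
Qed.

(** The split words are the inner nodes of a finite binary tree, whose leaves separate them from all
    remaining words. *)
Lemma leaves_trichotomy ws n e : valid_words ws n ->
  [\/ e \in leaves ws n, exists2 i, (i < n)%N & e = ws i |
      exists2 f, f \in ancestors e & f \in leaves ws n].
Proof.
elim: n => [_|n ih /valid_wordsS[v wn]].
  case: e => [|b e]; first by apply: Or31; rewrite inE.
  apply: Or33; exists [::]; last by rewrite inE.
  by elim: e b => // b e ih c; rewrite [ancestors _]/= in_cons; apply/orP; right; exact: ih.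
have rm f : f \in leaves ws n -> f != ws n -> f \in rem (ws n) (leaves ws n).
  by move=> fn fw; have [u _ _] := leaves_invariant v; rewrite mem_rem_uniq// inE fw.
have [en|[i iN ->]|[f fe fn]] := ih v.
- have [ew|ew] := eqVneq e (ws n); first by apply: Or32; exists n.
  by apply: Or31; rewrite /= !inE; apply/orP; right; apply/orP; right; exact: rm.
- by apply: Or32; exists i => //; exact: ltnW.
have [fw|fw] := eqVneq f (ws n); last first.
  by apply: Or33; exists f => //; rewrite /= !inE rm// !orbT.
rewrite fw in fe; have {f fn fw} [b [be|be]] : exists b, e = b :: ws n \/ b :: ws n \in ancestors e.
  elim: e {ih} fe => //= b e ihe; rewrite inE => /orP[/eqP ->|/ihe[c [ec|ce]]].
  - by exists b; left.
  - by exists c; right; rewrite inE ec eqxx.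
  - by exists c; right; rewrite inE ce orbT.
- by apply: Or31; rewrite be /= !inE; case: (b); rewrite eqxx ?orbT.
- by apply: Or33; exists (b :: ws n) => //=; rewrite !inE; case: (b); rewrite eqxx ?orbT.
Qed.

End word_codes.

Section hit_lists.
Context {R : realType} {l : nat}.
Local Notation V := 'rV[R]_l.+1.
Local Notation path := (path_space R l).
Variable W : set V.
Hypothesis W_window : window W.

(** Counterpart of [hit_words] that refers to the path instead of the state of the construction. *)
Definition hit_list n (x : path) (h : hyperplane R l) : seq word :=
  sort word_le [seq e <- pleaves n x | `[< hits (pcell W n x e) h >]].

Definition select (L : seq word) (u : R) : word := head [::] [seq e <- L | in_slot L u e].

Lemma measurable_hits_pcell n e :
  measurable ([set p | hits (pcell W n p.1 e) p.2] : set (path_before n * hyperplane R l)).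
Proof.
apply: (@measurable_hits_cell _ _ _ (polytope_compact W_window.1) _ _ (fun p : path_before n * hyperplane R l => hyp_at n p.1)).
  by move=> f; exact: (measurableT_comp (@measurable_hyp_at R l n f) measurable_fst).
exact: measurable_snd.
Qed.

Lemma measurable_cuts_pcell n e :
  measurable ([set p | cuts (pcell W n p.1 e) p.2] : set (path_before n * hyperplane R l)).
Proof.
apply: (@measurable_cuts_cell _ _ _ (polytope_compact W_window.1) _ _ (fun p : path_before n * hyperplane R l => hyp_at n p.1)).
  by move=> f; exact: (measurableT_comp (@measurable_hyp_at R l n f) measurable_fst).
exact: measurable_snd.
Qed.

Lemma measurable_hit_list n (L : seq word) :
  measurable ([set p | hit_list n p.1 p.2 = L] : set (path_before n * hyperplane R l)).
Proof.
pose bits (p : path_before n * hyperplane R l) e := `[< hits (pcell W n p.1 e) p.2 >].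
apply: (@measurable_countable_fiber _ (path_before n * hyperplane R l)%type _ (fun p => pleaves n p.1)
  (fun E => [set p | sort word_le [seq e <- E | bits p e] = L])).
  move=> E; have mE := @measurable_pleaves R l n E.
  by have := @measurable_fst _ _ (path_before n) (hyperplane R l) measurableT _ mE; rewrite setTI.
move=> E; have -> : [set p | sort word_le [seq e <- E | bits p e] = L] =
   [set p | [set m | sort word_le (mask m E) = L] [seq bits p e | e <- E]].
  by apply/seteqP; split => p /=; rewrite filter_mask.
apply: measurable_countable_pred => m; apply: (measurable_map_bits (b := fun e p => bits p e)) => e.
rewrite (_ : [set t | _] = [set p | hits (pcell W n p.1 e) p.2]); first exact: measurable_hits_pcell.
by apply/seteqP; split => p /= /asboolP.
Qed.

Lemma measurable_select (L : seq word) w : measurable [set u : R | select L u = w].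
Proof.
have -> : [set u : R | select L u = w] =
   [set u : R | [set m | head [::] (mask m L) = w] [seq in_slot L u e | e <- L]].
  by apply/seteqP; split => u /=; rewrite /select filter_mask.
apply: measurable_countable_pred => m; apply: (measurable_map_bits (b := fun e (u : R) => in_slot L u e)) => e.
exact: measurable_slot.
Qed.

End hit_lists.

(** * The path of the construction and its kernel *)

Section split_side.
Context {R : realType} {l : nat}.
Local Notation Vec := 'rV[R]_l.+1.
Local Notation path := (path_space R l).
Local Notation paths := (@paths R l).
Local Notation Hyp := (hyperplane R l).
Variable Lam : {measure set (hyperplane R l) -> \bar R}.
Hypothesis Lam_neq0 : Lam setT <> 0%E.
Hypothesis Lam_inv : translation_invariant Lam.
Hypothesis Lam_fin : locally_finite Lam.
Variable W : set Vec.
Hypothesis W_window : window W.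
Context d (Om : measurableType d) (P : probability Om R).
Variables (U V : nat -> {RV P >-> R}) (G : nat -> {RV P >-> hyperplane R l}).
Variable Xi : nat -> (set (hyperplane R l) -> \bar R) -> hyperplane R l -> hyperplane R l.
Hypothesis Xi_measurable : forall n,
     measurable_fun ([set T : tess_space W | tessellation W T] `*` hits W)
       (fun p : tess_space W * hyperplane R l => Xi n (Gam Lam p.1) p.2).
Implicit Types (w : Om) (n : nat) (e : word).

Definition sstate n w := split_state Lam W Xi (fun k => U k w) (fun k => G k w) n.
Definition shyp n w : Hyp := Xi n (Gam Lam (cells (sstate n w))) (G n.+1 w).
Definition sword n w : word := select (hit_words (sstate n w) (shyp n w)) (U n.+1 w).
Definition swait n w : R :=
  waiting Lam W Xi (fun k => U k w) (fun k => V k w) (fun k => G k w) n.+1.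
Definition spath w : path := fun n => (sword n w, shyp n w, swait n w).

(** The first [n] steps are regular. On this event the state of the construction is the one that can
    be rebuilt from the path. *)
Fixpoint split_ok n w : Prop := if n is m.+1 then split_ok m w /\
    [/\ hits W (G n w), 0 <= U n w < 1, hit_list W m (spath w) (shyp m w) != [::],
        cuts (pcell W m (spath w) (sword m w)) (shyp m w) & 0 < V n w]
  else True.

(** Distinct slots are disjoint and together they cover [0, 1), so exactly one hit word is selected
    and [step] does split its cell; the state and the path evolve together. *)
Lemma split_ok_state n w : split_ok n w ->
  [/\ good W n (spath w), (sstate n w).1 = pleaves n (spath w) &
      {in pleaves n (spath w), (sstate n w).2 =1 pcell W n (spath w)}].
Proof.
elim: n => [_|n ih /= [/ih[g s1 s2] [Gh u01 L0 ch v0]]].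
  by split => // e; rewrite inE => /eqP ->.
have HE : hit_words (sstate n w) (shyp n w) = hit_list W n (spath w) (shyp n w).
  rewrite /hit_words /hit_list s1; congr (sort _ _); apply: eq_in_filter => e en.
  by rewrite s2.
set L := hit_list _ _ _ _ in HE L0.
have uL : uniq L by rewrite sort_uniq filter_uniq//; have [] := leaves_invariant g.1.
have [e eL eu] := exists_slot uL L0 u01.
have we : sword n w = e by rewrite /sword /select HE (head_slot uL eL eu).
have en : e \in pleaves n (spath w).
  by move: eL; rewrite mem_sort mem_filter => /andP[].
have sE : step (sstate n w) (shyp n w) (U n.+1 w) = split_cell (sstate n w) e (shyp n w).
  by rewrite /step HE (head_slot uL eL eu).
have cE : cells (sstate n w) = ptess W n (spath w).
  rewrite /cells /ptess s1; apply/seteqP; split => C [f fn <-]; exists f => //.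
    by rewrite s2.
  by rewrite s2.
have g1 : good W n.+1 (spath w).
  apply/goodS; split => //; first by rewrite [pword _ _]we.
  rewrite /pwait /= /swait /waiting /=; rewrite mulr_gt0// invr_gt0.
  by rewrite /split_tess -/(sstate n w) cE zeta_ptess// zt_gt0.
have v1 : valid_words (pword (spath w)) n.+1 by case: g1.
rewrite -/(shyp n w) sE; split => //; first by rewrite /= s1 pleavesS [pword _ _]we.
move=> f; rewrite pleavesS [pword _ _]we !inE /=.
have chE b : pcell W n.+1 (spath w) (b :: e) = pcell W n (spath w) e `&` half b (shyp n w).
  by rewrite -we; apply: pcell_split.
have [->|f0] := eqVneq f (false :: e); first by rewrite chE s2.
have [->|f1] := eqVneq f (true :: e); first by rewrite chE s2.
move=> /= /mem_rem fn; rewrite s2// pcell_stable//.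
Qed.

Lemma split_ok_cells n w : split_ok n w -> cells (sstate n w) = ptess W n (spath w).
Proof.
move=> /split_ok_state[g s1 s2].
rewrite /cells /ptess s1; apply/seteqP; split => C [f fn <-]; exists f => //; by rewrite s2.
Qed.

Lemma split_ok_hit_words n w h : split_ok n w ->
  hit_words (sstate n w) h = hit_list W n (spath w) h.
Proof.
move=> /split_ok_state[g s1 s2].
by rewrite /hit_words /hit_list s1; congr (sort _ _); apply: eq_in_filter => e en; rewrite s2.
Qed.

Lemma split_ok_wait n w : split_ok n w -> swait n w = (zt Lam W n (spath w))^-1 * V n.+1 w.
Proof.
move=> /[dup] o /split_ok_state[g _ _].
by rewrite /swait /waiting /= /split_tess -/(sstate n w) split_ok_cells// zeta_ptess.
Qed.

Local Notation F := (UVG_events U V G).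

Lemma UVG_events_measurable i : F i `<=` measurable.
Proof. by case: i => [[]|] n; exact: events_of_measurable. Qed.

Lemma UVG_eventsT i : F i setT.
Proof. by case: i => [[]|] n; exact: events_ofT. Qed.

Lemma UVG_eventsI i : setI_closed (F i).
Proof. by case: i => [[]|] n; exact: events_ofI. Qed.

(** The index [k] stands for the term [k.+1] of each sequence, so these are the variables used by
    the first [n] steps. *)
Definition split_past n : set (nat + nat + nat) :=
  [set i | match i with inl (inl k) => k < n | inl (inr k) => k < n | inr k => k < n end]%N.

Lemma split_past_le m n : (m <= n)%N -> split_past m `<=` split_past n.
Proof. by move=> mn [[]|] k /= h; exact: leq_trans mn. Qed.

Local Notation before n := (g_sigma_algebraType (join_events F (split_past n))).
Local Notation with_G n := (g_sigma_algebraType (join_events F (split_past n `|` [set inr n]))).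

(** The next hyperplane as a function of the past and of a free argument in the place of G(n+1),
    over which one can then integrate. *)
Definition proposal n (p : Om * Hyp) : path_before n * Hyp :=
  (spath p.1 : path_before n, Xi n (Gam Lam (cells (sstate n p.1))) p.2).

Let mhW : measurable (hits W) := measurable_hits (polytope_compact W_window.1).

(** Outside the regular event the arguments of [Xi] may leave the domain on which it is measurable;
    the path is therefore claimed to be measurable with respect to the past on that event only. *)
Definition ok_measurable n := forall D, measurable (D : set (path_before n)) ->
  measurable (split_ok n `&` spath @^-1` D : set (before n)).

Lemma ok_measurableT n : ok_measurable n -> measurable (split_ok n : set (before n)).
Proof. by move=> h; have := h _ measurableT; rewrite preimage_setT setIT. Qed.

Lemma measurable_proposal n : ok_measurable n ->
  measurable_fun (split_ok n `*` hits W : set (before n * Hyp)) (proposal n).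
Proof.
move=> h; have mo := ok_measurableT h.
have mD : measurable (split_ok n `*` hits W : set (before n * Hyp)) by exact: measurableX.
apply: measurable_fun_pair_in.
  move=> _ B mB; rewrite (_ : _ `&` _ = (split_ok n `&` spath @^-1` B) `*` hits W).
    by apply: measurableX => //; exact: h.
  by apply/seteqP; split => -[w g] /=; [move=> [[]]|move=> [[]]].
pose T0 := [set T : tess_space W | tessellation W T].
apply: (@measurable_comp _ _ _ (before n * Hyp)%type (tess_space W * Hyp)%type Hyp
  (T0 `*` hits W) (fun p => Xi n (Gam Lam p.1) p.2)
  (split_ok n `*` hits W) (fun p => (cells (sstate n p.1), p.2))) => //.
- apply: measurableX => //; apply: sub_sigma_algebra; exists set0.
    by split; [exact: compact0|].
  by apply/seteqP; split => T /=; [move=> []|move=> h0; split; rewrite ?setI0].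
- move=> _ [[w g] [/= ow gW] <-]; split => //=.
  by rewrite split_ok_cells//; apply: good_tessellation => //; have [] := split_ok_state ow.
- apply: measurable_fun_pair_in; last by apply: measurable_funTS; exact: measurable_snd.
  move=> _ B mB.
  rewrite (_ : _ `&` _ = (split_ok n `&` spath @^-1` (good W n `&` ptess W n @^-1` B)) `*` hits W).
    apply: measurableX => //; apply: h; apply: measurable_ptess => //; exact: measurable_good.
  apply/seteqP; split => -[w g] /=.
    move=> [[ow gW] Bw]; split => //; split => //; split; first by have [] := split_ok_state ow.
    by rewrite /= -split_ok_cells.
  by move=> [[ow [gw Bw]] gW]; split => //; rewrite split_ok_cells.
Qed.

Definition proposed n w : path_before n * Hyp := (spath w : path_before n, shyp n w).

Definition ok_G n : set Om := split_ok n `&` G n.+1 @^-1` hits W.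

Lemma measurable_ok_G n : ok_measurable n -> measurable (ok_G n : set (with_G n)).
Proof.
move=> h; apply: measurableI.
  by apply: (@gen_mono _ Om _ _ _ _ (ok_measurableT h)); apply: join_events_mono => i; left.
rewrite -[X in measurable X]setTI.
by apply: (@measurable_rv_join _ Om _ P _ Hyp _ F _ (inr n) (G n.+1)) => //; right.
Qed.

Lemma measurable_proposed n : ok_measurable n ->
  measurable_fun (ok_G n : set (with_G n)) (proposed n : with_G n -> _).
Proof.
move=> h.
have -> : (proposed n : with_G n -> _) = proposal n \o (fun w : with_G n => (w : before n, G n.+1 w)) by [].
apply: (@measurable_comp _ _ _ (with_G n) (before n * Hyp)%type (path_before n * Hyp)%type
  (split_ok n `*` hits W) (proposal n) (ok_G n)).
- by apply: measurableX => //; exact: ok_measurableT.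
- by move=> _ [w [ow Gw] <-].
- exact: measurable_proposal.
- apply: measurable_funTS; apply: measurable_fun_pair.
    move=> _ B mB; rewrite setTI.
    by apply: (@gen_mono _ Om _ _ _ _ mB); apply: join_events_mono => i; left.
  by apply: (@measurable_rv_join _ Om _ P _ Hyp _ F _ (inr n) (G n.+1)) => //; right.
Qed.

(** By induction the past path is measurable, and the next step is a function of it and of three new
    variables. The new word is treated by sorting outcomes according to the list of hit cells. *)
Lemma split_ok_measurable n : ok_measurable n.
Proof.
elim: n => [|n h].
  suff mX : measurable_fun setT (spath : before 0 -> path_before 0).
    by move=> D mD; exact: mX.
  by apply: (@measurability _ _ (before 0) (path_before 0) _ _ (events_before 0)) => // A [B [i]]; rewrite /= ltn0.
have sub A : measurable (A : set (with_G n)) -> measurable (A : set (before n.+1)).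
  apply: (@gen_mono _ Om); apply: join_events_mono => i [|->]; last exact: ltnSn.
  exact: split_past_le.
have mG := sub _ (measurable_ok_G h).
have mJ M : measurable M -> measurable (ok_G n `&` proposed n @^-1` M : set (before n.+1)).
  by move=> mM; apply: sub; apply: measurable_proposed => //; exact: measurable_ok_G.
have mU : measurable_fun setT (U n.+1 : before n.+1 -> R).
  by apply: (@measurable_rv_join _ Om _ P _ R _ F _ (inl (inl n)) (U n.+1)) => //=.
have mV : measurable_fun setT (V n.+1 : before n.+1 -> R).
  by apply: (@measurable_rv_join _ Om _ P _ R _ F _ (inl (inr n)) (V n.+1)) => //=.
have wE w : ok_G n w -> sword n w = select (hit_list W n (spath w) (shyp n w)) (U n.+1 w).
  by move=> [ow _]; rewrite /sword split_ok_hit_words.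
have mw e : measurable (ok_G n `&` [set w | sword n w = e] : set (before n.+1)).
  rewrite (_ : _ `&` _ = \bigcup_L ((ok_G n `&` proposed n @^-1` [set p | hit_list W n p.1 p.2 = L]) `&`
     (U n.+1 @^-1` [set u | select L u = e]))).
    apply: countable_bigcupT_measurable => [|L]; first exact: countableP.
    apply: measurableI.
      by apply: mJ; exact: measurable_hit_list.
    by rewrite -[X in measurable X]setTI; apply: mU => //; exact: measurable_select.
  apply/seteqP; split => w /=.
    by move=> [ow sw]; exists (hit_list W n (spath w) (shyp n w)) => //; split => //=; rewrite -wE.
  by move=> [L _ [[ow LE] sw]]; split => //; rewrite wE// [hit_list _ _ _ _]LE.
have mok : measurable (split_ok n.+1 : set (before n.+1)).
  rewrite (_ : split_ok n.+1 = (U n.+1 @^-1` `[0, 1[%classic `&` [set w | 0 < V n.+1 w]) `&`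
    ((ok_G n `&` proposed n @^-1` ~` [set p | hit_list W n p.1 p.2 = [::]]) `&`
     \bigcup_e ((ok_G n `&` [set w | sword n w = e]) `&`
       (ok_G n `&` proposed n @^-1` [set p | cuts (pcell W n p.1 e) p.2])))).
    apply: measurableI; first apply: measurableI.
    - by rewrite -[X in measurable X]setTI; apply: mU.
    - exact: measurable_gt_cst.
    apply: measurableI; first by apply: mJ; apply: measurableC; exact: measurable_hit_list.
    apply: countable_bigcupT_measurable => [|e]; first exact: countableP.
    apply: measurableI => //.
    by apply: mJ; exact: measurable_cuts_pcell.
  apply/seteqP; split => w /=.
    move=> [ow [Gw u01 L0 cw v0]]; split; first by rewrite in_itv.
    split; first by split => //; apply/eqP.
    by exists (sword n w).
  rewrite in_itv/=; move=> [[u01 v0] [[[ow Gw] L0] [e _ [[_ <-] [_ cw]]]]].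
  by split => //; split => //; apply/eqP.
suff mX : measurable_fun (split_ok n.+1 : set (before n.+1)) (spath : _ -> path_before n.+1).
  by move=> D mD; exact: mX.
have okG w : split_ok n.+1 w -> ok_G n w by move=> /= [ow []].
apply: (@measurability _ _ (before n.+1) (path_before n.+1) _ _ (events_before n.+1)) => //.
move=> _ [B [i /= iN Bi] <-]; move: iN; rewrite ltnS leq_eqVlt => /orP[/eqP ie|iN]; last first.
  rewrite (_ : _ `&` _ = split_ok n.+1 `&` (split_ok n `&` spath @^-1` B)).
    apply: measurableI => //.
    apply: (@gen_mono _ Om (join_events F (split_past n))).
      by apply: join_events_mono; exact: split_past_le.
    by apply: h; apply: sub_sigma_algebra; exists i.
  by apply/seteqP; split => w; [move=> [ow Bw]; split => //; split => //; exact: ow.1|move=> [ow [_ Bw]]].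
rewrite ie in Bi; case: Bi => [[Q ->]|[A mA ->]|[A mA ->]].
- rewrite (_ : _ `&` _ = split_ok n.+1 `&` \bigcup_(e in Q) (ok_G n `&` [set w | sword n w = e])).
    apply: measurableI => //; rewrite bigcup_mkcond.
    by apply: countable_bigcupT_measurable => [|e]; [exact: countableP|case: ifP].
  apply/seteqP; split => w; first by move=> [ow Qw]; split => //; exists (sword n w) => //; split => //; exact: okG.
  by move=> [ow [e Qe [_ we]]]; split => //=; rewrite /pword /= we.
- rewrite (_ : _ `&` _ = split_ok n.+1 `&` (ok_G n `&` proposed n @^-1` (setT `*` A))).
    by apply: measurableI => //; apply: mJ; exact: measurableX.
  apply/seteqP; split => w; first by move=> [ow Aw]; split => //; split; first exact: okG.
  by move=> [ow [_ [_ Aw]]].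
- rewrite (_ : _ `&` _ = split_ok n.+1 `&` (ok_G n `&` [set w | A ((zt Lam W n (spath w))^-1 * V n.+1 w)])).
    apply: measurableI => //.
    pose f (p : path_before n * R) := (zt Lam W n p.1)^-1 * p.2.
    have mf : measurable_fun setT f.
      apply: measurable_funM => //.
      apply: (@measurableT_comp _ _ _ _ _ _ (fun x : path_before n => (zt Lam W n x)^-1)) => //.
      apply: measurable_inv_ge0; [exact: measurable_zt|exact: zt_ge0].
    have mp : measurable_fun (ok_G n : set (before n.+1)) (fun w => (spath w : path_before n, V n.+1 w)).
      apply: measurable_fun_pair_in; last exact: measurable_funTS.
      move=> _ C mC; rewrite (_ : _ `&` _ = ok_G n `&` proposed n @^-1` (C `*` setT)).
        by apply: mJ; exact: measurableX.
      by apply/seteqP; split => w /=; [move=> []|move=> [? []]].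
    have := mp mG _ (mf measurableT _ mA); rewrite setTI; congr measurable.
  apply/seteqP; split => w.
    move=> [ow Aw]; have [on gn] := okG _ ow; split => //; split => //=.
    by move: Aw; rewrite /= /pwait /= split_ok_wait.
  by move=> [ow [[on gn] Aw]]; split => //=; rewrite /pwait /= split_ok_wait.
Qed.

Hypothesis U_law : forall n, has_law (U n.+1) (uniform_prob (@ltr01 R)).
Hypothesis V_law : forall n, has_law (V n.+1) (exponential_prob (1 : R)).
Hypothesis G_law : forall n, has_law (G n.+1) (normalize (Lam_on Lam W)).
Hypothesis UVG_indep : mutually_independent P F.
Hypothesis Xi_transports : {ae P, forall w, forall n,
  let Y := cells (sstate n w) in transports Lam W (Gam Lam Y) (Xi n (Gam Lam Y))}.

(** The normalization of Gamma_n evaluated at [B], expressed by the path. *)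
Definition jump n x (B : set Hyp) : \bar R :=
  (((zt Lam W n x)^-1)%:E * \sum_(e <- pleaves n x) Lam (B `&` hits (pcell W n x e)))%E.

Lemma jump_ge0 n x B : (0 <= jump n x B)%E.
Proof.
by rewrite mule_ge0// ?lee_fin ?invr_ge0 ?zt_ge0//; apply: sume_ge0 => e _; exact: measure_ge0.
Qed.

Lemma measurable_jump n (M : set (path_before n * Hyp)) : measurable M ->
  measurable_fun setT ((fun x => jump n x [set h | M (x, h)]) : path_before n -> \bar R).
Proof.
move=> mM; apply: emeasurable_funM.
  by apply/measurable_EFinP; apply: measurable_inv_ge0; [exact: measurable_zt|exact: zt_ge0].
apply: (@measurable_fun_countable_fiber _ (path_before n) _ _ _ (pleaves n)
  (fun E x => \sum_(e <- E) Lam ([set h | M (x, h)] `&` hits (pcell W n x e)))%E).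
  exact: measurable_pleaves.
move=> E; apply: emeasurable_sum => e.
apply: (@measurable_Lam_section _ _ _ Lam_fin _ W_window _ _ (M `&` [set p | hits (pcell W n p.1 e) p.2])).
  by apply: measurableI => //; exact: measurable_hits_pcell.
by move=> p [_]; apply: sub_hits; exact: tree_cell_sub.
Qed.

Lemma measurable_fun_spath n (K : set (before n)) d1 (Y : measurableType d1) (g : path_before n -> Y) :
  measurable K -> K `<=` split_ok n -> measurable_fun setT g ->
  measurable_fun K (fun w => g (spath w)).
Proof.
move=> mK Ko mg _ B mB; have mgB := mg measurableT _ mB; rewrite setTI in mgB.
rewrite (_ : _ `&` _ = K `&` (split_ok n `&` spath @^-1` (g @^-1` B))).
  by apply: measurableI => //; exact: split_ok_measurable.
by apply/seteqP; split => w /=; [move=> [Kw gw]; split => //; split => //; exact: Ko|move=> [? []]].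
Qed.

Lemma before_measurable n (A : set Om) : measurable (A : set (before n)) -> measurable A.
Proof. by apply: gen_sub_measurable; apply: join_events_measurable; exact: UVG_events_measurable. Qed.

(** With the past frozen, only G(n+1) is random, and the transport property of [Xi] turns its law
    into the normalization of Gamma_n. The weight [f] is there to carry the exponential factor of
    the waiting time. *)
Lemma split_G_step n (K : set (before n)) (f : before n -> \bar R) (M : set (path_before n * Hyp)) :
  measurable K -> K `<=` split_ok n -> measurable M ->
  measurable_fun setT f -> (forall w, 0 <= f w)%E ->
  (\int[P]_(w in K `&` (ok_G n `&` proposed n @^-1` M)) f w =
   \int[P]_(w in K) (f w * jump n (spath w) [set h | M (spath w, h)]))%E.
Proof.
move=> mK Ko mM mf f0.
pose S : set (before n * Hyp) := (K `*` hits W) `&` ((split_ok n `*` hits W) `&` proposal n @^-1` M).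
have mS : measurable S.
  apply: measurableI; first exact: measurableX.
  apply: (measurable_proposal (@split_ok_measurable n)) => //.
  by apply: measurableX => //; apply: ok_measurableT; exact: split_ok_measurable.
have mE : measurable (K `&` (ok_G n `&` proposed n @^-1` M) : set Om).
  apply: (@measurableI _ Om); first exact: (before_measurable mK).
  apply: (@gen_sub_measurable _ Om (join_events F (split_past n `|` [set inr n]))).
    by apply: join_events_measurable; exact: UVG_events_measurable.
  apply: measurable_proposed => //; [exact: split_ok_measurable|].
  by apply: measurable_ok_G; exact: split_ok_measurable.
have mKP : measurable (K : set Om) := before_measurable mK.
rewrite -integral_indicM//.
pose g (p : before n * Hyp) : \bar R := ((\1_S p)%:E * f p.1)%E.
have mg : measurable_fun setT g.
  apply: emeasurable_funM; first by apply/measurable_EFinP; exact: measurable_indic.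
  exact: (measurableT_comp mf measurable_fst).
have g0 p : (0 <= g p)%E by rewrite mule_ge0.
rewrite (_ : (\int[P]_w _ = \int[P]_w g (w, G n.+1 w))%E); last first.
  apply: eq_integral => w _; rewrite /g !indicE; congr ((_%:R)%:E * _)%E; congr nat_of_bool.
  apply/idP/idP => /set_mem h; apply/mem_set.
    by case: h => [Kw [[ow Gw] Mw]].
  by case: h => [[Kw Gw] [[ow _] Mw]].
rewrite (indep_rv_integral UVG_events_measurable UVG_eventsT UVG_eventsI UVG_indep (j := inr n) _ _ mg g0)//; last by rewrite /split_past /= ltnn.
pose q w := distribution P (G n.+1) (xsection S w).
have qE w : (\int[distribution P (G n.+1)]_y g (w, y) = f w * q w)%E.
  have mSw : measurable (xsection S w) by exact: measurable_xsection.
  rewrite /q muleC (measure_indic_integral _ mSw) -ge0_integralZr//; last first.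
    by apply/measurable_EFinP; exact: measurable_indic.
  apply: eq_integral => y _; rewrite /g !indicE; congr ((_%:R)%:E * _)%E; congr nat_of_bool.
  by apply/idP/idP; rewrite mem_xsection.
under eq_integral do rewrite qE.
have mq : measurable_fun setT (q : before n -> \bar R) by exact: measurable_fun_xsection.
have up d1 (Y : measurableType d1) (g1 : before n -> Y) : measurable_fun setT g1 -> measurable_fun [set: Om] g1.
  by apply: measurable_fun_gen; apply: join_events_measurable; exact: UVG_events_measurable.
rewrite [RHS]integral_mkcond; apply: ae_eq_integral => //.
- by apply: up; apply: emeasurable_funM.
- apply/(measurable_restrictT _ _).1 => //.
  have : measurable_fun K (fun w => f w * jump n (spath w) [set h | M (spath w, h)])%E.
    apply: emeasurable_funM; first exact: measurable_funTS.
    exact: (measurable_fun_spath mK Ko (measurable_jump mM)).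
  by move=> mk _ B mB; apply: before_measurable; exact: mk.
apply: filterS Xi_transports => w /(_ n) /= tr _.
rewrite patchE; case: ifPn => [/set_mem Kw|]; last first.
  move=> /negP nK; rewrite /q (_ : xsection S w = set0) ?measure0 ?mule0//.
  by apply/seteqP; split => // y /set_mem [[Kw]]; exfalso; apply: nK; exact: mem_set.
congr (_ * _)%E; have ow := Ko _ Kw; have gw : good W n (spath w) by have [] := split_ok_state ow.
have [tr1 tr2 _ tr4] := tr.
pose xi := Xi n (Gam Lam (cells (sstate n w))).
pose B : set Hyp := [set h | M (spath w : path_before n, h)].
have mB : measurable B by exact: (@measurable_section2 _ _ (path_before n) Hyp).
have SE : xsection S w = hits W `&` xi @^-1` B.
  apply/seteqP; split => y /=; first by move=> /set_mem [[_ yW] [_ My]].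
  by move=> [yW My]; apply/mem_set.
have mXB : measurable (hits W `&` xi @^-1` B) by exact: tr2.
rewrite /q SE G_law// /normalize.
have -> : Lam_on Lam W (hits W `&` xi @^-1` B) = Lam_on Lam W (xi @^-1` B).
  by rewrite /Lam_on setIC setIA setIid setIC.
have := tr4 B mB; rewrite /normalize => ->.
rewrite split_ok_cells//.
rewrite !Gam_ptess// /jump.
congr (_%:E * _)%E; congr (_^-1); rewrite /zt /pzeta; congr fine.
by apply: eq_bigr => e _; rewrite setTI.
Qed.

Lemma jump0 n x B : (forall e, e \in pleaves n x -> Lam (B `&` hits (pcell W n x e)) = 0%E) ->
  jump n x B = 0%E.
Proof. by move=> h; rewrite /jump big1_seq ?mule0// => e /andP[_ en]; exact: h. Qed.

Lemma probability_compl0 (A : set Om) : measurable A -> P A = 1%E -> P (~` A) = 0%E.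
Proof. by move=> mA PA; rewrite probability_setC// PA subee. Qed.

(** The next step can only fail to be regular if G misses [W], if U or V leaves its range, if no
    cell is hit, or if a cell is touched without being cut. Each of these events is null. *)
Lemma split_okS_measure n : P (split_ok n) = 1%E -> P (split_ok n.+1) = 1%E.
Proof.
move=> Pn.
have mok m : measurable (split_ok m : set (before m)) by apply: ok_measurableT; exact: split_ok_measurable.
have mokP m : measurable (split_ok m) := before_measurable (mok m).
have mrv d1 (Y : measurableType d1) (X : {RV P >-> Y}) B : measurable B -> measurable (X @^-1` B).
  by move=> mB; rewrite -[X in measurable X]setTI; exact: measurable_funP.
pose N1 := ~` (G n.+1 @^-1` hits W).
have N10 : P.-negligible N1.
  exists N1; split => //; first by apply: measurableC; exact: mrv.
  rewrite (_ : N1 = G n.+1 @^-1` ~` hits W)//.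
  have := G_law n (measurableC mhW); rewrite /distribution /pushforward => ->.
  by rewrite /normalize /Lam_on setICl measure0 mule0.
pose N2 := ~` (U n.+1 @^-1` `[0, 1[%classic).
have N20 : P.-negligible N2.
  exists N2; split => //; first by apply: measurableC; exact: mrv.
  apply: probability_compl0; first exact: mrv.
  have := U_law n (measurable_itv `[0, 1[); rewrite /distribution /pushforward => ->.
  by rewrite uniform_prob_itv// subr0.
pose N3 := ~` (V n.+1 @^-1` [set v | 0 < v]).
have N30 : P.-negligible N3.
  have m0 : measurable [set v : R | 0 < v].
    by rewrite (_ : [set v | _] = `]0, +oo[%classic)//; apply/seteqP; split => v /=; rewrite in_itv/= andbT.
  exists N3; split => //; first by apply: measurableC; exact: mrv.
  apply: probability_compl0; first exact: mrv.
  have := exponential_tail (V_law n) (lexx 0); rewrite oppr0 expR0 => <-.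
  rewrite -[LHS]/(distribution P (V n.+1) _) measure_indic_integral//.
  by apply: eq_integral => v _; rewrite indicE mem_setE.
have Gnull (M : set (path_before n * Hyp)) : measurable M -> (forall w, split_ok n w -> forall e, e \in pleaves n (spath w) ->
    Lam ([set h | M (spath w, h)] `&` hits (pcell W n (spath w) e)) = 0%E) ->
    P.-negligible (ok_G n `&` proposed n @^-1` M).
  move=> mM M0.
  have mE : measurable (ok_G n `&` proposed n @^-1` M : set Om).
    apply: (@gen_sub_measurable _ Om (join_events F (split_past n `|` [set inr n]))).
      by apply: join_events_measurable; exact: UVG_events_measurable.
    apply: measurable_proposed => //; [exact: split_ok_measurable|].
    by apply: measurable_ok_G; exact: split_ok_measurable.
  exists (ok_G n `&` proposed n @^-1` M); split => //.
  have := @split_G_step n (split_ok n) (fun=> 1%E) M (mok n) _ mM (measurable_cst _) _.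
  rewrite (_ : split_ok n `&` _ = ok_G n `&` proposed n @^-1` M); last first.
    by rewrite /ok_G !setIA setIid.
  rewrite integral_cst// mul1e => ->//; rewrite integral0_eq// => w ow.
  by rewrite jump0 ?mule0// => e en; exact: M0.
(* Hyperplanes that hit no cell at all: Gamma_n does not charge them. *)
pose M4 : set (path_before n * Hyp) := [set p | hit_list W n p.1 p.2 = [::]].
have N40 : P.-negligible (ok_G n `&` proposed n @^-1` M4).
  apply: Gnull; first exact: measurable_hit_list.
  move=> w ow e en; rewrite (_ : _ `&` _ = set0) ?measure0//; apply/seteqP; split => // h /= [].
  rewrite /M4 /hit_list /= => h0 hh.
  have : e \in sort word_le [seq e <- pleaves n (spath w) | `[< hits (pcell W n (spath w) e) h >]].
    by rewrite mem_sort mem_filter en andbT; apply/asboolP.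
  by rewrite h0.
(* Hyperplanes that touch a cell without cutting it, null by [touch_null] applied to each of the
   finitely many leaves. *)
pose M5 : set (path_before n * Hyp) := \bigcup_e (([set p | e \in pleaves n p.1] `&`
  [set p | hits (pcell W n p.1 e) p.2]) `\` [set p | cuts (pcell W n p.1 e) p.2]).
have N50 : P.-negligible (ok_G n `&` proposed n @^-1` M5).
  apply: Gnull.
    apply: countable_bigcupT_measurable => [|e]; first exact: countableP.
    apply: measurableD; last exact: measurable_cuts_pcell.
    apply: measurableI; last exact: measurable_hits_pcell.
    have me := @measurable_countable_pred _ (path_before n) _ (pleaves n) (fun E => e \in E) (@measurable_pleaves R l n).
    by have := @measurable_fst _ _ (path_before n) Hyp measurableT _ me; rewrite setTI.
  move=> w ow e en.
  pose x := spath w.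
  have cx f : compact (pcell W n x f) := @pcell_compact R l W W_window n x f.
  have mt f : measurable (hits (pcell W n x f) `\` cuts (pcell W n x f)).
    apply: measurableD; first exact: measurable_hits.
    exact: (@measurable_cuts_cell _ _ _ (polytope_compact W_window.1) _ _ (fun _ => hyp_at n x) _ f id).
  have mh := @measurable_section2 _ _ (path_before n) Hyp M5 x.
  apply/eqP; rewrite eq_le measure_ge0 andbT.
  apply: (@le_trans _ _ (Lam (\big[setU/set0]_(f <- pleaves n x) (hits (pcell W n x f) `\` cuts (pcell W n x f))))).
    apply: measure_mono; last first.
    - move=> h /= [[f _ /= [[fn hf] cf]] _]; rewrite -bigcup_seq; exists f => //.
    - exact: bigsetU_measurable.
    - apply: measurableI; last exact: measurable_hits.
      apply: mh; apply: countable_bigcupT_measurable => [|f]; first exact: countableP.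
      apply: measurableD; last exact: measurable_cuts_pcell.
      apply: measurableI; last exact: measurable_hits_pcell.
      have me := @measurable_countable_pred _ (path_before n) _ (pleaves n) (fun E => f \in E) (@measurable_pleaves R l n).
      by have := @measurable_fst _ _ (path_before n) Hyp measurableT _ me; rewrite setTI.
  elim: (pleaves n x) => [|f E ih]; first by rewrite big_nil measure0.
  rewrite big_cons; apply: le_trans; first exact: (measureU2 Lam (mt f) (bigsetU_measurable _ _)).
  rewrite -[leRHS](adde0 0%E); apply: leeD => //.
  by rewrite le_eqVlt; apply/orP; left; apply/eqP; exact: touch_null.
have : P (split_ok n `\` split_ok n.+1) = 0%E.
  apply: measure_negligible; first exact: measurableD.
  apply: (negligibleS _ (negligibleU N10 (negligibleU N20 (negligibleU N30 (negligibleU N40 N50))))).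
  move=> w [ow nw].
  have [Gw|?] := pselect (hits W (G n.+1 w)); last by left.
  have [Uw|?] := pselect ((U n.+1 @^-1` `[0, 1[%classic) w); last by right; left.
  have [Vw|?] := pselect (0 < V n.+1 w); last by right; right; left.
  right; right; right.
  have [h0|h0] := eqVneq (hit_list W n (spath w) (shyp n w)) [::]; first by left.
  right; split => //; set L := hit_list W n (spath w) (shyp n w) in h0.
  have [g _ _] := split_ok_state ow.
  have uL : uniq L by rewrite sort_uniq filter_uniq//; have [] := leaves_invariant g.1.
  have u01 : 0 <= U n.+1 w < 1 by move: Uw; rewrite /= in_itv.
  have [e eL eu] := exists_slot uL h0 u01.
  have we : sword n w = e by rewrite /sword split_ok_hit_words// /select (head_slot uL eL eu).
  move: eL; rewrite mem_sort mem_filter => /andP[/asboolP eh en].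
  exists e => //; split => //= cw; apply: nw; split => //; split => //; by rewrite we.
have sub : split_ok n.+1 `<=` split_ok n by move=> w [].
move=> D0; have : P (split_ok n.+1 `|` (split_ok n `\` split_ok n.+1)) = 1%E by rewrite setDUK.
rewrite measureU//; last 2 first.
- exact: measurableD.
- by rewrite setDE setICA setICr setI0.
by move=> <-; rewrite [X in (_ + X)%E]D0 adde0.
Qed.

Lemma split_ok_measure n : P (split_ok n) = 1%E.
Proof. elim: n => [|n]; [exact: probability_setT|exact: split_okS_measure]. Qed.

(** This is the density xi_n: a hyperplane with hit list [L] is counted once for each word of
    [L]. *)
Lemma sum_hit_cells n x (L : seq word) (B : set Hyp) : good W n x -> measurable B ->
  B `<=` [set h | hit_list W n x h = L] ->
  (\sum_(e <- pleaves n x) Lam (B `&` hits (pcell W n x e)) = (size L)%:R%:E * Lam B)%E.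
Proof.
move=> gx mB BL.
have [->|/set0P[h0 Bh0]] := eqVneq B set0.
  by rewrite measure0 mule0 big1// => e _; rewrite set0I measure0.
pose E := pleaves n x; have uE : uniq E by have [] := leaves_invariant gx.1.
have BE e : e \in E -> B `&` hits (pcell W n x e) = if e \in L then B else set0.
  move=> eE; case: ifPn => eL; apply/seteqP; split => h //.
  - by move=> [].
  - by move=> Bh; split => //; move: eL; rewrite -(BL _ Bh) mem_sort mem_filter => /andP[/asboolP].
  - move=> [Bh' eh]; move: eL; rewrite -(BL _ Bh') mem_sort mem_filter eE andbT => /negP; apply.
    exact/asboolP.
rewrite big_seq (eq_bigr (fun e => if e \in L then Lam B else 0%E)); last first.
  by move=> e eE; rewrite BE//; case: ifP => // _; rewrite measure0.
rewrite -big_seq -big_mkcond /= big_const_seq.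
have -> m : iter m (adde (Lam B)) 0%E = (m%:R%:E * Lam B)%E.
  elim: m => [|m ih]; first by rewrite mul0e.
  by rewrite iterS ih -[m.+1]add1n natrD EFinD ge0_muleDl// mul1e.
congr (_%:R%:E * _)%E.
rewrite -(BL _ Bh0) size_sort -size_filter; congr size; apply: eq_in_filter => e eE.
by rewrite mem_sort mem_filter eE andbT.
Qed.

(** Outcomes are sorted by the hit list L of the next hyperplane. For each L that contains [w], the
    uniform variable contributes 1 / |L|, Gamma_n contributes |L|, and the exponential variable
    contributes exp (- s zeta). Summation over L restores Lam (A /\ [C(w)]). *)
Lemma split_kernel n (D : set (path_before n)) (w : word) A s : measurable D -> D `<=` good W n ->
  measurable A -> 0 <= s ->
  (P (split_ok n.+1 `&` spath @^-1` (D `&` cylinder n w A s)) =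
   \int[P]_(o in split_ok n `&` spath @^-1` D) kern Lam W n w A s (spath o))%E.
Proof.
move=> mD Dg mA s0.
set K := split_ok n `&` spath @^-1` D.
have mK : measurable (K : set (before n)) by exact: split_ok_measurable.
have Ko : K `<=` split_ok n by move=> o [].
have mok m : measurable (split_ok m : set (before m)) by apply: ok_measurableT; exact: split_ok_measurable.
pose HL k : set (path_before n * Hyp) := [set p | choice.pickle (hit_list W n p.1 p.2) = k].
have mHL k : measurable (HL k).
  exact: (@measurable_countable_pred _ (path_before n * Hyp)%type _ (fun p => hit_list W n p.1 p.2)
    (fun L => choice.pickle L = k) (@measurable_hit_list _ _ _ W_window n)).
pose M k : set (path_before n * Hyp) := (setT `*` A) `&`
  ([set p | w \in hit_list W n p.1 p.2] `&` HL k).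
have mM k : measurable (M k).
  apply: measurableI; first exact: measurableX.
  apply: measurableI => //.
  exact: (@measurable_countable_pred _ (path_before n * Hyp)%type _ (fun p => hit_list W n p.1 p.2)
    (fun L => w \in L) (@measurable_hit_list _ _ _ W_window n)).
(* The total intensity, given a default value off the regular event so as to be measurable with
   respect to the past. *)
pose zz : before n -> R := (fun o => zt Lam W n (spath o)) \_ (split_ok n).
have mzz : measurable_fun setT zz.
  apply: (measurable_restrictT _ (mok n)).1.
  exact: (measurable_fun_spath (mok n) (fun _ h => h) (@measurable_zt R l Lam Lam_fin W W_window n)).
have zzE o : split_ok n o -> zz o = zt Lam W n (spath o) by move=> oo; rewrite /zz patchE mem_set.
have zz0 o : 0 <= zz o by rewrite /zz patchE; case: ifP => // _; exact: zt_ge0.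
pose E k : set Om := K `&` (ok_G n `&` proposed n @^-1` M k).
pose J1 := split_past n `|` [set inr n].
pose J2 := J1 `|` [set inl (inr n)].
have JM J : join_events F J `<=` measurable.
  by apply: join_events_measurable; exact: UVG_events_measurable.
have sub1 (B : set Om) : measurable (B : set (before n)) -> measurable (B : set (with_G n)).
  by apply: (@gen_mono _ Om); apply: join_events_mono => i; left.
have mE k : measurable (E k : set (with_G n)).
  apply: measurableI; first exact: sub1.
  apply: measurable_proposed => //; [exact: split_ok_measurable|].
  by apply: measurable_ok_G; exact: split_ok_measurable.
(* The waiting time is V / zeta, so it exceeds s iff V exceeds s zeta. *)
pose late o := s * zz o < V n.+1 o.
have mlate : measurable ([set o | late o] : set (g_sigma_algebraType (join_events F J2))).
  have mV : measurable_fun setT (V n.+1 : g_sigma_algebraType (join_events F J2) -> R).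
    by apply: (@measurable_rv_join _ Om _ P _ R _ F _ (inl (inr n)) (V n.+1)) => //; right.
  have mz : measurable_fun setT (zz : g_sigma_algebraType (join_events F J2) -> R).
    move=> _ B mB; have := mzz measurableT _ mB; rewrite !setTI.
    by apply: (@gen_mono _ Om); apply: join_events_mono => i; left; left.
  rewrite -[X in measurable X]setTI.
  have -> : [set o | late o] = (fun o => V n.+1 o - s * zz o) @^-1` [set v | 0 < v].
    by apply/seteqP; split => o /=; rewrite /late subr_gt0.
  have mdiff : measurable_fun setT ((fun o => V n.+1 o - s * zz o) : g_sigma_algebraType (join_events F J2) -> R).
    by apply: measurable_funB => //; exact: measurable_funM.
  apply: mdiff => //.
  by rewrite (_ : [set v | _] = `]0, +oo[%classic)//; apply/seteqP; split => v /=; rewrite in_itv/= andbT.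
have mEl k : measurable (E k `&` [set o | late o] : set (g_sigma_algebraType (join_events F J2))).
  apply: measurableI => //; apply: (@gen_mono _ Om _ _ _ _ (mE k)).
  by apply: join_events_mono => i; left.
(* On the piece of code [k] the hit list is fixed, so the slot condition becomes an event of U(n+1)
   alone. *)
pose E' k : set Om := (E k `&` [set o | late o]) `&`
  [set o | in_slot (hit_list W n (spath o) (shyp n o)) (U n.+1 o) w].
have E'L k L : choice.pickle L = k -> E' k = (E k `&` [set o | late o]) `&` U n.+1 @^-1` [set u | in_slot L u w].
  move=> kL; apply/seteqP; split => o [[Eo lo] /= uo]; split => //=; move: uo.
    by case: Eo => _ [_ [_ [_ /= /[!(esym kL)] /(pcan_inj choice.pickleK) ->]]].
  by case: Eo => _ [_ [_ [_ /= /[!(esym kL)] /(pcan_inj choice.pickleK) ->]]].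
have nL k : ~ (exists L : seq word, choice.pickle L = k) -> M k = set0.
  move=> nk; apply/seteqP; split => // p [_ [_ /= hp]]; apply: nk.
  by exists (hit_list W n p.1 p.2).
have mE' k : measurable (E' k).
  have [[L kL]|/nL M0] := pselect (exists L : seq word, choice.pickle L = k).
    rewrite (E'L k L kL); apply: measurableI; first exact: (gen_sub_measurable (@JM J2) (mEl k)).
    by rewrite -[X in measurable X]setTI; apply: measurable_funP => //; exact: measurable_slot.
  by rewrite /E' /E M0 preimage_set0 !setI0 !set0I.
pose kk k (x : path_before n) : \bar R :=
  (Lam (A `&` hits (pcell W n x w) `&` [set h | HL k (x, h)]) *
   ((zt Lam W n x)^-1 * expR (- (s * zt Lam W n x)))%:E)%E.
have mMs k x : measurable [set h | M k (x, h)] by exact: (@measurable_section2 _ _ (path_before n) Hyp).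
have wL x h : w \in hit_list W n x h <-> w \in pleaves n x /\ hits (pcell W n x w) h.
  rewrite mem_sort mem_filter; split=> [/andP[/asboolP]//|[wn wh]].
  by rewrite wn andbT; apply/asboolP.
have kkE k x : w \in pleaves n x ->
    A `&` hits (pcell W n x w) `&` [set h | HL k (x, h)] = [set h | M k (x, h)].
  move=> wn; apply/seteqP; split => h /=.
    by move=> [[Ah wh] kh]; split => //; split => //; apply/wL.
  by move=> [[_ Ah] [/wL[_ wh] kh]].
have M0 k x : w \notin pleaves n x -> [set h | M k (x, h)] = set0.
  by move=> /negP wn; apply/seteqP; split => // h /= [_ [/wL[]]].
have mEP k : measurable (E k : set Om) by exact: (gen_sub_measurable (@JM J1) (mE k)).
have mlP k : measurable (E k `&` [set o | late o] : set Om) by exact: (gen_sub_measurable (@JM J2) (mEl k)).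
have mzP : measurable_fun [set: Om] zz by exact: (measurable_fun_gen (@JM _) mzz).
have mzG : measurable_fun setT (zz : with_G n -> R).
  by move=> _ B mB; have := mzz measurableT _ mB; rewrite !setTI; exact: sub1.
have Plate k : (P (E k `&` [set o | late o]) = \int[P]_(o in E k) (expR (- (s * zz o)))%:E)%E.
  pose S : set (with_G n * R) := (E k `*` setT) `&` [set p | s * zz p.1 < p.2].
  have mS : measurable S.
    apply: measurableI; first exact: measurableX.
    have -> : [set p : with_G n * R | s * zz p.1 < p.2] = (fun p => p.2 - s * zz p.1) @^-1` [set v | 0 < v].
      by apply/seteqP; split => p /=; rewrite subr_gt0.
    rewrite -[X in measurable X]setTI.
    have mdiff : measurable_fun setT (fun p : with_G n * R => p.2 - s * zz p.1).
      apply: measurable_funB; first exact: measurable_snd.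
      by apply: measurable_funM => //; exact: (measurableT_comp mzG measurable_fst).
    apply: mdiff => //.
    by rewrite (_ : [set v | _] = `]0, +oo[%classic)//; apply/seteqP; split => v /=; rewrite in_itv/= andbT.
  rewrite measure_indic_integral//.
  pose g (p : with_G n * R) : \bar R := (\1_S p)%:E.
  have mg : measurable_fun setT g by apply/measurable_EFinP; exact: measurable_indic.
  have g0 p : (0 <= g p)%E by rewrite /g lee_fin indicE ler0n.
  rewrite (_ : (\int[P]_o _ = \int[P]_o g (o, V n.+1 o))%E); last first.
    apply: eq_integral => o _; rewrite /g !indicE; congr ((_%:R)%:E)%E; congr nat_of_bool.
    apply/idP/idP => /set_mem h; apply/mem_set; first by case: h => Eo lo.
    by case: h => -[Eo _] lo.
  rewrite (indep_rv_integral UVG_events_measurable UVG_eventsT UVG_eventsI UVG_indep (j := inl (inr n)) _ _ mg g0)//; last first.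
    by move=> [|//]; rewrite /= ltnn.
  rewrite -[RHS]integral_indicM//; apply: eq_integral => o _.
  have a0 : 0 <= s * zz o by rewrite mulr_ge0.
  rewrite -(exponential_tail (V_law n) a0) /g !indicE.
  have [Eo|nEo] := boolP (o \in E k); last first.
    rewrite mul0e integral0_eq// => v _; rewrite indicE memNset//.
    by move=> [[Eo _] _]; move/negP: nEo; apply; exact: mem_set.
  rewrite mul1e; apply: eq_integral => v _; rewrite indicE; congr ((_%:R)%:E)%E; congr nat_of_bool.
  apply/idP/idP => [/set_mem[_ //]|sv]; apply/mem_set; split => //; split => //; exact: set_mem Eo.
have PE k : (P (E' k) = \int[P]_(o in K) (if w \in pleaves n (spath o) then kk k (spath o) else 0))%E.
  (* A sample outcome exhibits the list of code [k]; if there is none, both sides vanish. *)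
  have [[q0 [h0 [Ko0 Mh0]]]|nM] := pselect (exists o h, K o /\ M k (spath o, h)); last first.
    rewrite (_ : E' k = set0) ?measure0; last first.
      by apply/seteqP; split => // o [[[Ko' [_ Mo]] _] _]; apply: nM; exists o, (shyp n o).
    rewrite integral0_eq// => o oK; case: ifP => // wn; rewrite /kk kkE//.
    rewrite (_ : [set h | _] = set0) ?measure0 ?mul0e//.
    by apply/seteqP; split => // h Mh; apply: nM; exists o, h.
  set L := hit_list W n (spath q0) h0.
  have kL : choice.pickle L = k by case: Mh0 => _ [].
  have wLL : w \in L by case: Mh0 => _ [].
  have uL : uniq L.
    by rewrite sort_uniq filter_uniq//; have [] := leaves_invariant (Dg _ Ko0.2).1.
  have sL : (size L)%:R != 0 :> R by rewrite pnatr_eq0 size_eq0; case: (L) wLL.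
  rewrite (E'L k L kL).
  rewrite (indep_rv UVG_events_measurable UVG_eventsT UVG_eventsI UVG_indep (j := inl (inl n)) _ _ (mEl k))//; last 2 first.
  - by move=> [[|]|//] //=; rewrite ltnn.
  - exact: measurable_slot.
  rewrite U_law ?uniform_slot//; last exact: measurable_slot.
  rewrite Plate muleC.
  have mexp : measurable_fun setT ((fun o => (expR (- (s * zz o)))%:E) : before n -> \bar R).
    apply/measurable_EFinP; apply: measurableT_comp => //; apply: measurable_funN.
    exact: measurable_funM.
  rewrite /E (split_G_step mK Ko (mM k) mexp)//.
  rewrite -ge0_integralZl_EFin ?invr_ge0//; last 3 first.
  - exact: (before_measurable mK).
  - by move=> o _; rewrite mule_ge0// ?jump_ge0// lee_fin expR_ge0.
  - have mm : measurable_fun (K : set (before n)) (fun o => (expR (- (s * zz o)))%:E * jump n (spath o) [set h | M k (spath o, h)])%E.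
      apply: emeasurable_funM; first exact: measurable_funTS.
      exact: (measurable_fun_spath mK Ko (measurable_jump (mM k))).
    by move=> mKP B mB; apply: before_measurable; exact: mm.
  apply: eq_integral => o /set_mem Ko'; have go := Dg _ Ko'.2.
  rewrite zzE; last exact: Ko.
  have BL : [set h | M k (spath o, h)] `<=` [set h | hit_list W n (spath o) h = L].
    by move=> h [_ [_ /= hk]]; apply: (pcan_inj choice.pickleK); rewrite hk kL.
  rewrite /jump (sum_hit_cells go _ BL)//.
  case: ifPn => wn; last by rewrite M0// measure0 !mule0.
  rewrite /kk kkE//.
  have LB : Lam [set h | M k (spath o, h)] \is a fin_num.
    have := @Lam_hits_fin R l Lam Lam_fin (pcell W n (spath o) w) [set h | M k (spath o, h)] (@pcell_compact R l W W_window n (spath o) w) (mMs k (spath o)).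
    congr (_ \is a fin_num); congr (Lam _); apply/setIidl => h [_ [/wL[]]] //.
  rewrite -(fineK LB) -!EFinM; congr (_%:E); rewrite [RHS]mulrC; field.
  by rewrite sL andbT gt_eqF// zt_gt0.
have okP m : measurable (split_ok m : set Om) := before_measurable (mok m).
transitivity (P ((\bigcup_k E' k) `&` split_ok n.+1)).
  congr (P _); apply/seteqP; split => o.
    move=> [oo [Do [wo Ao so]]]; split => //; have [ok [Go u01 L0 _ _]] := oo.
    set L := hit_list W n (spath o) (shyp n o) in L0.
    have [g _ _] := split_ok_state ok.
    have uL : uniq L by rewrite sort_uniq filter_uniq//; have [] := leaves_invariant g.1.
    have [e eL eu] := exists_slot uL L0 u01.
    have we : sword n o = e by rewrite /sword split_ok_hit_words// /select (head_slot uL eL eu).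
    rewrite [pword _ _]we in wo; rewrite wo in eL eu.
    exists (choice.pickle L) => //; split => //; split.
      by split => //; split => //; split.
    rewrite /= /late zzE//; move: so; rewrite /pwait /= split_ok_wait//.
    by rewrite (mulrC _^-1) ltr_pdivlMr ?zt_gt0.
  move=> [[k _ [[[[ok Do] [[_ Go] [[_ Ao] [wL' _]]]] lo] uo]] oo]; split => //; split => //.
  have [g _ _] := split_ok_state ok.
  have uL : uniq (hit_list W n (spath o) (shyp n o)).
    by rewrite sort_uniq filter_uniq//; have [] := leaves_invariant g.1.
  split => //.
    by rewrite [pword _ _](_ : _ = sword n o)// /sword split_ok_hit_words// /select (head_slot uL wL' uo).
  move: lo; rewrite /= /late zzE// /pwait /= split_ok_wait//.
  by rewrite (mulrC _^-1) ltr_pdivlMr ?zt_gt0.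
rewrite measure_setI_full//; [|exact: bigcupT_measurable|exact: split_ok_measure].
rewrite measure_bigcupT//; last first.
  move=> i j _ _ [t [[[[_ [_ [_ [_ /= <-]]]] _] _] [[[_ [_ [_ [_ /= <-]]]] _] _]]]; exact: erefl.
have mkk k : measurable_fun setT (fun x : path_before n => if w \in pleaves n x then kk k x else 0%E).
  apply: measurable_fun_if => //.
  - apply: (measurable_fun_bool true); rewrite setTI.
    exact: (@measurable_countable_pred _ (path_before n) _ (pleaves n) (fun E => w \in E) (@measurable_pleaves R l n)).
  - apply: measurable_funTS; apply: emeasurable_funM.
      pose M' : set (path_before n * Hyp) := (snd @^-1` A `&` [set p | hits (pcell W n p.1 w) p.2]) `&` HL k.
      have mM' : measurable M'.
        apply: measurableI => //; apply: measurableI; last exact: measurable_hits_pcell.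
        by rewrite -[X in measurable X]setTI; exact: (@measurable_snd _ _ (path_before n) Hyp).
      apply: (@measurable_Lam_section _ _ _ Lam_fin _ W_window _ _ M' mM') => p [[_ hp] _].
      by apply: sub_hits hp; exact: tree_cell_sub.
    apply/measurable_EFinP; apply: measurable_funM.
      by apply: measurable_inv_ge0; [exact: measurable_zt|exact: zt_ge0].
    apply: measurableT_comp => //; apply: measurable_funN; apply: measurable_funM => //.
    exact: measurable_zt.
have kk0 k x : (0 <= if w \in pleaves n x then kk k x else 0)%E.
  by case: ifP => // _; rewrite mule_ge0// lee_fin mulr_ge0 ?expR_ge0// invr_ge0 zt_ge0.
transitivity (\sum_(k <oo) \int[P]_(o in K) (if w \in pleaves n (spath o) then kk k (spath o) else 0))%E.
  by apply: eq_eseriesr => k _; exact: PE.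
rewrite -integral_nneseries//; last 2 first.
- exact: (before_measurable mK).
- move=> k mKP B mB; apply: before_measurable.
  exact: (measurable_fun_spath mK Ko (mkk k)).
apply: eq_integral => o /set_mem Ko'; rewrite /kern; case: ifPn => wn; last first.
  by rewrite eseries0.
rewrite /kk; under eq_eseriesr do rewrite muleC.
rewrite nneseriesZl// muleC; congr (_ * _)%E.
have mhw : measurable (hits (pcell W n (spath o) w)).
  exact: (measurable_hits (@pcell_compact R l W W_window n (spath o) w)).
rewrite (measure_pickle Lam (c := hit_list W n (spath o)) (measurableI _ _ mA mhw))// => L.
exact: (@measurable_section2 _ _ (path_before n) Hyp [set p | hit_list W n p.1 p.2 = L] (spath o) (@measurable_hit_list _ _ _ W_window n L)).
Qed.

(** * The random path as a measurable map, and non-explosion *)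

Definition all_ok : set Om := \bigcap_n split_ok n.

Let mok n : measurable (split_ok n : set Om) :=
  before_measurable (ok_measurableT (@split_ok_measurable n)).

Lemma measurable_all_ok : measurable all_ok.
Proof. exact: bigcapT_measurable. Qed.

Lemma all_ok_measure : P all_ok = 1%E.
Proof.
have PC : P (~` all_ok) = 0%E.
  apply: measure_negligible; first exact: measurableC measurable_all_ok.
  rewrite /all_ok setC_bigcap; apply: negligible_bigcup => n.
  exists (~` split_ok n); split => //; first exact: measurableC.
  by apply: probability_compl0 => //; exact: split_ok_measure.
rewrite -[X in P X]setCK probability_setC ?PC ?sube0//.
exact: measurableC measurable_all_ok.
Qed.

(** A default path is taken off the regular event, which makes the map measurable everywhere. *)
Definition split_path : Om -> paths := (spath : Om -> paths) \_ all_ok.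

Lemma split_pathE w : all_ok w -> split_path w = spath w.
Proof. by move=> ow; rewrite /split_path patchE mem_set. Qed.

Lemma measurable_split_path : measurable_fun setT split_path.
Proof.
apply: (@measurability _ _ Om paths _ _ path_gen) => // _ [B [i _ Bi] <-]; rewrite setTI.
rewrite (_ : split_path @^-1` B = (all_ok `&` (split_ok i.+1 `&` spath @^-1` B)) `|`
   (~` all_ok `&` [set w | B point])).
  apply: measurableU.
    apply: measurableI; first exact: measurable_all_ok.
    apply: (@before_measurable i.+1); apply: split_ok_measurable.
    by apply: sub_sigma_algebra; exists i => //=.
  apply: measurableI; first by apply: measurableC; exact: measurable_all_ok.
  have [h|h] := pselect (B point).
    by rewrite (_ : [set _ | _] = setT)//; apply/seteqP; split.
  by rewrite (_ : [set _ | _] = set0)//; apply/seteqP; split.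
apply/seteqP; split => w.
  move=> Bw; have [ow|nw] := pselect (all_ok w); [left|right]; split => //.
    by split; [exact: ow|move: Bw; rewrite /= split_pathE].
  by move: Bw; rewrite /= /split_path patchE memNset.
move=> [[ow [_ Bw]]|[nw Bw]]; first by rewrite /= split_pathE.
by rewrite /= /split_path patchE memNset.
Qed.

(** Bounds exp (- S_n) from above on regular outcomes, each zeta being replaced by its bound from
    [zt_le]. It is a product of independent factors, so its mean is explicit. *)
Definition weight n w : R := \prod_(i < n)
  (((0 < V i.+1 w)%R%:R : R) * expR (- ((i.+1%:R * fine (Lam (hits W)))^-1 * V i.+1 w))).

Let c : R := fine (Lam (hits W)).
Let c0 : 0 < c.
Proof.
apply: fine_gt0; rewrite (hits_ltoo Lam_fin (polytope_compact W_window.1)) andbT.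
by apply: hits_gt0 => //; [exact: polytope_compact W_window.1|case: W_window].
Qed.

Let rate (i : nat) : R := (i.+1%:R * c)^-1.

Let rate_ge0 i : 0 <= rate i.
Proof. by rewrite invr_ge0 mulr_ge0// ltW. Qed.

Lemma measurable_weight n : measurable_fun setT (weight n : before n -> R).
Proof.
apply: measurable_prod => i _.
have mV : measurable_fun setT (V i.+1 : before n -> R).
  by apply: (@measurable_rv_join _ Om _ P _ R _ F _ (inl (inr (i : nat))) (V i.+1)) => //=.
apply: measurable_funM.
  rewrite (_ : (fun w => _) = (fun w : before n => \1_(V i.+1 @^-1` [set v | 0 < v]) w)).
    apply: measurable_indic; rewrite -[X in measurable X]setTI; apply: mV => //.
    by rewrite (_ : [set v | _] = `]0, +oo[%classic)//; apply/seteqP; split => v /=; rewrite in_itv/= andbT.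
  by apply/funext => w; rewrite indicE mem_setE.
by apply: measurableT_comp => //; apply: measurable_funN; apply: measurable_funM.
Qed.

Lemma weight_ge0 n w : 0 <= weight n w.
Proof. by apply: prodr_ge0 => i _; rewrite mulr_ge0// expR_ge0. Qed.

Lemma integral_weight n : (\int[P]_w (weight n w)%:E = (\prod_(i < n) (1 + rate i)^-1)%:E)%E.
Proof.
elim: n => [|n ih].
  under eq_integral do rewrite /weight big_ord0.
  by rewrite big_ord0 integral_cst// mul1e; exact: probability_setT.
pose g (p : before n * R) : \bar R :=
  ((weight n p.1)%:E * (((0 < p.2)%R%:R * expR (- rate n * p.2)))%:E)%E.
have mg : measurable_fun setT g.
  apply: emeasurable_funM.
    by apply/measurable_EFinP; exact: (measurableT_comp (@measurable_weight n) measurable_fst).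
  apply/measurable_EFinP; apply: measurable_funM; last first.
    by apply: measurableT_comp => //; apply: measurable_funM => //; exact: measurable_snd.
  rewrite (_ : (fun p => _) = (fun p : before n * R => \1_(snd @^-1` [set v | 0 < v]) p)).
    apply: measurable_indic; rewrite -[X in measurable X]setTI; apply: measurable_snd => //.
    by rewrite (_ : [set v | _] = `]0, +oo[%classic)//; apply/seteqP; split => v /=; rewrite in_itv/= andbT.
  by apply/funext => p; rewrite indicE mem_setE.
have g0 p : (0 <= g p)%E.
  by rewrite mule_ge0// lee_fin ?weight_ge0// mulr_ge0// expR_ge0.
rewrite (_ : (\int[P]_w _ = \int[P]_w g (w, V n.+1 w))%E); last first.
  by apply: eq_integral => w _; rewrite /weight big_ord_recr EFinM /g mulNr.
rewrite (indep_rv_integral UVG_events_measurable UVG_eventsT UVG_eventsI UVG_indep (j := inl (inr n)) _ _ mg g0)//; last first.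
  by rewrite /split_past /= ltnn.
have nz : 1 + rate n != 0 by rewrite gt_eqF// ltr_pwDl.
have inner w : (\int[distribution P (V n.+1)]_v g (w, v) = (weight n w)%:E * ((1 + rate n)^-1)%:E)%E.
  rewrite /g /= ge0_integralZl_EFin ?weight_ge0//; last first.
    apply/measurable_EFinP; apply: measurable_funM; last first.
      by apply: measurableT_comp => //; exact: measurable_funM.
    rewrite (_ : (fun p => _) = (fun p : R => \1_([set v : R | 0 < v]) p)).
      apply: measurable_indic.
      by rewrite (_ : [set v | _] = `]0, +oo[%classic)//; apply/seteqP; split => v /=; rewrite in_itv/= andbT.
    by apply/funext => p; rewrite indicE mem_setE.
  by rewrite (exponential_tail_integral (V_law n) (lexx 0) (rate_ge0 n)) mulr0 expR0 div1r.
under eq_integral do rewrite inner.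
rewrite ge0_integralZr//; last 3 first.
- apply/measurable_EFinP; apply: (measurable_fun_gen _ (@measurable_weight n)).
  by apply: join_events_measurable; exact: UVG_events_measurable.
- by move=> w _; rewrite lee_fin weight_ge0.
- by rewrite lee_fin invr_ge0 addr_ge0.
by rewrite ih big_ord_recr EFinM.
Qed.

(** The product of the 1 + rate i is at least 1 plus a multiple of a partial sum of the harmonic
    series, which diverges. *)
Lemma weight_small (eps : R) : 0 < eps -> exists n, \prod_(i < n) (1 + rate i)^-1 < eps.
Proof.
move=> e0.
have lower n : 1 + c^-1 * series (@harmonic R) n <= \prod_(i < n) (1 + rate i).
  elim: n => [|n ih]; first by rewrite /series /= big_geq// big_ord0 mulr0 addr0.
  rewrite big_ord_recr /= mulrDr mulr1 seriesSr mulrDr addrA; apply: lerD => //.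
  rewrite /harmonic /rate /= invfM mulrC ler_peMl//; first by rewrite mulr_ge0// invr_ge0// ltW.
  apply: le_trans ih; rewrite lerDl mulr_ge0//; first by rewrite invr_ge0 ltW.
  by apply: sumr_ge0 => i _; rewrite invr_ge0.
have [n hn] : exists n, c * eps^-1 < series (@harmonic R) n.
  apply: contrapT => nex; apply: (@dvg_harmonic R).
  apply: nondecreasing_is_cvgn.
    by apply/nondecreasing_seqP => n; rewrite seriesSr lerDl invr_ge0.
  exists (c * eps^-1) => _ [n _ <-]; rewrite leNgt; apply/negP => h; apply: nex; by exists n.
exists n; rewrite prodfV invf_plt ?posrE//.
  apply: lt_le_trans (lower n); rewrite ltr_wpDl//.
  by rewrite mulrC ltr_pdivlMr// mulrC.
by apply: lt_le_trans (lower n); rewrite ltr_pwDl// mulr_ge0 ?invr_ge0 ?(ltW c0)//; apply: sumr_ge0 => i _; rewrite invr_ge0.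
Qed.

Lemma split_ptime w n : all_ok w -> expR (- ptime n (spath w)) <= weight n w.
Proof.
move=> ow; rewrite /ptime -sumrN expR_sum; apply: ler_prod => i _; rewrite expR_ge0/=.
have v0 : 0 < V i.+1 w by have [_ []] := ow i.+1 I.
rewrite v0 mul1r ler_expR lerN2 /pwait /= split_ok_wait; last exact: ow.
have [g _ _] := split_ok_state (ow i I).
rewrite ler_wpM2r ?(ltW v0)// lef_pV2 ?posrE ?mulr_gt0 ?zt_gt0//.
exact: zt_le.
Qed.

(** If all split times are at most M, then every weight is at least exp (- M). By Markov's
    inequality this has probability at most exp M times the mean weight, which can be made
    arbitrarily small. *)
Lemma split_no_explosion :
  {ae P, forall w, all_ok w -> forall M : nat, exists n, M%:R < ptime n (spath w)}.
Proof.
have mw n : measurable_fun [set: Om] (weight n).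
  apply: (measurable_fun_gen _ (@measurable_weight n)).
  by apply: join_events_measurable; exact: UVG_events_measurable.
pose B (M n : nat) := [set w | expR (- M%:R) <= weight n w].
have mB M n : measurable (B M n).
  rewrite (_ : B M n = weight n @^-1` `[expR (- M%:R), +oo[%classic).
    by rewrite -[X in measurable X]setTI; exact: mw.
  by apply/seteqP; split => w /=; rewrite in_itv/= andbT.
have PB M n : ((expR (- M%:R))%:E * P (B M n) <= (\prod_(i < n) (1 + rate i)^-1)%:E)%E.
  rewrite -integral_weight (measure_indic_integral P (mB M n)) -ge0_integralZl_EFin ?expR_ge0//; last first.
    by apply/measurable_EFinP; exact: measurable_indic.
  apply: ge0_le_integral => //.
  - by apply: emeasurable_funM => //; apply/measurable_EFinP; exact: measurable_indic.
  - exact/measurable_EFinP.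
  - move=> w _; rewrite indicE; case: (boolP (w \in B M n)) => [/set_mem h|_].
      by rewrite mule1 lee_fin.
    by rewrite mule0 lee_fin weight_ge0.
have N0 M : P.-negligible (\bigcap_n B M n).
  have mBB : measurable (\bigcap_n B M n) by exact: bigcapT_measurable.
  exists (\bigcap_n B M n); split => //.
  apply/eqP; rewrite eq_le measure_ge0 andbT leNgt; apply/negP => P0.
  have Pfin : P (\bigcap_n B M n) \is a fin_num by exact: fin_num_measure.
  have := P0; rewrite -(fineK Pfin) lte_fin => p0.
  have [n] := weight_small (mulr_gt0 (expR_gt0 (- M%:R)) p0).
  rewrite ltNge => /negP; apply; rewrite -lee_fin EFinM (fineK Pfin).
  apply: le_trans (PB M n); apply: lee_wpmul2l; first by rewrite lee_fin expR_ge0.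
  by apply: measure_mono => // w; apply.
apply: (negligibleS _ (negligible_bigcup N0)) => w /= /not_implyP[ow /existsNP[M nM]].
exists M => // n _; rewrite /B /=; apply: le_trans (split_ptime n ow).
by rewrite ler_expR lerN2 leNgt; apply/negP => h; apply: nM; exists n.
Qed.

Lemma split_process_chain : exists X : {RV P >-> paths},
  [/\ {ae P, forall w, good_path W (X w) /\
         (fun t => split_process Lam W Xi (fun k => U k w) (fun k => V k w) (fun k => G k w) t)
         = path_process W (X w)},
      forall n, distribution P X (good W n) = 1%E &
      split_chain Lam W (distribution P X)].
Proof.
pose X : {RV P >-> paths} := HB.pack split_path (isMeasurableFun.Build _ _ _ _ _ measurable_split_path).
have PI A : measurable A -> P A = P (A `&` all_ok).
  by move=> mA; rewrite measure_setI_full//; [exact: measurable_all_ok|exact: all_ok_measure].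
have mX A : measurable A -> measurable (split_path @^-1` A).
  by move=> mA; rewrite -[X in measurable X]setTI; exact: measurable_split_path.
exists X; split.
- have aok : {ae P, forall w, all_ok w}.
    exists (~` all_ok); split; first exact: measurableC measurable_all_ok.
    + by apply: probability_compl0; [exact: measurable_all_ok|exact: all_ok_measure].
    + by move=> w.
  apply: filterS2 aok split_no_explosion => w ow /(_ ow) ne.
  rewrite [X w](split_pathE ow); split.
    by split => // n; have [] := split_ok_state (ow n I).
  apply/funext => t; rewrite /split_process /path_process.
  have jE n : jump_time Lam W Xi (fun k => U k w) (fun k => V k w) (fun k => G k w) n = ptime n (spath w).
    by rewrite /jump_time /ptime big_add1 big_mkord.
  apply/seteqP; split => C [n /= tn Cn]; exists n => //=.
  + by move: tn; rewrite !jE.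
  + by rewrite -split_ok_cells//; exact: ow.
  + by rewrite !jE.
  + by rewrite /split_tess -/(sstate n w) split_ok_cells//; exact: ow.
- move=> n; have mg : measurable (good W n : set paths).
    by apply: measurable_before_path; exact: measurable_good.
  rewrite /distribution /pushforward /= PI; last exact: mX.
  rewrite -all_ok_measure; congr (P _); apply/setIidr => w ow; rewrite /= split_pathE//.
  by have [] := split_ok_state (ow n I).
- move=> n D w A s mD Dg mA s0.
  have mDP : measurable (D : set paths) := measurable_before_path mD.
  have mkP : measurable_fun setT (kern Lam W n w A s : paths -> \bar R).
    by apply: (@measurable_fun_gen _ paths (events_before n)); [exact: events_before_sub|exact: measurable_kern].
  rewrite /distribution ge0_integral_pushforward//; last 2 first.
  - exact: measurable_funTS.
  - by move=> x _; exact: kern_ge0.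
  have mcyl' := measurable_setI_cylinder w s mD mA.
  have mcyl : measurable (D `&` cylinder n w A s : set paths) := measurable_before_path mcyl'.
  transitivity (P (split_path @^-1` (D `&` cylinder n w A s) `&` all_ok)).
    by apply: PI; exact: mX.
  have mS B : measurable (B : set (path_before n.+1)) -> measurable (split_ok n.+1 `&` spath @^-1` B : set Om).
    by move=> mB; apply: (@before_measurable n.+1); exact: split_ok_measurable.
  have mS0 B : measurable (B : set (path_before n)) -> measurable (split_ok n `&` spath @^-1` B : set Om).
    by move=> mB; apply: (@before_measurable n); exact: split_ok_measurable.
  have II B (f : Om -> \bar R) : measurable B -> measurable_fun B f -> (forall o, B o -> 0 <= f o)%E ->
      (\int[P]_(o in B) f o = \int[P]_(o in B `&` all_ok) f o)%E.
    move=> mB mf f0; have mC := measurableC measurable_all_ok.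
    rewrite (@ge0_negligible_integral _ _ _ P _ (~` all_ok) f mC mB)//; last first.
      by apply: probability_compl0; [exact: measurable_all_ok|exact: all_ok_measure].
    by rewrite setDE setCK.
  transitivity (P (split_ok n.+1 `&` spath @^-1` (D `&` cylinder n w A s))).
    apply/esym; apply: etrans; first by apply: PI; exact: mS.
    apply/esym; congr (P _); apply/seteqP; split => o [Do oo]; split => //.
      by split; [exact: oo|move: Do; rewrite /= split_pathE].
    by case: Do => _; rewrite /= split_pathE.
  rewrite (split_kernel w mD Dg mA s0).
  transitivity (\int[P]_(o in (split_ok n `&` spath @^-1` D) `&` all_ok) kern Lam W n w A s (spath o))%E.
    apply: (II _ (fun o => kern Lam W n w A s (spath o))); last by move=> o _; exact: kern_ge0.
      exact: mS0.
    have mo : measurable (split_ok n `&` spath @^-1` D : set (before n)) by exact: split_ok_measurable.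
    have := measurable_fun_spath mo (@subIsetl _ _ _) (@measurable_kern R l Lam Lam_fin W W_window n w A s mA).
    by move=> h mm B mB; apply: before_measurable; exact: h.
  apply/esym; transitivity (\int[P]_(o in split_path @^-1` D `&` all_ok) kern Lam W n w A s (split_path o))%E.
    apply: (II _ (fun o => kern Lam W n w A s (split_path o))); last by move=> o _; exact: kern_ge0.
      exact: mX.
    by apply: measurable_funTS; apply: (measurableT_comp mkP); exact: measurable_split_path.
  apply/esym; transitivity (\int[P]_(o in split_path @^-1` D `&` all_ok) kern Lam W n w A s (spath o))%E.
    congr (integral _ _ _); apply/seteqP; split => o [Do oo]; split => //.
      by rewrite /= split_pathE//; case: Do.
    by move: Do; rewrite /= split_pathE// => Do; split => //; exact: oo.
  by apply: eq_integral => o /set_mem[_ oo]; rewrite split_pathE.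
Qed.

End split_side.

(** * The STIT process *)

Section stit_stages.
Context {R : realType} {l : nat}.
Local Notation Vec := 'rV[R]_l.+1.
Local Notation Hyp := (hyperplane R l).
Variable W : set Vec.
Implicit Types (g : nat -> Hyp) (C : set Vec) (m n i : nat) (e f : word).

Definition first_hit g m C n := [/\ (m < n)%N, hits C (g n) &
  forall k, (m < k < n)%N -> ~ hits C (g k)].

Definition next_index g m C : option nat := xget None [set Some n | n in first_hit g m C].

Lemma first_hit_uniq g m C n n' : first_hit g m C n -> first_hit g m C n' -> n = n'.
Proof.
move=> [mn hn fn] [mn' hn' fn']; apply/eqP; rewrite eqn_leq; apply/andP.
by split; rewrite leqNgt; apply/negP => h; [apply: (fn n')|apply: (fn' n)]; rewrite ?mn ?mn'.
Qed.

Lemma next_indexE g m C n : next_index g m C = Some n <-> first_hit g m C n.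
Proof.
split; first by rewrite /next_index; case: xgetP => [_ -> [k fk <-] [<-]|].
move=> fn; rewrite /next_index; case: xgetP => [_ -> [k fk <-]|]; first by rewrite (first_hit_uniq fk fn).
by move=> /(_ (Some n)) h; case: h; exists n.
Qed.

(* The last index used for the words of code less than [i], and their         *)
(* hyperplanes; [None] records that some cell is never hit.                   *)
Fixpoint stage g i : option nat * (word -> Hyp) :=
  if i is j.+1 then
    let: (u, H) := stage g j in
    let u' := if u is Some m then next_index g m (tree_cell W H (nth_word j)) else None in
    (u', fun f => if f == nth_word j then (if u' is Some n then g n else point) else H f)
  else (Some 0%N, fun=> point).

(** Read off the stage at which the word receives its hyperplane; later stages leave it
    unchanged. *)
Definition stit_hyp g e : Hyp := (stage g (word_code e).+1).2 e.

Lemma stage_hyp g i f : (word_code f < i)%N -> (stage g i).2 f = stit_hyp g f.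
Proof.
elim: i => // i ih; rewrite ltnS leq_eqVlt => /orP[/eqP <- //|fi].
rewrite -ih//=; case: (stage g i) => u H /=; case: eqP => // fE.
by rewrite fE nth_wordK ltnn in fi.
Qed.

Lemma stage_cell g e i : (word_code e <= i)%N -> tree_cell W (stage g i).2 e = tree_cell W (stit_hyp g) e.
Proof.
move=> ei; apply: eq_tree_cell => f /ancestor_word_code fe; rewrite stage_hyp//.
exact: leq_trans ei.
Qed.

Lemma stage_some g i n : (stage g i.+1).1 = Some n <->
  exists2 m, (stage g i).1 = Some m & first_hit g m (tree_cell W (stit_hyp g) (nth_word i)) n.
Proof.
rewrite -(@stage_cell g (nth_word i) i) ?nth_wordK//=; case: (stage g i) => -[m|] H /=; last by split => [//|[]].
split; first by move=> /next_indexE fn; exists m.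
by move=> [_ [<-] /next_indexE].
Qed.

Lemma stit_hyp_some g e n : (stage g (word_code e).+1).1 = Some n -> stit_hyp g e = g n.
Proof.
rewrite /stit_hyp /=; case: (stage g (word_code e)) => -[m|] H //= ->.
by rewrite word_codeK eqxx.
Qed.

Lemma stit_hyp_none g e : (stage g (word_code e).+1).1 = None -> stit_hyp g e = point.
Proof.
rewrite /stit_hyp /=; case: (stage g (word_code e)) => -[m|] H //=; last by rewrite word_codeK eqxx.
by move=> ->; rewrite word_codeK eqxx.
Qed.

End stit_stages.

Lemma tree_cell_window {R : realType} {l : nat} (W : set 'rV[R]_l.+1) (H : word -> hyperplane R l) e :
  window W -> (forall f, f \in ancestors e -> cuts (tree_cell W H f) (H f)) ->
  window (tree_cell W H e).
Proof.
move=> wW; elim: e => //= b e ih h; apply: window_cut; last by apply: h; rewrite mem_head.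
by apply: ih => f fe; apply: h; rewrite inE fe orbT.
Qed.

Section stit_side.
Context {R : realType} {l : nat}.
Local Notation Vec := 'rV[R]_l.+1.
Local Notation Hyp := (hyperplane R l).
Variable Lam : {measure set (hyperplane R l) -> \bar R}.
Hypothesis Lam_neq0 : Lam setT <> 0%E.
Hypothesis Lam_inv : translation_invariant Lam.
Hypothesis Lam_fin : locally_finite Lam.
Variable W : set Vec.
Hypothesis W_window : window W.
Context d (Om : measurableType d) (P : probability Om R).
Variables (Z : word -> {RV P >-> R}) (G : nat -> {RV P >-> hyperplane R l}).
Implicit Types (w : Om) (n i m p : nat) (e f : word).

Local Notation F := (ZG_events Z G).

Lemma ZG_events_measurable (i : word + nat) : F i `<=` measurable.
Proof. by case: i => n; exact: events_of_measurable. Qed.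

Lemma ZG_eventsT (i : word + nat) : F i setT.
Proof. by case: i => n; exact: events_ofT. Qed.

Lemma ZG_eventsI (i : word + nat) : setI_closed (F i).
Proof. by case: i => n; exact: events_ofI. Qed.

(** The variables G(1), ..., G(m), without the clocks. *)
Definition known m : set (word + nat) := [set i | if i is inr k then (k < m)%N else False].

Local Notation sigma m := (g_sigma_algebraType (join_events F (known m))).

Lemma known_le m n : (m <= n)%N -> known m `<=` known n.
Proof. by move=> mn [//|k] /= h; exact: leq_trans mn. Qed.

Lemma sigma_le m n (A : set Om) : (m <= n)%N -> measurable (A : set (sigma m)) -> measurable (A : set (sigma n)).
Proof. by move=> mn; apply: (@gen_mono _ Om); apply: join_events_mono; exact: known_le. Qed.

Definition stg i w := stage W (fun k => G k w) i.
Definition hyp e w : Hyp := stit_hyp W (fun k => G k w) e.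

Definition at_index i m : set Om := [set w | (stg i w).1 = Some m].

(** Hyperplanes are given a default value off [at_index i m], so that this set depends on G(1), ...,
    G(m) on all outcomes. *)
Definition stage_cells i m w : set Vec :=
  tree_cell W (fun f => ((fun w => (stg i w).2 f) \_ (at_index i m)) w) (nth_word i).

Definition hit_at i m k : set Om := [set w | hits (stage_cells i m w) (G k w)].

Definition waiting_at i m p : set Om :=
  at_index i m `&` \bigcap_(k in [set k | (m < k <= p)%N]) ~` hit_at i m k.

Lemma stage_cellsE i m w : at_index i m w -> stage_cells i m w = tree_cell W (hyp ^~ w) (nth_word i).
Proof.
move=> aw; rewrite /stage_cells -(@stage_cell R l W _ (nth_word i) i) ?nth_wordK//.
by apply: eq_tree_cell => f _; rewrite patchE mem_set.
Qed.

(** Here [n.-1] is the last index before the hit; m < n makes it at least m. *)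
Lemma at_indexS i n : at_index i.+1 n =
  \bigcup_(m in `I_n) (waiting_at i m n.-1 `&` hit_at i m n).
Proof.
apply/seteqP; split => w /=.
  move=> /stage_some[m mi [mn hn fn]]; exists m => //.
  have aw : at_index i m w by [].
  split; last by rewrite /hit_at /= stage_cellsE.
  split => // k /= /andP[mk kn]; rewrite /hit_at /= stage_cellsE//; apply: fn.
  by rewrite mk /= (leq_ltn_trans kn)// prednK// (leq_ltn_trans _ mn).
move=> [m mn [[aw nh] hn]]; apply/stage_some; exists m => //; split => //.
  by move: hn; rewrite /hit_at /= stage_cellsE.
move=> k /andP[mk kn]; have := nh k; rewrite /hit_at /= stage_cellsE//; apply.
by rewrite mk /= -ltnS prednK// (leq_ltn_trans _ kn).
Qed.

Let measurable_G m k : (0 < k <= m)%N -> measurable_fun setT (G k : sigma m -> Hyp).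
Proof.
case: k => // k /andP[_ km].
by apply: (@measurable_rv_join _ Om _ P _ Hyp _ F _ (inr k) (G k.+1)).
Qed.

Definition stage_measurable i := forall m f B, measurable B ->
  measurable (at_index i m `&` [set w | B ((stg i w).2 f)] : set (sigma m)).

Lemma measurable_at_index i m : stage_measurable i -> measurable (at_index i m : set (sigma m)).
Proof. by move=> h; have := h m [::] _ measurableT; rewrite (_ : [set w | _] = setT) ?setIT//; apply/seteqP; split. Qed.

Lemma measurable_stage_hyp i m f : stage_measurable i ->
  measurable_fun setT ((fun w => (stg i w).2 f) \_ (at_index i m) : sigma m -> Hyp).
Proof.
move=> h; have mA := @measurable_at_index i m h.
apply: (@measurable_restrictT _ _ (sigma m) Hyp (at_index i m) (fun w => (stg i w).2 f) mA).1.
by move=> _ B mB; exact: h.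
Qed.

Lemma measurable_hit_at i m k : stage_measurable i -> (m < k)%N ->
  measurable (hit_at i m k : set (sigma k)).
Proof.
move=> h mk.
apply: (@measurable_hits_cell _ _ _ (polytope_compact W_window.1) _ (sigma k)
  (fun w f => ((fun w => (stg i w).2 f) \_ (at_index i m)) w) _ _ (G k)).
  move=> f _ B mB; rewrite setTI; apply: (@sigma_le m k); first exact: ltnW.
  by have := @measurable_stage_hyp i m f h measurableT B mB; rewrite setTI.
by apply: measurable_G; rewrite (leq_ltn_trans _ mk)/=.
Qed.

Lemma measurable_waiting_at i m p : stage_measurable i -> (m <= p)%N ->
  measurable (waiting_at i m p : set (sigma p)).
Proof.
move=> h mp; apply: measurableI.
  by apply: (sigma_le mp); exact: measurable_at_index.
apply: bigcap_measurableType => k /= /andP[mk kp]; apply: measurableC.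
by apply: (sigma_le kp); exact: measurable_hit_at.
Qed.

(** The last index used is a stopping time for the sequence G, and the hyperplanes assigned so far
    are known at that time. *)
Lemma all_stage_measurable i : stage_measurable i.
Proof.
elim: i => [|i ih] m f B mB.
  have [->|m0] := eqVneq m 0%N; last first.
    rewrite (_ : _ `&` _ = set0)//; apply/seteqP; split => // w [] [/= m0'].
    by rewrite -m0' in m0.
  have [h|h] := pselect (B point).
    by rewrite (_ : _ `&` _ = setT)//; apply/seteqP; split.
  by rewrite (_ : _ `&` _ = set0)//; apply/seteqP; split => // w [].
have mS n k : (k < n)%N -> measurable (waiting_at i k n.-1 `&` hit_at i k n : set (sigma n)).
  move=> kn; apply: measurableI; last exact: measurable_hit_at.
  apply: (@sigma_le n.-1); first exact: leq_pred.
  by apply: measurable_waiting_at => //; rewrite -ltnS prednK// (leq_ltn_trans _ kn).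
have m0 w : at_index i.+1 m w -> (0 < m)%N.
  by rewrite at_indexS => -[k /= km _]; exact: leq_ltn_trans km.
have mat : measurable (at_index i.+1 m : set (sigma m)).
  by rewrite at_indexS; apply: bigcup_measurable => k /= km; exact: mS.
have [fi|fi] := eqVneq f (nth_word i).
  have [->|m1] := posnP m.
    rewrite (_ : _ `&` _ = set0)//; apply/seteqP; split => // w [].
    by rewrite at_indexS => -[].
  rewrite (_ : _ `&` _ = at_index i.+1 m `&` G m @^-1` B).
    apply: measurableI => //; rewrite -[X in measurable X]setTI.
    by apply: measurable_G => //; rewrite m1 /=.
  apply/seteqP; split => w [aw]; rewrite fi.
    have aw' := aw; rewrite /at_index /= -{1}(nth_wordK i) in aw'.
    rewrite /= stage_hyp ?nth_wordK// => Bw; split => //=.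
    by rewrite -(stit_hyp_some aw').
  have aw' := aw; rewrite /at_index /= -{1}(nth_wordK i) in aw'.
  move=> Bw; split => //=; rewrite stage_hyp ?nth_wordK//.
  by rewrite (stit_hyp_some aw').
rewrite (_ : _ `&` _ = \bigcup_(k in `I_m) ((at_index i k `&` [set w | B ((stg i w).2 f)]) `&`
    (waiting_at i k m.-1 `&` hit_at i k m))).
  apply: bigcup_measurable => k /= km; apply: measurableI; last exact: mS.
  by apply: (@sigma_le k); [exact: ltnW|exact: ih].
have sE w : (stg i.+1 w).2 f = (stg i w).2 f.
  by rewrite /stg /=; case: (stage _ _ i) => u H /=; rewrite (negPf fi).
rewrite at_indexS; apply/seteqP; split => w.
  by move=> [[k km [[ak nk] hk]]] /=; rewrite sE => Bw; exists k => //.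
by move=> [k km [[ak Bw] h]]; split; [exists k|rewrite /= sE].
Qed.

Lemma sigma_sub m (A : set Om) : measurable (A : set (sigma m)) -> measurable A.
Proof. by apply: gen_sub_measurable; apply: join_events_measurable; exact: ZG_events_measurable. Qed.

Definition all_G : set (word + nat) := [set i | if i is inr _ then True else False].

Lemma measurable_hyp e : measurable_fun setT (hyp e : g_sigma_algebraType (join_events F all_G) -> Hyp).
Proof.
have up m (A : set Om) : measurable (A : set (sigma m)) ->
    measurable (A : set (g_sigma_algebraType (join_events F all_G))).
  by apply: (@gen_mono _ Om); apply: join_events_mono => -[].
move=> _ B mB; rewrite setTI.
pose E m := at_index (word_code e).+1 m `&` [set w | B ((stg (word_code e).+1 w).2 e)].
pose D : set Om := \bigcup_m at_index (word_code e).+1 m.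
have mD : measurable (D : set (g_sigma_algebraType (join_events F all_G))).
  by apply: bigcupT_measurable => m; apply: (@up m); apply: measurable_at_index; exact: all_stage_measurable.
rewrite (_ : _ @^-1` _ = \bigcup_m E m `|` (~` D `&` [set w | B point])).
  apply: measurableU.
    by apply: bigcupT_measurable => m; apply: (@up m); exact: all_stage_measurable.
  apply: measurableI; first exact: measurableC.
  have [h|h] := pselect (B point).
    by rewrite (_ : [set _ | _] = setT)//; apply/seteqP; split.
  by rewrite (_ : [set _ | _] = set0)//; apply/seteqP; split.
apply/seteqP; split => w /=.
  case E1 : (stg (word_code e).+1 w).1 => [m|] Bw.
    by left; exists m => //; split => //=.
  right; split; first by move=> [m _]; rewrite /at_index /= E1.
  by move: Bw; rewrite /hyp stit_hyp_none.
move=> [[m _ [_ Bw]]|[nD Bw]]; first exact: Bw.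
rewrite /hyp stit_hyp_none//; case E1 : (stg (word_code e).+1 w).1 => [m|//].
by exfalso; apply: nD; exists m.
Qed.

Hypothesis Z_law : forall e, has_law (Z e) (exponential_prob (1 : R)).
Hypothesis G_law : forall n, has_law (G n.+1) (normalize (Lam_on Lam W)).
Hypothesis ZG_indep : mutually_independent P F.

Definition past m : set (word + nat) := [set i | if i is inr k then (k < m)%N else True].

Local Notation spast m := (g_sigma_algebraType (join_events F (past m))).
Local Notation law_W := (normalize (Lam_on Lam W)).

Let mhW : measurable (hits W) := measurable_hits (polytope_compact W_window.1).

Lemma sigma_past m (A : set Om) : measurable (A : set (sigma m)) -> measurable (A : set (spast m)).
Proof. by apply: (@gen_mono _ Om); apply: join_events_mono => -[]. Qed.

Lemma past_le m n (A : set Om) : (m <= n)%N -> measurable (A : set (spast m)) -> measurable (A : set (spast n)).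
Proof.
move=> mn; apply: (@gen_mono _ Om); apply: join_events_mono => -[//|k] /= h.
exact: leq_trans mn.
Qed.

Lemma past_sub m (A : set Om) : measurable (A : set (spast m)) -> measurable A.
Proof. by apply: gen_sub_measurable; apply: join_events_measurable; exact: ZG_events_measurable. Qed.

(** The past includes all the clocks, because later conditionings involve them. *)
Lemma freeze_G p (N : set (spast p)) (M : set (spast p * Hyp)) : measurable N -> measurable M ->
  (P (N `&` [set w | M (w, G p.+1 w)]) = \int[P]_(w in N) law_W [set h | M (w, h)])%E.
Proof.
move=> mN mM; pose S : set (spast p * Hyp) := (N `*` setT) `&` M.
have mS : measurable S by apply: measurableI => //; exact: measurableX.
have mNP : measurable (N : set Om) := past_sub mN.
have mE : measurable (N `&` [set w | M (w, G p.+1 w)] : set Om).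
  have mi := @measurable_id_gen _ Om _ (join_events_measurable (J := past p) ZG_events_measurable).
  have mp : measurable_fun setT (fun w : Om => ((w : spast p), G p.+1 w)).
    by apply: measurable_fun_pair => //; exact: measurable_funP.
  by apply: (@measurableI _ Om) => //; rewrite -[X in measurable X]setTI; exact: (mp measurableT _ mM).
pose g (q : spast p * Hyp) : \bar R := (\1_S q)%:E.
have mg : measurable_fun setT g by apply/measurable_EFinP; exact: measurable_indic.
have g0 q : (0 <= g q)%E by rewrite /g lee_fin indicE ler0n.
rewrite (measure_indic_integral P mE) (_ : (\int[P]_w _ = \int[P]_w g (w, G p.+1 w))%E); last first.
  apply: eq_integral => w _; rewrite /g !indicE; congr ((_%:R)%:E); congr nat_of_bool.
  by apply/idP/idP => /set_mem h; apply/mem_set; [case: h|case: h => -[]].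
rewrite (indep_rv_integral ZG_events_measurable ZG_eventsT ZG_eventsI ZG_indep (j := inr p) _ _ mg g0)//; last first.
  by rewrite /past /= ltnn.
rewrite [RHS]integral_mkcond; apply: eq_integral => w _; rewrite patchE.
case: ifPn => [/set_mem Nw|/negP nN]; last first.
  rewrite integral0_eq// => h _; rewrite /g indicE memNset// => -[[Nw _] _].
  by apply: nN; exact: mem_set.
have mMw : measurable [set h | M (w, h)] by exact: (@measurable_section2 _ _ (spast p) Hyp).
rewrite -[RHS](G_law p mMw) (measure_indic_integral (distribution P (G p.+1)) mMw).
apply: eq_integral => h _; rewrite /g !indicE; congr ((_%:R)%:E); congr nat_of_bool.
by apply/idP/idP => /set_mem hh; apply/mem_set; [case: hh|split].
Qed.

Let total : R := fine (Lam_on Lam W setT).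

Let total_gt0 : 0 < total.
Proof.
rewrite /total /Lam_on setTI; apply: fine_gt0.
rewrite (hits_ltoo Lam_fin (polytope_compact W_window.1)) andbT.
by apply: hits_gt0 => //; [exact: polytope_compact W_window.1|case: W_window].
Qed.

Lemma law_W_hits C (A : set Hyp) : C `<=` W ->
  law_W (A `&` hits C) = ((total^-1)%:E * Lam (A `&` hits C))%E.
Proof.
move=> CW; rewrite /normalize /Lam_on -/(Lam_on Lam W setT) -/total; congr (_ * Lam _)%E.
by apply/setIidl => h [_]; exact: sub_hits.
Qed.

Lemma law_W_ge0 A : (0 <= law_W A)%E.
Proof. by rewrite mule_ge0// lee_fin invr_ge0 ltW. Qed.

Lemma stage_cells_sub i m w : stage_cells i m w `<=` W.
Proof. exact: tree_cell_sub. Qed.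

Lemma stage_cells_compact i m w : compact (stage_cells i m w).
Proof. by apply: tree_cell_compact; exact: polytope_compact W_window.1. Qed.

Lemma measurable_stage_law i m (A : set Hyp) : measurable A ->
  measurable_fun setT ((fun w => law_W (A `&` hits (stage_cells i m w))) : sigma m -> \bar R).
Proof.
move=> mA; rewrite (_ : (fun w => _) = (fun w => (total^-1)%:E * Lam (A `&` hits (stage_cells i m w)))%E); last first.
  by apply/funext => w; apply: law_W_hits; exact: stage_cells_sub.
apply: measurable_funeM.
apply: (@measurable_Lam_hits _ _ _ Lam_fin _ W_window _ (sigma m)
  (fun w f => ((fun w => (stg i w).2 f) \_ (at_index i m)) w)) => // f.
by apply: measurable_stage_hyp; exact: all_stage_measurable.
Qed.

Lemma measurable_stage_hits i m p : (m <= p)%N ->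
  measurable ([set q | hits (stage_cells i m q.1) q.2] : set (spast p * Hyp)).
Proof.
move=> mp; apply: (@measurable_hits_cell _ _ _ (polytope_compact W_window.1) _ (spast p * Hyp)%type
  (fun q f => ((fun w => (stg i w).2 f) \_ (at_index i m)) q.1)); last exact: measurable_snd.
move=> f; apply: (measurableT_comp _ measurable_fst) => _ B mB; rewrite setTI.
apply: (past_le mp); apply: sigma_past.
by have := @measurable_stage_hyp i m f (@all_stage_measurable i) measurableT B mB; rewrite setTI.
Qed.

Lemma measurable_stage_cuts i m p : (m <= p)%N ->
  measurable ([set q | cuts (stage_cells i m q.1) q.2] : set (spast p * Hyp)).
Proof.
move=> mp; apply: (@measurable_cuts_cell _ _ _ (polytope_compact W_window.1) _ (spast p * Hyp)%type
  (fun q f => ((fun w => (stg i w).2 f) \_ (at_index i m)) q.1)); last exact: measurable_snd.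
move=> f; apply: (measurableT_comp _ measurable_fst) => _ B mB; rewrite setTI.
apply: (past_le mp); apply: sigma_past.
by have := @measurable_stage_hyp i m f (@all_stage_measurable i) measurableT B mB; rewrite setTI.
Qed.

Lemma waiting_hit_measure i m p (K : set (spast p)) A : (m <= p)%N -> measurable K -> measurable A ->
  (P (K `&` [set w | (A `&` hits (stage_cells i m w)) (G p.+1 w)]) =
   \int[P]_(w in K) law_W (A `&` hits (stage_cells i m w)))%E.
Proof.
move=> mp mK mA.
apply: (freeze_G mK (M := snd @^-1` A `&` [set q | hits (stage_cells i m q.1) q.2])).
apply: measurableI; last exact: measurable_stage_hits.
by rewrite -[X in measurable X]setTI; exact: (@measurable_snd _ _ (spast p) Hyp).
Qed.

Lemma waiting_hit_null i m p : (m <= p)%N ->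
  P.-negligible ([set w | hits (stage_cells i m w) (G p.+1 w)] `\`
                 [set w | cuts (stage_cells i m w) (G p.+1 w)]).
Proof.
move=> mp; pose M : set (spast p * Hyp) :=
  [set q | hits (stage_cells i m q.1) q.2] `\` [set q | cuts (stage_cells i m q.1) q.2].
have mM : measurable M by apply: measurableD; [exact: measurable_stage_hits|exact: measurable_stage_cuts].
have := freeze_G (@measurableT _ (spast p)) mM; rewrite setTI => h.
exists [set w | M (w, G p.+1 w)]; split => //.
  have mi := @measurable_id_gen _ Om _ (join_events_measurable (J := past p) ZG_events_measurable).
  have mpr : measurable_fun setT (fun w : Om => ((w : spast p), G p.+1 w)).
    by apply: measurable_fun_pair => //; exact: measurable_funP.
  by rewrite -[X in measurable X]setTI; exact: (mpr measurableT _ mM).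
rewrite h integral0_eq// => w _; rewrite /normalize /Lam_on.
rewrite (_ : [set h | M (w, h)] `&` hits W = hits (stage_cells i m w) `\` cuts (stage_cells i m w)); last first.
  apply/seteqP; split => h0 /=; first by move=> [].
  move=> [hh nc]; split; first by split.
  by apply: sub_hits hh; exact: stage_cells_sub.
rewrite touch_null ?mule0//.
exact: stage_cells_compact.
Qed.

(** While the cell has not been hit, each new hyperplane hits it with conditional probability [q].
    The integral of [q] over the event that it is never hit is thus a lower bound for the
    probability of a first hit at each index; these events are disjoint, so the integral is 0. But
    [q] is positive when the cell has interior. *)
Lemma never_hit_null i m :
  P.-negligible ((at_index i m `&` [set w | forall k, (m < k)%N -> ~ hit_at i m k w]) `&`
                 [set w | interior (stage_cells i m w) !=set0]).
Proof.
pose Fm := at_index i m `&` \bigcap_(k in [set k | (m < k)%N]) ~` hit_at i m k.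
pose q w := law_W (setT `&` hits (stage_cells i m w)).
have mw p : (m <= p)%N -> measurable (waiting_at i m p : set (sigma p)).
  by move=> mp; apply: measurable_waiting_at => //; exact: all_stage_measurable.
have mwP p : (m <= p)%N -> measurable (waiting_at i m p : set Om) by move=> mp; exact: (sigma_sub (mw p mp)).
have mhP k : (m < k)%N -> measurable (hit_at i m k : set Om).
  by move=> mk; apply: (@sigma_sub k); apply: measurable_hit_at => //; exact: all_stage_measurable.
have mF : measurable (Fm : set Om).
  apply: measurableI.
    by apply: (@sigma_sub m); apply: measurable_at_index; exact: all_stage_measurable.
  by apply: bigcap_measurableType => k mk; apply: measurableC; exact: mhP.
have mq : measurable_fun [set: Om] q.
  have := @measurable_stage_law i m setT measurableT.
  by apply: measurable_fun_gen; apply: join_events_measurable; exact: ZG_events_measurable.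
have q0 w : (0 <= q w)%E by exact: law_W_ge0.
have wS p : (m <= p)%N -> waiting_at i m p = waiting_at i m p.+1 `|` (waiting_at i m p `&` hit_at i m p.+1).
  move=> mp; apply/seteqP; split => w.
    move=> [aw nh]; have [hw|nhw] := pselect (hit_at i m p.+1 w); [right|left] => //.
    split => // k /andP[mk]; rewrite leq_eqVlt => /orP[/eqP -> //|kp].
    by apply: nh; rewrite /= mk -ltnS.
  move=> [[aw nh]|[]//]; split => // k /andP[mk kp]; apply: nh; rewrite /= mk /=; exact: ltnW.
pose a := (\int[P]_(w in Fm) q w)%E.
(* Each of the [K] first hits has probability at least [a], and they are disjoint from the event of
   still waiting. *)
have bound K : (P (waiting_at i m (m + K)) + K%:R%:E * a <= 1)%E.
  elim: K => [|K ih]; first by rewrite mul0e adde0 probability_le1//; apply: mwP; exact: leq_addr.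
  have mp : (m <= m + K)%N by exact: leq_addr.
  apply: le_trans ih; rewrite [in leRHS](wS _ mp) measureU//; last 3 first.
  - by apply: mwP; exact: leqW.
  - by apply: measurableI; [exact: mwP|apply: mhP; rewrite ltnS].
  - apply/seteqP; split => // w [[_ nh] [_ hw]]; have := nh (m + K).+1; apply => //=.
    by rewrite ltnS mp leqnn.
  rewrite addnS -[K.+1]addn1 natrD EFinD ge0_muleDl// mul1e -addeA; apply: leeD => //.
  rewrite addeC; apply: leeD => //.
  rewrite (_ : _ `&` _ = waiting_at i m (m + K) `&`
      [set w | (setT `&` hits (stage_cells i m w)) (G (m + K).+1 w)]); last first.
    by rewrite /hit_at; congr (_ `&` _); apply/seteqP; split => w /=; [move=> ?; split|move=> []].
  apply: (@le_trans _ _ (\int[P]_(w in waiting_at i m (m + K)) q w)%E); last first.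
    rewrite le_eqVlt; apply/orP; left; apply/eqP; apply/esym.
    exact: (waiting_hit_measure i mp (sigma_past (mw _ mp)) measurableT).
  apply: ge0_subset_integral => //; first exact: mwP.
    exact: measurable_funTS.
  move=> w [aw nh]; split => // k /andP[mk _]; exact: nh.
have a0 : a = 0%E.
  apply/eqP; rewrite eq_le integral_ge0// andbT leNgt; apply/negP => apos.
  have afin : a \is a fin_num.
    rewrite ge0_fin_numE ?integral_ge0//; apply: (@le_lt_trans _ _ 1%E); last exact: ltry.
    by apply: le_trans (bound 1%N); rewrite mul1e leeDr.
  have f0 : 0 < fine a by apply: fine_gt0; rewrite apos -ge0_fin_numE// ltW.
  pose K := (Num.truncn (fine a)^-1).+1.
  have := bound K; apply/negP; rewrite -ltNge.
  apply: (@lt_le_trans _ _ (K%:R%:E * a)%E); last by rewrite leeDr.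
  rewrite -(fineK afin) -EFinM lte_fin -ltr_pdivrMr// mul1r; exact: truncnS_gt.
have : ae_eq P Fm q (cst 0%E).
  apply/(ae_eq_integral_abs P mF); first exact: measurable_funTS.
  by rewrite -[RHS]a0 /a; apply: eq_integral => w _; rewrite gee0_abs.
move=> [N [mN N0 sub]]; exists N; split => // w [[aw nh] int]; apply: sub => /= h.
have Fw : Fm w by split.
have := h Fw; rewrite /q law_W_hits; last exact: stage_cells_sub.
rewrite setTI => /eqP; rewrite mule_eq0 => /orP[/eqP[]/eqP|].
  by rewrite invr_eq0 gt_eqF.
apply/negP; rewrite gt_eqF//; apply: hits_gt0 => //.
exact: stage_cells_compact.
Qed.

(** * Almost surely every cell is hit, and cut *)

Definition cellw e w : set Vec := tree_cell W (hyp ^~ w) e.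

(** The existence of a last index says that each cell of smaller rank has been hit at some time. *)
Definition proper_until i w := (exists m, at_index i m w) /\
  forall e, (word_code e < i)%N -> cuts (cellw e w) (hyp e w).

Lemma proper_window i w e : proper_until i w -> (word_code e <= i)%N -> window (cellw e w).
Proof.
move=> [_ cw] ei; apply: tree_cell_window => // f /ancestor_word_code fe.
by apply: cw; exact: leq_trans ei.
Qed.

(** The cell of the next word is a window because its ancestors are cut; it is hit almost surely by
    [never_hit_null], and the hyperplane that hits it first cuts it almost surely by
    [waiting_hit_null]. *)
Lemma proper_until_ae i : {ae P, forall w, proper_until i w}.
Proof.
elim: i => [|i ih].
  by apply: aeW => w; split => //; exists 0%N.
have n1 : {ae P, forall w, forall m, ~ ((at_index i m `&` [set w | forall k, (m < k)%N -> ~ hit_at i m k w]) `&`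
                 [set w | interior (stage_cells i m w) !=set0]) w}.
  apply: ae_foralln => m; have [N [mN N0 sub]] := @never_hit_null i m.
  by exists N; split => // w /= h; apply: sub; apply: contrapT.
have n2 : {ae P, forall w, forall m p, (m <= p)%N -> hits (stage_cells i m w) (G p.+1 w) ->
     cuts (stage_cells i m w) (G p.+1 w)}.
  apply: ae_foralln => m; apply: ae_foralln => p.
  have [mp|mp] := boolP (m <= p)%N; last by apply: aeW => w.
  have [N [mN N0 sub]] := waiting_hit_null i mp.
  exists N; split => // w /= h; apply: sub; apply: contrapT => nh; apply: h => _ hw.
  by apply: contrapT => nc; apply: nh.
apply: filterS3 ih n1 n2 => w pw h1 h2; have [[m aw] cw] := pw.
have sE := stage_cellsE aw; rewrite -/(cellw _ w) in sE.
have winC : window (cellw (nth_word i) w) by apply: (proper_window pw); rewrite nth_wordK.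
have [k [mk hk]] : exists k, (m < k)%N /\ hit_at i m k w.
  apply: contrapT => nk; apply: (h1 m); split; last by rewrite /= sE; case: winC.
  by split => // k mk hk; apply: nk; exists k.
pose hit n := (m < n)%N && `[< hit_at i m n w >].
have [n /andP[mn /asboolP hn] nmin] := ex_minnP (ex_intro hit k (introT andP (conj mk (asboolT hk)))).
have an : at_index i.+1 n w.
  rewrite at_indexS; exists m => //; split => //; split => // j /= /andP[mj jn] hj.
  have : hit j by rewrite /hit mj; apply/asboolP.
  have n0 : (0 < n)%N := leq_ltn_trans (leq0n m) mn.
  by move=> /nmin nj; have := leq_trans nj jn; rewrite -ltnS prednK// ltnn.
split; first by exists n.
move=> e; rewrite ltnS leq_eqVlt => /orP[/eqP ei|]; last exact: cw.
have eE : e = nth_word i by rewrite -ei word_codeK.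
have hE : hyp e w = G n w.
  by apply: stit_hyp_some; rewrite ei.
rewrite eE in hE *; rewrite hE -sE; case: n mn hn {nmin an hE} => // n mn hn.
by apply: h2.
Qed.

Definition proper w := forall i, proper_until i w.

Lemma proper_ae : {ae P, forall w, proper w}.
Proof. by apply: ae_foralln => i; exact: proper_until_ae. Qed.

(** * Conditional laws of the splitting hyperplanes *)

Let measurable_hyp_rv e : measurable_fun [set: Om] (hyp e).
Proof.
apply: (measurable_fun_gen _ (measurable_hyp e)).
by apply: join_events_measurable; exact: ZG_events_measurable.
Qed.

Definition hyp_rv e : {RV P >-> Hyp} :=
  HB.pack (hyp e) (isMeasurableFun.Build _ _ _ _ _ (measurable_hyp_rv e)).

(** From here on, histories are generated by the clocks and by the hyperplanes of words, in place of
    the sequence G. *)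
Definition ZH_events (i : word + word) : set (set Om) :=
  match i with inl e => events_of (Z e) | inr e => events_of (hyp_rv e) end.

Local Notation hist J := (g_sigma_algebraType (join_events ZH_events J)).

Lemma ZH_events_measurable (i : word + word) : ZH_events i `<=` measurable.
Proof. by case: i => n; exact: events_of_measurable. Qed.

Lemma hist_sub J (A : set Om) : measurable (A : set (hist J)) -> measurable A.
Proof. by apply: gen_sub_measurable; apply: join_events_measurable; exact: ZH_events_measurable. Qed.

Lemma hist_le J J' (A : set Om) : J `<=` J' -> measurable (A : set (hist J)) -> measurable (A : set (hist J')).
Proof. by move=> JJ; apply: (@gen_mono _ Om); exact: join_events_mono. Qed.

Lemma measurable_hist_hyp J e : J (inr e) -> measurable_fun setT (hyp e : hist J -> Hyp).
Proof.
by move=> Je; apply: (@measurable_rv_join _ Om _ P _ Hyp _ ZH_events _ (inr e) (hyp_rv e)).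
Qed.

Lemma measurable_hist_Z J e : J (inl e) -> measurable_fun setT (Z e : hist J -> R).
Proof.
by move=> Je; apply: (@measurable_rv_join _ Om _ P _ R _ ZH_events _ (inl e) (Z e)).
Qed.

Lemma measurable_cellw_Lam J e (A : set Hyp) : measurable A ->
  (forall f, f \in ancestors e -> J (inr f)) ->
  measurable_fun setT ((fun w => Lam (A `&` hits (cellw e w))) : hist J -> \bar R).
Proof.
move=> mA Je; pose H w f := if f \in ancestors e then hyp f w else point.
rewrite (_ : (fun w => _) = (fun w => Lam (A `&` hits (tree_cell W (H w) e)))); last first.
  by apply/funext => w; rewrite /cellw (@eq_tree_cell _ _ _ _ (H w))// => f fe; rewrite /H fe.
apply: (@measurable_Lam_hits _ _ _ Lam_fin _ W_window _ (hist J)) => // f; rewrite /H.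
have [fe|fe] := boolP (f \in ancestors e); last exact: measurable_cst.
exact: (@measurable_hist_hyp J f (Je f fe)).
Qed.

Lemma cellw_compact e w : compact (cellw e w).
Proof. by apply: tree_cell_compact; exact: polytope_compact W_window.1. Qed.

Definition intensity e w : R := fine (Lam (hits (cellw e w))).

Lemma intensity_ge0 e w : 0 <= intensity e w.
Proof. by apply: fine_ge0; exact: measure_ge0. Qed.

Lemma intensityE e w : (intensity e w)%:E = Lam (hits (cellw e w)).
Proof.
rewrite fineK//; have := @Lam_hits_fin R l Lam Lam_fin (cellw e w) setT (@cellw_compact e w) measurableT.
by rewrite setTI.
Qed.

Lemma measurable_intensity J e : (forall f, f \in ancestors e -> J (inr f)) ->
  measurable_fun setT (intensity e : hist J -> R).
Proof.
move=> Je; apply: measurableT_comp => //.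
by have := measurable_cellw_Lam measurableT Je; under eq_fun do rewrite setTI.
Qed.

Definition split_density e (A : set Hyp) w : \bar R :=
  (((intensity e w)^-1)%:E * Lam (A `&` hits (cellw e w)))%E.

Lemma split_density_ge0 e A w : (0 <= split_density e A w)%E.
Proof. by rewrite mule_ge0// lee_fin invr_ge0 intensity_ge0. Qed.

Lemma split_density_fin e A w : measurable A -> split_density e A w \is a fin_num.
Proof. by move=> mA; rewrite fin_numM//; apply: Lam_hits_fin => //; exact: cellw_compact. Qed.

Lemma measurable_split_density J e A : measurable A -> (forall f, f \in ancestors e -> J (inr f)) ->
  measurable_fun setT (split_density e A : hist J -> \bar R).
Proof.
move=> mA Je; apply: emeasurable_funM; last exact: measurable_cellw_Lam.
apply/measurable_EFinP; apply: measurable_inv_ge0; last by move=> w; exact: intensity_ge0.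
exact: measurable_intensity.
Qed.

Definition before_word e : set (word + word) :=
  [set i | if i is inr f then (word_code f < word_code e)%N else True].

(** Once the last index used before [e] is fixed to [m], the hyperplanes of earlier words are
    determined by G(1), ..., G(m). *)
Lemma before_word_at e m (K : set (hist (before_word e))) : measurable K ->
  measurable (K `&` at_index (word_code e) m : set (spast m)).
Proof.
have mT : measurable (at_index (word_code e) m : set (spast m)).
  by apply: sigma_past; apply: measurable_at_index; exact: all_stage_measurable.
pose C : set (set Om) := [set K | measurable (K `&` at_index (word_code e) m : set (spast m))].
suff : <<s join_events ZH_events (before_word e) >> `<=` C by apply.
apply: smallest_sub.
  split.
  - by rewrite /C /= set0I; exact: measurable0.
  - move=> A CA; rewrite /C /= setTD (_ : _ `&` _ = at_index (word_code e) m `\` (A `&` at_index (word_code e) m)).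
      exact: measurableD.
    by apply/seteqP; split => w; [move=> [nA aw]; split => // -[]|move=> [aw nA]; split => // Aw; apply: nA].
  - by move=> A CA; rewrite /C /= setI_bigcupl; apply: bigcupT_measurable => n; exact: CA.
move=> B [[f _|f /= fe]] [B0 mB0 <-]; rewrite setTI /C /=.
  apply: measurableI => //; rewrite -[X in measurable X]setTI.
  by apply: (@measurable_rv_join _ Om _ P _ R _ F _ (inl f) (Z f)).
rewrite (_ : _ `&` _ = at_index (word_code e) m `&` [set w | B0 ((stg (word_code e) w).2 f)]).
  by apply: sigma_past; exact: all_stage_measurable.
by apply/seteqP; split => w [/= h1 h2]; split => //=; move: h1 h2; rewrite /stg stage_hyp.
Qed.

(** Outcomes are sorted by the last index m used before [e] and by the index p + 1 of the first
    later hyperplane that hits the cell. On such a piece G(p+1) is independent of the past, and its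
    law given that it hits the cell is the normalization of Lam on the hyperplanes hitting the
    cell. *)
Lemma split_law e (K : set (hist (before_word e))) A : measurable K -> measurable A ->
  (P (K `&` [set w | A (hyp e w)]) = \int[P]_(w in K) split_density e A w)%E.
Proof.
move=> mK mA; set i := word_code e.
have iE : nth_word i = e by exact: word_codeK.
have mKP : measurable (K : set Om) := hist_sub mK.
have mhe : measurable ([set w | A (hyp e w)] : set Om).
  by rewrite -[X in measurable X]setTI; exact: measurable_hyp_rv.
have mden : measurable_fun [set: Om] (split_density e A).
  apply: (measurable_fun_gen _ (@measurable_split_density (before_word e) e A mA _)).
    by apply: join_events_measurable; exact: ZH_events_measurable.
  by move=> f /ancestor_word_code.
pose S m p : set Om := waiting_at i m p `&` hit_at i m p.+1.
have mS m p : (m <= p)%N -> measurable (S m p).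
  move=> mp; apply: measurableI.
    by apply: (@sigma_sub p); apply: measurable_waiting_at => //; exact: all_stage_measurable.
  by apply: (@sigma_sub p.+1); apply: measurable_hit_at; [exact: all_stage_measurable|].
have Sat m p w : (m <= p)%N -> S m p w -> at_index i m w /\ at_index i.+1 p.+1 w.
  by move=> mp [ww hw]; split; [case: ww|rewrite at_indexS; exists m => //=].
have step m p : (m <= p)%N ->
    (P ((K `&` S m p) `&` [set w | A (hyp e w)]) = \int[P]_(w in K `&` S m p) split_density e A w)%E.
  move=> mp.
  have mN : measurable (K `&` waiting_at i m p : set (spast p)).
    rewrite (_ : _ `&` _ = (K `&` at_index i m) `&` waiting_at i m p).
      apply: measurableI; first by apply: (past_le mp); exact: before_word_at.
      by apply: sigma_past; apply: measurable_waiting_at => //; exact: all_stage_measurable.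
    by rewrite -setIA; congr (_ `&` _); apply/esym/setIidr => w [].
  (* [q] is the probability that G(p+1) hits the cell and [rho] the conditional probability of [A]
     given a hit; their product is the probability of a hit by a hyperplane of [A]. *)
  pose rho w := (((fine (Lam (hits (stage_cells i m w))))^-1)%:E * Lam (A `&` hits (stage_cells i m w)))%E.
  pose q w := law_W (setT `&` hits (stage_cells i m w)).
  have up (f : Om -> \bar R) : measurable_fun setT (f : sigma m -> \bar R) -> measurable_fun setT (f : spast p -> \bar R).
    by move=> mf _ B mB; have := mf measurableT _ mB; rewrite !setTI => /sigma_past; exact: past_le.
  have mq : measurable_fun setT (q : spast p -> \bar R) by apply: up; exact: measurable_stage_law.
  have mstage B : measurable B -> measurable_fun setT ((fun w => Lam (B `&` hits (stage_cells i m w))) : sigma m -> \bar R).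
    move=> mB; apply: (@measurable_Lam_hits _ _ _ Lam_fin _ W_window _ (sigma m)
      (fun w f => ((fun w => (stg i w).2 f) \_ (at_index i m)) w)) => // f.
    by apply: measurable_stage_hyp; exact: all_stage_measurable.
  have finS B w : measurable B -> Lam (B `&` hits (stage_cells i m w)) \is a fin_num.
    by move=> mB; apply: Lam_hits_fin => //; exact: stage_cells_compact.
  have mrho : measurable_fun setT (rho : spast p -> \bar R).
    apply: up; apply: emeasurable_funM; last exact: mstage.
    apply/measurable_EFinP; apply: measurable_inv_ge0; last by move=> w; rewrite fine_ge0.
    apply: measurableT_comp => //.
    by have := mstage _ measurableT; under eq_fun do rewrite setTI.
  have rho0 w : (0 <= rho w)%E by rewrite mule_ge0// lee_fin invr_ge0 fine_ge0.
  have rhoq w : (rho w * q w = law_W (A `&` hits (stage_cells i m w)))%E.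
    rewrite /rho /q !law_W_hits ?setTI; [|exact: stage_cells_sub|exact: stage_cells_sub].
    have f1 := finS A w mA; have := finS setT w measurableT; rewrite setTI => f2.
    have [z0|nz] := eqVneq (fine (Lam (hits (stage_cells i m w)))) 0.
      have L0 : Lam (hits (stage_cells i m w)) = 0%E by rewrite -(fineK f2) z0.
      have A0 : Lam (A `&` hits (stage_cells i m w)) = 0%E.
        apply/eqP; rewrite eq_le measure_ge0 andbT -L0; apply: measure_mono => //.
          apply: measurableI => //; apply: measurable_hits; exact: stage_cells_compact.
        by apply: measurable_hits; exact: stage_cells_compact.
      by rewrite L0 A0 !mule0.
    rewrite -(fineK f1) -(fineK f2) -!EFinM; congr (_%:E); field; rewrite nz andbT.
    exact: lt0r_neq0 total_gt0.
  have qfin w : q w \is a fin_num.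
    by rewrite /q law_W_hits; [rewrite fin_numM//; exact: finS|exact: stage_cells_sub].
  have mhit : measurable ([set w | hits (stage_cells i m w) (G p.+1 w)] : set Om).
    by apply: (@sigma_sub p.+1); apply: measurable_hit_at; [exact: all_stage_measurable|].
  have hK K' : <<s join_events F (past p) >> K' ->
      (P (K' `&` [set w | hits (stage_cells i m w) (G p.+1 w)]) = \int[P]_(w in K') q w)%E.
    move=> mK'; have := freeze_G mK' (M := [set q | (setT `&` hits (stage_cells i m q.1)) q.2]).
    move=> <-; first by congr (P (_ `&` _)); apply/seteqP; split => w /=; [|case].
    by have := @measurable_stage_hits i m p mp; congr measurable; apply/seteqP; split => z /=; [|case].
  have := @conditional_integral _ Om R P _ (join_events_measurable (J := past p) ZG_events_measurable)
    _ q _ rho mhit mq (fun w => law_W_ge0 _) qfin hK mrho rho0 mN.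
  under [in X in _ = X -> _]eq_integral do rewrite rhoq.
  rewrite -(waiting_hit_measure i mp mN mA) => hE.
  transitivity (P ((K `&` waiting_at i m p) `&` [set w | (A `&` hits (stage_cells i m w)) (G p.+1 w)])).
    congr (P _); apply/seteqP; split => w.
      move=> [[Kw Sw]] /= Aw; have [_ a1] := Sat _ _ _ mp Sw; case: Sw => ww hw.
      by split => //; split => //; move: Aw; rewrite /= /hyp (stit_hyp_some a1).
    move=> [[Kw ww] [Aw hw]]; have Sw : S m p w by split.
    split; first by split.
    by have [_ a1] := Sat _ _ _ mp Sw; rewrite /= /hyp (stit_hyp_some a1).
  rewrite -hE -setIA -[waiting_at i m p `&` _]/(S m p).
  apply: eq_integral => w /set_mem[Kw Sw]; have [a0 _] := Sat _ _ _ mp Sw.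
  by rewrite /rho /split_density /intensity (stage_cellsE a0) iE.
(* The pieces, numbered by a code of the pair (m, p). *)
pose T k : set Om := if @choice.pickle_inv (nat * nat)%type k is Some mp then (if (mp.1 <= mp.2)%N then S mp.1 mp.2 else set0) else set0.
have mT k : measurable (T k).
  by rewrite /T; case: (choice.pickle_inv _) => // -[m p]; case: ifP => // mp; exact: mS.
have tT : trivIset setT T.
  move=> k k' _ _ [w []]; rewrite /T.
  have := @choice.pickle_invK (nat * nat)%type k; have := @choice.pickle_invK (nat * nat)%type k'.
  case: (choice.pickle_inv _) => // -[m' p'] /= k'E; case: (choice.pickle_inv _) => // -[m p] /= kE.
  case: ifP => // mp Sw; case: ifP => // mp' Sw'.
  have [a1 b1] := Sat _ _ _ mp Sw; have [a2 b2] := Sat _ _ _ mp' Sw'.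
  rewrite -kE -k'E; congr (choice.pickle (_, _)); first by apply: Some_inj; rewrite -a1 -a2.
  by apply: succn_inj; apply: Some_inj; rewrite -b1 -b2.
have PT : P (\bigcup_k T k) = 1%E.
  have mU : measurable (\bigcup_k T k) by exact: bigcupT_measurable.
  have [N [mN N0 sub]] := proper_until_ae i.+1.
  have h0 : P (~` \bigcup_k T k) = 0%E.
    apply: measure_negligible; first exact: measurableC.
    exists N; split => // w nT; apply: sub => /= -[[n]]; rewrite at_indexS => -[m /= mn Sw] _.
    have mp : (m <= n.-1)%N by rewrite -ltnS prednK// (leq_ltn_trans _ mn).
    apply: nT; exists (choice.pickle (m, n.-1)) => //.
    by rewrite /T choice.pickleK_inv /= mp /S prednK// (leq_ltn_trans _ mn).
  by rewrite -[X in P X]setCK probability_setC ?h0 ?sube0//; exact: measurableC.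
have stepT k : (P ((K `&` T k) `&` [set w | A (hyp e w)]) = \int[P]_(w in K `&` T k) split_density e A w)%E.
  rewrite /T; case: (choice.pickle_inv _) => [[m p]|] /=; last by rewrite setI0 set0I measure0 integral_set0.
  by case: ifP => mp; [exact: step|rewrite setI0 set0I measure0 integral_set0].
have mU : measurable (\bigcup_k T k) by exact: bigcupT_measurable.
have -> : P (K `&` [set w | A (hyp e w)]) = P ((K `&` [set w | A (hyp e w)]) `&` \bigcup_k T k).
  by apply/esym; apply: measure_setI_full => //; exact: measurableI.
rewrite (integral_setI_full mU PT)//; last 2 first.
- exact: measurable_funTS.
- by move=> w _; exact: split_density_ge0.
rewrite !setI_bigcupr ge0_integral_bigcup//; last 4 first.
- by move=> k; exact: measurableI.
- exact: measurable_funTS.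
- by move=> w _; exact: split_density_ge0.
- by apply: trivIset_setIl.
rewrite measure_bigcupT; last 2 first.
- by move=> k; apply: measurableI => //; exact: measurableI.
- by apply: trivIset_setIl.
by apply: eq_eseriesr => k _; rewrite setIAC; exact: stepT.
Qed.

(** The word [e] and its descendants are left out, as the cells of the latter are shaped by the
    hyperplane of [e]. Other words may come after [e] in the order; the bound on ranks serves as the
    induction parameter. *)
Definition aside e N : set (word + word) :=
  [set i | if i is inr f then (word_code f <= N)%N && (e \notin f :: ancestors f) else True].

Lemma ancestors_trans e f g : g \in f :: ancestors f -> f \in e :: ancestors e -> g \in e :: ancestors e.
Proof.
move=> gf; elim: e => [|b e ih]; first by rewrite !inE => /eqP fE; move: gf; rewrite fE inE.
rewrite [ancestors _]/= !inE => /orP[/eqP fE|/orP[/eqP fE|fe]].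
- by move: gf; rewrite fE inE.
- by move: gf; rewrite fE inE => ->; rewrite orbT.
- have : g \in e :: ancestors e by apply: ih; rewrite inE fe orbT.
  by rewrite inE => ->; rewrite orbT.
Qed.

Lemma notin_ancestors e f : f \in ancestors e -> e \notin f :: ancestors f.
Proof.
move=> fe; apply/negP; rewrite inE => /orP[/eqP ef|/ancestor_word_code].
  by have := ancestor_word_code fe; rewrite ef ltnn.
by move=> /(ltn_trans (ancestor_word_code fe)); rewrite ltnn.
Qed.

(* Induction on [N]: the conditional law of [hyp f], where [f] is the word of *)
(* code [N.+1], is expressed by hyperplanes of [aside e N], so that [hyp e]   *)
(* and [hyp f] can be exchanged.                                              *)
Lemma split_law_aside e N (K : set (hist (aside e N))) A : measurable K -> measurable A ->
  (P (K `&` [set w | A (hyp e w)]) = \int[P]_(w in K) split_density e A w)%E.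
Proof.
move=> mK mA; elim: N K mK => [|N ih] K mK.
  apply: split_law => //; apply: (hist_le _ mK) => -[//|f] /=.
  rewrite leqn0 inE negb_or => /andP[/eqP f0 /andP[ef _]]; rewrite f0 lt0n.
  by apply: contra_neq ef => e0; apply: word_code_inj; rewrite e0.
have [eN|Ne] := leqP (word_code e) N.+1.
  have [eN1|eN1] := eqVneq (word_code e) N.+1.
    apply: split_law => //; apply: (hist_le _ mK) => -[//|f] /=.
    rewrite eN1 inE negb_or ltn_neqAle => /andP[-> /andP[ef _]]; rewrite andbT.
    by apply: contra_neq ef => fN; apply: word_code_inj; rewrite eN1.
  have {eN eN1} eN : (word_code e <= N)%N by rewrite -ltnS ltn_neqAle eN1.
  set f := nth_word N.+1; have fN : word_code f = N.+1 by exact: nth_wordK.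
  (* If [f] is [e] or a descendant of it, raising the bound to its rank adds nothing to the
     history. *)
  have [ef|ef] := boolP (e \in f :: ancestors f).
    apply: ih; apply: (hist_le _ mK) => -[//|g] /=; rewrite leq_eqVlt => /andP[/orP[/eqP gN|gN] eg].
      by move: eg; rewrite (_ : g = f) ?ef//; apply: word_code_inj; rewrite gN.
    by rewrite -ltnS gN.
  have anc_e J : aside e N `<=` J -> forall g, g \in ancestors e -> J (inr g).
    move=> sJ g ge; apply: sJ => /=; rewrite notin_ancestors// andbT.
    exact: leq_trans (ltnW (ancestor_word_code ge)) eN.
  have anc_f g : g \in ancestors f -> aside e N (inr g).
    move=> gf /=; have := ancestor_word_code gf; rewrite fN ltnS => ->/=.
    apply: contra ef => eg; apply: ancestors_trans eg _; by rewrite inE gf orbT.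
  have mhyp g B : measurable B -> measurable ([set w | B (hyp g w)] : set Om).
    by move=> mB; rewrite -[X in measurable X]setTI; exact: measurable_hyp_rv.
  have JM J : join_events ZH_events J `<=` measurable.
    by apply: join_events_measurable; exact: ZH_events_measurable.
  have sub_f : aside e N `<=` before_word f.
    by move=> [//|g] /= /andP[gN _]; rewrite fN ltnS.
  pose Q : set (set Om) := [set K | exists K0 B, [/\ measurable (K0 : set (hist (aside e N))),
    measurable B & K = K0 `&` [set w | B (hyp f w)]]].
  have QE K' : Q K' -> (P (K' `&` [set w | A (hyp e w)]) = \int[P]_(w in K') split_density e A w)%E.
    move=> [K0 [B [mK0 mB ->]]]; rewrite setIAC.
    have mf0 : forall w, (0 <= split_density f B w)%E by move=> w; exact: split_density_ge0.
    have me0 : forall w, (0 <= split_density e A w)%E by move=> w; exact: split_density_ge0.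
    rewrite split_law//; last first.
      apply: measurableI; first exact: (hist_le sub_f mK0).
      have he : before_word f (inr e) by rewrite /= fN ltnS.
      by rewrite -[X in measurable X]setTI; exact: (measurable_hist_hyp he).
    rewrite (@conditional_integral _ Om R P _ (JM (aside e N)) _ (split_density e A) _ (split_density f B)) //; last 4 first.
    - exact: mhyp.
    - by apply: measurable_split_density => //; exact: anc_e.
    - by move=> w; exact: split_density_fin.
    - exact: measurable_split_density.
    have -> : (\int[P]_(w in K0 `&` [set w | B (hyp f w)]) split_density e A w =
        \int[P]_(w in K0) (split_density e A w * split_density f B w))%E.
      apply: (@conditional_integral _ Om R P _ (JM (before_word f)) _ (split_density f B) _ (split_density e A)) => //.
      - exact: mhyp.
      - by apply: measurable_split_density => // g /anc_f; exact: sub_f.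
      - by move=> w; exact: split_density_fin.
      - by move=> K1 mK1; exact: split_law.
      - by apply: measurable_split_density => //; exact: anc_e.
      - exact: (hist_le sub_f mK0).
    by apply: eq_integral => w _; rewrite muleC.
  apply: (@conditional_pi_lambda _ Om R P Q) => //.
  - by move=> _ [K0 [B [mK0 mB ->]]]; apply: measurableI; [exact: (hist_sub mK0)|exact: mhyp].
  - move=> _ _ [K1 [B1 [mK1 mB1 ->]]] [K2 [B2 [mK2 mB2 ->]]]; exists (K1 `&` K2), (B1 `&` B2).
    split; [exact: measurableI|exact: measurableI|].
    by rewrite setIACA.
  - by exists setT, setT; split => //; rewrite setTI.
  - exact: mhyp.
  - apply: (measurable_fun_gen (JM (aside e N))).
    by apply: measurable_split_density => //; exact: anc_e.
  - by move=> w; exact: split_density_ge0.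
  apply: (@gen_le_gen _ Om _ _ _ K mK) => B [[g _|g /= /andP[gN eg]]] HB; apply: sub_sigma_algebra.
  - exists B, setT; split => //; last by rewrite setIT.
    by apply: sub_sigma_algebra; exists (inl g).
  - move: gN; rewrite leq_eqVlt => /orP[/eqP gN|gN].
      have gf : g = f by apply: word_code_inj; rewrite gN.
      case: HB => B0 mB0 <-; exists setT, B0; split => //.
      by rewrite gf.
    exists B, setT; split => //; last by rewrite setIT.
    by apply: sub_sigma_algebra; exists (inr g) => //=; rewrite -ltnS gN.
apply: split_law => //; apply: (hist_le _ mK) => -[//|f] /= /andP[fN _].
exact: leq_ltn_trans Ne.
Qed.

(** * Integrating out the clocks *)

Section exponential_clocks.
Variables (J : set (word + nat)) (e : word).
Hypothesis Je : ~ J (inl e).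
Local Notation sigmaJ := (g_sigma_algebraType (join_events F J)).

Lemma sigmaJ_sub (A : set Om) : measurable (A : set sigmaJ) -> measurable A.
Proof. by apply: gen_sub_measurable; apply: join_events_measurable; exact: ZG_events_measurable. Qed.

Lemma measurable_clock_event (a : sigmaJ -> R) : measurable_fun setT a ->
  measurable ([set w | a w < Z e w] : set Om).
Proof.
move=> ma; have maP : measurable_fun [set: Om] a.
  by apply: (measurable_fun_gen _ ma); apply: join_events_measurable; exact: ZG_events_measurable.
have -> : [set w | a w < Z e w] = (fun w => Z e w - a w) @^-1` [set v | 0 < v].
  by apply/seteqP; split => w /=; rewrite subr_gt0.
rewrite -[X in measurable X]setTI; apply: measurable_funB => //.
by rewrite (_ : [set v | _] = `]0, +oo[%classic)//; apply/seteqP; split => v /=; rewrite in_itv/= andbT.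
Qed.

Lemma freeze_clock (K : set sigmaJ) (f : sigmaJ -> \bar R) (a b : sigmaJ -> R) :
  measurable K -> measurable_fun setT f -> (forall w, 0 <= f w)%E ->
  measurable_fun setT a -> (forall w, 0 <= a w) -> measurable_fun setT b -> (forall w, 0 <= b w) ->
  (\int[P]_(w in K `&` [set w | (a w < Z e w)%R]) (f w * (expR (- b w * Z e w))%:E) =
   \int[P]_(w in K) (f w * (expR (- (1 + b w) * a w) / (1 + b w))%:E))%E.
Proof.
move=> mK mf f0 ma a0 mb b0.
have mKP : measurable (K : set Om) := sigmaJ_sub mK.
have mE : measurable (K `&` [set w | a w < Z e w] : set Om).
  by apply: (@measurableI _ Om) => //; exact: measurable_clock_event.
have mlt : measurable_fun setT (fun q : sigmaJ * R => ((a q.1 < q.2)%R%:R : R)).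
  rewrite (_ : (fun q => _) = (fun q : sigmaJ * R => \1_([set q | a q.1 < q.2]) q)).
    apply: measurable_indic.
    have -> : [set q : sigmaJ * R | a q.1 < q.2] = (fun q => q.2 - a q.1) @^-1` [set v | 0 < v].
      by apply/seteqP; split => q /=; rewrite subr_gt0.
    have mdiff : measurable_fun setT (fun q : sigmaJ * R => q.2 - a q.1).
      by apply: measurable_funB; [exact: measurable_snd|exact: (measurableT_comp ma measurable_fst)].
    rewrite -[X in measurable X]setTI; apply: mdiff => //.
    by rewrite (_ : [set v | _] = `]0, +oo[%classic)//; apply/seteqP; split => v /=; rewrite in_itv/= andbT.
  by apply/funext => q; rewrite indicE mem_setE.
pose h (q : sigmaJ * R) : R := (a q.1 < q.2)%R%:R * expR (- b q.1 * q.2).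
have mh : measurable_fun setT h.
  apply: measurable_funM => //; apply: measurableT_comp => //; apply: measurable_funM.
    by apply: measurable_funN; exact: (measurableT_comp mb measurable_fst).
  exact: measurable_snd.
pose g (q : sigmaJ * R) : \bar R := ((\1_K q.1)%:E * f q.1 * (h q)%:E)%E.
have mg : measurable_fun setT g.
  apply: emeasurable_funM; last exact/measurable_EFinP.
  apply: emeasurable_funM; last exact: (measurableT_comp mf measurable_fst).
  by apply/measurable_EFinP; apply: (measurableT_comp _ measurable_fst); exact: measurable_indic.
have g0 q : (0 <= g q)%E.
  by rewrite mule_ge0 ?mule_ge0// lee_fin mulr_ge0// expR_ge0.
rewrite -[LHS]integral_indicM// (_ : (\int[P]_w _ = \int[P]_w g (w, Z e w))%E); last first.
  apply: eq_integral => w _; rewrite /g /h /= !indicE in_setI.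
  have -> : (w \in [set w | a w < Z e w]) = (a w < Z e w) by apply/idP/idP => [/set_mem|/mem_set].
  have [Kw|nK] := boolP (w \in K); last by rewrite !mul0e.
  by have [aZ|aZ] := boolP (a w < Z e w); rewrite ?mul1e ?mul1r ?mul0r ?mul0e ?mule0.
rewrite (indep_rv_integral ZG_events_measurable ZG_eventsT ZG_eventsI ZG_indep (j := inl e) Je _ mg g0)//.
rewrite -[RHS]integral_indicM//; apply: eq_integral => w _; rewrite /g /= muleA.
rewrite ge0_integralZl//; last 3 first.
- by apply/measurable_EFinP; exact: (measurableT_comp mh (pair1_measurable _)).
- by move=> v _; rewrite lee_fin mulr_ge0// expR_ge0.
- by rewrite mule_ge0.
by congr (_ * _)%E; exact: (exponential_tail_integral (Z_law e) (a0 w) (b0 w)).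
Qed.

End exponential_clocks.

(** Independent unit exponential clocks exceed levels fixed by the other variables with probability
    exp of minus the sum of the levels. In the induction the first clock is regarded as known while
    the remaining ones are integrated. *)
Lemma freeze_clocks (E : seq word) (J : set (word + nat))
    (K : set (g_sigma_algebraType (join_events F J)))
    (f : g_sigma_algebraType (join_events F J) -> \bar R)
    (a : word -> g_sigma_algebraType (join_events F J) -> R) :
  uniq E -> (forall e, e \in E -> ~ J (inl e)) ->
  measurable K -> measurable_fun setT f -> (forall w, 0 <= f w)%E ->
  (forall e, measurable_fun setT (a e)) -> (forall e w, 0 <= a e w) ->
  (\int[P]_(w in K `&` [set w | forall e, e \in E -> (a e w < Z e w)%R]) f w =
   \int[P]_(w in K) (f w * (expR (- \sum_(e <- E) a e w))%:E))%E.
Proof.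
elim: E J K f a => [|e E ih] J K f a.
  move=> _ _ mK mf f0 ma a0; rewrite (_ : [set w | _] = setT) ?setIT; last by apply/seteqP; split.
  by apply: eq_integral => w _; rewrite big_nil oppr0 expR0 mule1.
move=> /= /andP[eE uE] JE mK mf f0 ma a0.
pose J' : set (word + nat) := J `|` [set inl e].
have up (A : set Om) : measurable (A : set (g_sigma_algebraType (join_events F J))) ->
    measurable (A : set (g_sigma_algebraType (join_events F J'))).
  by apply: (@gen_mono _ Om); apply: join_events_mono => i; left.
have upf d1 (Y : measurableType d1) (g : Om -> Y) :
    measurable_fun setT (g : g_sigma_algebraType (join_events F J) -> Y) ->
    measurable_fun setT (g : g_sigma_algebraType (join_events F J') -> Y).
  by move=> mg _ B mB; have := mg measurableT _ mB; rewrite !setTI; exact: up.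
have mZe : measurable_fun setT (Z e : g_sigma_algebraType (join_events F J') -> R).
  by apply: (@measurable_rv_join _ Om _ P _ R _ F _ (inl e) (Z e)) => //; right.
have mK' : measurable (K `&` [set w | a e w < Z e w] : set (g_sigma_algebraType (join_events F J'))).
  apply: measurableI; first exact: up.
  have -> : [set w | a e w < Z e w] = (fun w => Z e w - a e w) @^-1` [set v | 0 < v].
    by apply/seteqP; split => w /=; rewrite subr_gt0.
  rewrite -[X in measurable X]setTI.
  have md : measurable_fun setT ((fun w => Z e w - a e w) : g_sigma_algebraType (join_events F J') -> R).
    by apply: measurable_funB => //; exact: upf.
  apply: md => //.
  by rewrite (_ : [set v | _] = `]0, +oo[%classic)//; apply/seteqP; split => v /=; rewrite in_itv/= andbT.
transitivity (\int[P]_(w in (K `&` [set w | (a e w < Z e w)%R]) `&`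
    [set w | forall e, e \in E -> (a e w < Z e w)%R]) f w)%E.
  congr (integral _ _ _); apply/seteqP; split => w /=.
    move=> [Kw h]; split; first by split => //; apply: h; rewrite mem_head.
    by move=> e' eE'; apply: h; rewrite inE eE' orbT.
  by move=> [[Kw h] hE]; split => // e'; rewrite inE => /orP[/eqP ->//|]; exact: hE.
have JE' e' : e' \in E -> ~ J' (inl e').
  move=> eE' [Je'|[ee']]; first by apply: (JE e') => //; rewrite inE eE' orbT.
  by move: eE; rewrite -ee' eE'.
apply: (etrans (ih J' _ f a uE JE' mK' (upf _ _ _ mf) f0 (fun e' => upf _ _ _ (ma e')) a0)).
pose f' w := (f w * (expR (- \sum_(e <- E) a e w))%:E)%E.
have mf' : measurable_fun setT (f' : g_sigma_algebraType (join_events F J) -> \bar R).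
  apply: emeasurable_funM => //; apply/measurable_EFinP; apply: measurableT_comp => //.
  by apply: measurable_funN; exact: measurable_sum.
have f'0 w : (0 <= f' w)%E by rewrite mule_ge0// lee_fin expR_ge0.
have Je : ~ J (inl e) by apply: JE; rewrite mem_head.
have := @freeze_clock J e Je K f' (a e) (fun=> 0) mK mf' f'0 (ma e) (a0 e) (measurable_cst _) (fun=> lexx _).
rewrite (_ : (fun w => _ * _)%E = f') => [->|]; last first.
  by apply/funext => w; rewrite oppr0 mul0r expR0 mule1.
apply: eq_integral => w _; rewrite /f' -muleA -EFinM; congr (_ * _%:E)%E.
by rewrite addr0 divr1 mulN1r -expRD big_cons opprD addrC.
Qed.

Fixpoint birth_time e w : R :=
  if e is _ :: e' then birth_time e' w + (intensity e' w)^-1 * Z e' w else 0.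

Definition death_time e w : R := birth_time e w + (intensity e w)^-1 * Z e w.

Definition last_split (ws : nat -> word) n w : R := if n is m.+1 then death_time (ws m) w else 0.

(** The path obtained if words are split in the prescribed order [ws], whether or not this is the
    order of death times. With [ws] fixed, its first splits involve finitely many clocks and
    hyperplanes. *)
Definition split_times (ws : nat -> word) w : path_space R l :=
  fun i => (ws i, hyp (ws i) w, death_time (ws i) w - last_split ws i w).

Lemma ptime_split_times ws n w : ptime n (split_times ws w) = last_split ws n w.
Proof.
elim: n => [|n ih]; first by rewrite /ptime big_ord0.
by rewrite ptimeS ih /pwait /= addrC subrK.
Qed.

Definition used (ws : nat -> word) n : set (word + word) :=
  [set i | exists2 k, (k < n)%N & match i with inl f => f = ws k | inr f => f = ws k end].

Lemma measurable_birth_time J e : (forall f, f \in ancestors e -> J (inl f) /\ J (inr f)) ->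
  measurable_fun setT (birth_time e : hist J -> R).
Proof.
elim: e => [|b e ih] Je /=; first exact: measurable_cst.
have Je' f : f \in ancestors e -> J (inl f) /\ J (inr f).
  by move=> fe; apply: Je; rewrite /= inE fe orbT.
have [Jl Jr] : J (inl e) /\ J (inr e) by apply: Je; rewrite /= mem_head.
apply: measurable_funD; first exact: ih.
apply: measurable_funM; last exact: measurable_hist_Z.
apply: measurable_inv_ge0; last by move=> w; exact: intensity_ge0.
by apply: measurable_intensity => f /Je'[].
Qed.

Lemma measurable_death_time J e : J (inl e) ->
  (forall f, f \in ancestors e -> J (inl f) /\ J (inr f)) ->
  measurable_fun setT (death_time e : hist J -> R).
Proof.
move=> Jl Je; apply: measurable_funD; first exact: measurable_birth_time.
apply: measurable_funM; last exact: measurable_hist_Z.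
apply: measurable_inv_ge0; last by move=> w; exact: intensity_ge0.
by apply: measurable_intensity => f /Je[].
Qed.

(** * The next split when the order is prescribed *)

Section fixed_words.
Variables (ws : nat -> word) (n : nat).
Hypothesis vws : valid_words ws n.

Let ancestors_used e : e \in leaves ws n -> forall f, f \in ancestors e ->
  used ws n (inl f) /\ used ws n (inr f).
Proof.
move=> en f fe; have [_ a _] := leaves_invariant vws; have [i iN fi] := a e f en fe.
by split; exists i.
Qed.

Let ancestors_word_used k : (k < n)%N -> forall f, f \in ancestors (ws k) ->
  used ws n (inl f) /\ used ws n (inr f).
Proof.
move=> kn f fe; have [_ a _] := leaves_invariant (valid_words_le (ltnW kn) vws).
have [i iN fi] := a _ f (vws kn) fe.
by split; exists i => //; exact: ltn_trans kn.
Qed.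

Lemma measurable_last_split k : (k <= n)%N ->
  measurable_fun setT (last_split ws k : hist (used ws n) -> R).
Proof.
case: k => [|k] kn; first exact: measurable_cst.
by apply: measurable_death_time; [exists k|exact: ancestors_word_used].
Qed.

Lemma measurable_split_times :
  measurable_fun setT (split_times ws : hist (used ws n) -> path_before n).
Proof.
apply: (@measurability _ _ (hist (used ws n)) (path_before n) _ _ (events_before n)) => // _ [B [i /= iN Bi] <-].
rewrite setTI; case: Bi => [[Q ->]|[A mA ->]|[A mA ->]].
- have [h|h] := pselect (Q (ws i)).
    by rewrite (_ : _ @^-1` _ = setT)//; apply/seteqP; split.
  by rewrite (_ : _ @^-1` _ = set0)//; apply/seteqP; split.
- have Ji : used ws n (inr (ws i)) by exists i.
  by rewrite -[X in measurable X]setTI; exact: (measurable_hist_hyp Ji measurableT mA).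
- rewrite -[X in measurable X]setTI.
  have md : measurable_fun setT ((fun w => death_time (ws i) w - last_split ws i w) : hist (used ws n) -> R).
    apply: measurable_funB; last by apply: measurable_last_split; exact: ltnW.
    by apply: measurable_death_time; [exists i|exact: ancestors_word_used].
  exact: (md measurableT _ mA).
Qed.

Lemma split_times_cell w e : (forall f, f \in ancestors e -> exists2 i, (i < n)%N & f = ws i) ->
  pcell W n (split_times ws w) e = cellw e w.
Proof.
move=> h; apply: eq_tree_cell => f /h[i iN ->].
exact: (@hyp_atE _ _ n (split_times ws w) i vws iN).
Qed.

Lemma split_times_leaf w e : e \in leaves ws n -> pcell W n (split_times ws w) e = cellw e w.
Proof.
by move=> en; apply: split_times_cell => f; have [_ a _] := leaves_invariant vws; exact: a.
Qed.

Lemma zt_split_times w : zt Lam W n (split_times ws w) = \sum_(e <- leaves ws n) intensity e w.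
Proof.
rewrite /zt /pzeta -[RHS]/(fine (_%:E)); congr fine; rewrite -sumEFin !big_seq.
by apply: eq_bigr => e en; rewrite intensityE split_times_leaf.
Qed.

Lemma birth_before_last w e : good W n (split_times ws w) -> e \in leaves ws n ->
  birth_time e w <= last_split ws n w.
Proof.
move=> g en; have lt m k : (m <= k <= n)%N -> last_split ws m w <= last_split ws k w.
  move=> /andP[mk kn]; rewrite -!ptime_split_times.
  elim: k mk kn => [|k ih]; first by rewrite leqn0 => /eqP ->.
  rewrite leq_eqVlt => /orP[/eqP -> //|mk] kn; apply: (le_trans (ih mk (ltnW kn))).
  by rewrite ptimeS lerDl ltW//; have [_ /(_ k kn)[]] := g.
case: e en => [|b e] en /=; first by apply: (lt 0%N n); rewrite leqnn.
have [_ a _] := leaves_invariant vws.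
have [i iN ->] := a (b :: e) e en (mem_head _ _).
rewrite -[_ + _]/(last_split ws i.+1 w); apply: lt; by rewrite iN leqnn.
Qed.

Lemma leaf_intensity_gt0 w e : good W n (split_times ws w) -> e \in leaves ws n -> 0 < intensity e w.
Proof.
move=> g en; rewrite -lte_fin intensityE -(split_times_leaf w en).
by apply: pcell_Lam_gt0.
Qed.

(** The level that the clock of [e] must exceed for its cell to be alive at time [t]. The maximum
    with 0 makes it nonnegative on all outcomes. *)
Definition clock_level e (t : R) w : R := Num.max 0 (intensity e w * (t - birth_time e w)).

Lemma clock_levelP w e t : good W n (split_times ws w) -> e \in leaves ws n ->
  last_split ws n w <= t -> clock_level e t w = intensity e w * (t - birth_time e w) /\
  (t < death_time e w <-> clock_level e t w < Z e w).
Proof.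
move=> g en lt; have i0 := leaf_intensity_gt0 g en.
have -> : clock_level e t w = intensity e w * (t - birth_time e w).
  apply/max_idPr; rewrite mulr_ge0 ?(ltW i0)// subr_ge0.
  by apply: le_trans lt; exact: birth_before_last.
split => //; rewrite -ltr_pdivlMl// ltrBlDl /death_time; exact: iff_refl.
Qed.

(** The clocks of the split words and the whole sequence G; the clocks of the leaves are independent
    of these. *)
Local Notation clocks := ([set i : word + nat | match i with inl f => used ws n (inl f) | inr _ => True end]).

Let used_clocks (A : set Om) : measurable (A : set (hist (used ws n))) ->
  measurable (A : set (g_sigma_algebraType (join_events F clocks))).
Proof.
apply: (@gen_le_gen _ Om) => B [[f|f] [k kn fk]] HB.
  by apply: sub_sigma_algebra; exists (inl f) => //=; exists k.
case: HB => B0 mB0 <-; have := measurable_hyp f measurableT mB0; rewrite !setTI.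
by apply: (@gen_mono _ Om); apply: join_events_mono => -[].
Qed.

Let used_clocks_fun d1 (Y : measurableType d1) (g : Om -> Y) :
  measurable_fun setT (g : hist (used ws n) -> Y) ->
  measurable_fun setT (g : g_sigma_algebraType (join_events F clocks) -> Y).
Proof. by move=> mg _ B mB; have := mg measurableT _ mB; rewrite !setTI; exact: used_clocks. Qed.

Let leaf_unused e : e \in leaves ws n -> ~ clocks (inl e).
Proof. by move=> en [k kn ek]; have [_ _ /(_ k kn)] := leaves_invariant vws; rewrite -ek en. Qed.

(** The event on the left says that the leaf [u] dies before the other leaves and more than [s]
    after the last split. First the hyperplane of [u] is integrated out, given all the rest, by
    [split_law_aside]; then the clocks of the other leaves, whose survival beyond the death of [u]
    is exponential in the clock of [u]; then that clock. On the right the clocks of all leaves are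
    integrated out, given the past. Both sides become integrals over the past with equal integrands,
    which is the memoryless property. *)
Lemma split_times_kernel (D : set (path_before n)) u A s :
  measurable D -> D `<=` good W n -> u \in leaves ws n -> measurable A -> 0 <= s ->
  (P (split_times ws @^-1` D `&` [set w | [/\ forall e, e \in leaves ws n -> e != u -> (death_time u w < death_time e w)%R,
        A (hyp u w) & (last_split ws n w + s < death_time u w)%R]]) =
   \int[P]_(w in split_times ws @^-1` D `&` [set w | forall e, e \in leaves ws n -> (last_split ws n w < death_time e w)%R])
      kern Lam W n u A s (split_times ws w))%E.
Proof.
move=> mD Dg un mA s0.
have uL : uniq (leaves ws n) by have [] := leaves_invariant vws.
set K : set Om := split_times ws @^-1` D.
pose E := rem u (leaves ws n).
have En e : e \in E -> e \in leaves ws n by exact: mem_rem.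
have EP e : e \in E = (e != u) && (e \in leaves ws n) by rewrite /E mem_rem_uniq// inE.
have uE : uniq E by exact: rem_uniq.
have mK : measurable (K : set (hist (used ws n))).
  by rewrite -[X in measurable X]setTI; exact: measurable_split_times.
have gK w : K w -> good W n (split_times ws w) by exact: Dg.
have m1 := measurable_last_split (leqnn n).
have mb e : e \in leaves ws n -> measurable_fun setT (birth_time e : hist (used ws n) -> R).
  by move=> en; apply: measurable_birth_time; exact: ancestors_used.
have mi e : e \in leaves ws n -> measurable_fun setT (intensity e : hist (used ws n) -> R).
  by move=> en; apply: measurable_intensity => f /(ancestors_used en)[].
have mrho : measurable_fun setT (split_density u A : hist (used ws n) -> \bar R).
  by apply: measurable_split_density => // f /(ancestors_used un)[].
have mb' e : e \in leaves ws n -> measurable_fun setT (birth_time e : g_sigma_algebraType (join_events F clocks) -> R).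
  by move=> /mb; exact: used_clocks_fun.
have mi' e : e \in leaves ws n -> measurable_fun setT (intensity e : g_sigma_algebraType (join_events F clocks) -> R).
  by move=> /mi; exact: used_clocks_fun.
have m1' : measurable_fun setT (last_split ws n : g_sigma_algebraType (join_events F clocks) -> R).
  exact: used_clocks_fun.
have mK' : measurable (K : set (g_sigma_algebraType (join_events F clocks))) by exact: used_clocks.
(* A bound for the ranks of the words split so far, none of which is the leaf [u] or descends from
   it. *)
pose N := (\max_(i < n) word_code (ws i))%N.
have leafN e f : e \in leaves ws n -> f \in ancestors e -> aside u N (inr f).
  move=> en fe /=; have [_ a b] := leaves_invariant vws; have [i iN fi] := a e f en fe.
  rewrite fi (@leq_bigmax _ (fun i : 'I_n => word_code (ws i)) (Ordinal iN)) /=.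
  apply/negP; rewrite inE => /orP[/eqP ui|ui]; first by have := b i iN; rewrite -ui un.
  have [_ a' _] := leaves_invariant (valid_words_le (ltnW iN) vws).
  by have [j ji uj] := a' _ _ (vws iN) ui; have := b j (ltn_trans ji iN); rewrite -uj un.
have used_aside : used ws n `<=` aside u N.
  move=> [//|f] [i iN fi] /=; rewrite fi (@leq_bigmax _ (fun i : 'I_n => word_code (ws i)) (Ordinal iN)) /=.
  have [_ a b] := leaves_invariant vws.
  apply/negP; rewrite inE => /orP[/eqP ui|ui]; first by have := b i iN; rewrite -ui un.
  have [_ a' _] := leaves_invariant (valid_words_le (ltnW iN) vws).
  by have [j ji uj] := a' _ _ (vws iN) ui; have := b j (ltn_trans ji iN); rewrite -uj un.
have md e : e \in leaves ws n -> measurable_fun setT (death_time e : hist (aside u N) -> R).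
  by move=> en; apply: measurable_death_time => // f fe; split => //; exact: leafN fe.
pose K1 : set Om := K `&` ([set w | forall e, e \in leaves ws n -> e != u -> death_time u w < death_time e w] `&`
  [set w | last_split ws n w + s < death_time u w]).
have mK1 : measurable (K1 : set (hist (aside u N))).
  apply: measurableI; first exact: (hist_le used_aside mK).
  apply: measurableI.
    have -> : [set w | forall e, e \in leaves ws n -> e != u -> death_time u w < death_time e w] =
      \bigcap_(e in [set` E]) [set w | death_time u w < death_time e w].
      by apply/seteqP; split => w h e; [rewrite /= EP => /andP[eu en]; exact: h|move=> en eu; apply: h; rewrite /= EP eu].
    apply: fin_bigcap_measurable => [|e /= eE]; first exact: finite_seq.
    apply: measurable_lt_fun; first exact: md.
    by apply: md; exact: En.
  apply: measurable_lt_fun; last exact: md.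
  apply: measurable_funD => //.
  move=> _ B mB; have := m1 measurableT B mB; rewrite !setTI; exact: hist_le.
transitivity (P (K1 `&` [set w | A (hyp u w)])).
  by congr (P _); apply/seteqP; split => w /=; [move=> [Kw [h1 h2 h3]]|move=> [[Kw [h1 h3]] h2]].
rewrite (split_law_aside mK1 mA).
(* [alpha] is the level for the clock of [u] at time [s] after the last split; [a e] is the level
   for another leaf at the death of [u]. *)
pose alpha w := clock_level u (last_split ws n w + s) w.
pose a e w := if e \in E then clock_level e (death_time u w) w else 0.
have K1E : K1 = (K `&` [set w | alpha w < Z u w]) `&` [set w | forall e, e \in E -> a e w < Z e w].
  apply/seteqP; split => w.
    move=> [Kw [h1 h2]]; have gw := gK w Kw.
    have [_ [c1 _]] := clock_levelP gw un (ler_wpDr s0 (lexx (last_split ws n w))).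
    split; first by split => //; exact: c1.
    move=> e eE; rewrite /a eE; have [_ [c2 _]] := clock_levelP gw (En e eE) (ltW (le_lt_trans (ler_wpDr s0 (lexx (last_split ws n w))) h2)).
    by apply: c2; move: eE; rewrite EP => /andP[eu en]; exact: h1.
  move=> [[Kw h2] h1]; have gw := gK w Kw.
  have [_ [_ c1]] := clock_levelP gw un (ler_wpDr s0 (lexx (last_split ws n w))).
  have {}h2 := c1 h2; split => //; split => // e en eu.
  have eE : e \in E by rewrite EP eu.
  have [_ [_ c2]] := clock_levelP gw en (ltW (le_lt_trans (ler_wpDr s0 (lexx (last_split ws n w))) h2)).
  by apply: c2; have := h1 e eE; rewrite /a eE.
pose J2 : set (word + nat) := clocks `|` [set inl u].
have up2 (B : set Om) : measurable (B : set (g_sigma_algebraType (join_events F clocks))) ->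
    measurable (B : set (g_sigma_algebraType (join_events F J2))).
  by apply: (@gen_mono _ Om); apply: join_events_mono => i; left.
have upf2 (g : Om -> R) : measurable_fun setT (g : g_sigma_algebraType (join_events F clocks) -> R) ->
    measurable_fun setT (g : g_sigma_algebraType (join_events F J2) -> R).
  by move=> mg _ B mB; have := mg measurableT _ mB; rewrite !setTI; exact: up2.
have mZu : measurable_fun setT (Z u : g_sigma_algebraType (join_events F J2) -> R).
  by apply: (@measurable_rv_join _ Om _ P _ R _ F _ (inl u) (Z u)) => //; right.
have mlevel dd (T : measurableType dd) (i t b : T -> R) : measurable_fun setT i -> measurable_fun setT t ->
    measurable_fun setT b -> measurable_fun setT (fun x => Num.max 0 (i x * (t x - b x))).
  by move=> h1 h2 h3; apply: measurable_maxr => //; apply: measurable_funM => //; exact: measurable_funB.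
have malpha : measurable_fun setT (alpha : g_sigma_algebraType (join_events F clocks) -> R).
  by apply: mlevel; [exact: mi'|exact: measurable_funD|exact: mb'].
have alpha0 w : 0 <= alpha w by rewrite le_max lexx.
have mdu : measurable_fun setT (death_time u : g_sigma_algebraType (join_events F J2) -> R).
  apply: measurable_funD; first by apply: upf2; exact: mb'.
  apply: measurable_funM => //; apply: measurable_inv_ge0; last by move=> w; exact: intensity_ge0.
  by apply: upf2; exact: mi'.
have ma e : measurable_fun setT (a e : g_sigma_algebraType (join_events F J2) -> R).
  rewrite /a; case: (boolP (e \in E)) => eE; last exact: measurable_cst.
  by apply: mlevel => //; apply: upf2; [apply: mi'|apply: mb']; exact: En.
have a0 e w : 0 <= a e w by rewrite /a; case: ifP => // _; rewrite le_max lexx.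
have mK2 : measurable (K `&` [set w | alpha w < Z u w] : set (g_sigma_algebraType (join_events F J2))).
  by apply: measurableI; [exact: up2|apply: measurable_lt_fun => //; exact: upf2].
have mrho' : measurable_fun setT (split_density u A : g_sigma_algebraType (join_events F clocks) -> \bar R).
  exact: used_clocks_fun.
rewrite K1E (freeze_clocks uE _ mK2 _ _ ma a0); last 3 first.
- move=> e eE [/leaf_unused|[eu]]; first by apply; exact: En.
  by move: eE; rewrite EP eu eqxx.
- by move=> _ B mB; have := mrho' measurableT _ mB; rewrite !setTI; exact: up2.
- by move=> w; exact: split_density_ge0.
(* The sum of the levels of the other leaves is affine in the clock of [u]: it is [c] plus [b] times
   that clock. *)
pose S1 w := \sum_(e <- E) intensity e w.
pose S2 w := \sum_(e <- E) intensity e w * birth_time e w.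
pose c w := S1 w * birth_time u w - S2 w.
pose b w := S1 w * (intensity u w)^-1.
have S10 w : 0 <= S1 w by apply: sumr_ge0 => e _; exact: intensity_ge0.
have b0 w : 0 <= b w by rewrite mulr_ge0// invr_ge0 intensity_ge0.
have mS1 : measurable_fun setT (S1 : g_sigma_algebraType (join_events F clocks) -> R).
  apply: (@measurable_sum_in _ (g_sigma_algebraType (join_events F clocks)) R _ E intensity) => e /En.
  exact: mi'.
have mS2 : measurable_fun setT (S2 : g_sigma_algebraType (join_events F clocks) -> R).
  apply: (@measurable_sum_in _ (g_sigma_algebraType (join_events F clocks)) R _ E
    (fun e w => intensity e w * birth_time e w)) => e /En en.
  by apply: measurable_funM; [exact: mi'|exact: mb'].
have mc : measurable_fun setT (c : g_sigma_algebraType (join_events F clocks) -> R).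
  by apply: measurable_funB => //; apply: measurable_funM => //; exact: mb'.
have mbb : measurable_fun setT (b : g_sigma_algebraType (join_events F clocks) -> R).
  apply: measurable_funM => //; apply: measurable_inv_ge0; last by move=> w; exact: intensity_ge0.
  exact: mi'.
pose f w := (split_density u A w * (expR (- c w))%:E)%E.
have mf : measurable_fun setT (f : g_sigma_algebraType (join_events F clocks) -> \bar R).
  apply: emeasurable_funM => //; apply/measurable_EFinP; apply: measurableT_comp => //.
  exact: measurable_funN.
have f0 w : (0 <= f w)%E by rewrite mule_ge0 ?split_density_ge0// lee_fin expR_ge0.
transitivity (\int[P]_(w in K `&` [set w | (alpha w < Z u w)%R]) (f w * (expR (- b w * Z u w))%:E))%E.
  apply: eq_integral => w /set_mem[Kw h2]; have gw := gK w Kw.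
  have [_ [_ c1]] := clock_levelP gw un (ler_wpDr s0 (lexx (last_split ws n w))).
  have {}h2 := c1 h2.
  rewrite /f -[RHS]muleA -EFinM -expRD; congr (_ * (expR _)%:E)%E.
  rewrite mulNr -opprD; congr (- _); rewrite big_seq (eq_bigr (fun e =>
      intensity e w * death_time u w - intensity e w * birth_time e w)); last first.
    move=> e eE; rewrite /a eE -mulrBr.
    by have [] := clock_levelP gw (En e eE) (ltW (le_lt_trans (ler_wpDr s0 (lexx (last_split ws n w))) h2)).
  rewrite -big_seq sumrB -mulr_suml -/(S1 w) -/(S2 w) /c /b /death_time; ring.
rewrite (freeze_clock (leaf_unused un) mK' mf f0 malpha alpha0 mbb b0).
(* The levels at the time of the last split, for the integral on the right. *)
pose gam e w := if e \in leaves ws n then clock_level e (last_split ws n w) w else 0.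
have -> : K `&` [set w | forall e, e \in leaves ws n -> last_split ws n w < death_time e w] =
    K `&` [set w | forall e, e \in leaves ws n -> gam e w < Z e w].
  apply/seteqP; split => w [Kw h]; split => // e en; have := h e en; rewrite /gam en;
    by have [_ [c1 c2]] := clock_levelP (gK w Kw) en (lexx _).
rewrite (freeze_clocks uL _ mK')//; last 4 first.
- apply: used_clocks_fun.
  exact: (measurableT_comp (@measurable_kern R l Lam Lam_fin W W_window n u A s mA) measurable_split_times).
- by move=> w; exact: kern_ge0.
- move=> e; rewrite /gam; case: (boolP (e \in leaves ws n)) => en; last exact: measurable_cst.
  by apply: mlevel => //; [exact: mi'|exact: mb'].
- by move=> e w; rewrite /gam; case: ifP => // _; rewrite le_max lexx.
apply: eq_integral => w /set_mem Kw; have gw := gK w Kw.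
have u0 := leaf_intensity_gt0 gw un.
rewrite /kern (_ : u \in pleaves n (split_times ws w))// zt_split_times split_times_leaf//.
have LE : Lam (A `&` hits (cellw u w)) \is a fin_num by apply: Lam_hits_fin => //; exact: cellw_compact.
rewrite /f /split_density -(fineK LE) -!EFinM; congr (_%:E).
set L := fine _; have uperm : perm_eq (leaves ws n) (u :: E) by exact: perm_to_rem.
have zE : \sum_(e <- leaves ws n) intensity e w = intensity u w + S1 w.
  by rewrite (perm_big _ uperm) big_cons.
have gE : \sum_(e <- leaves ws n) gam e w =
    intensity u w * (last_split ws n w - birth_time u w) + (S1 w * last_split ws n w - S2 w).
  rewrite big_seq (eq_bigr (fun e => intensity e w * (last_split ws n w - birth_time e w))); last first.
    by move=> e en; rewrite /gam en; have [] := clock_levelP gw en (lexx _).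
  rewrite -big_seq (perm_big _ uperm) big_cons; congr (_ + _).
  by rewrite /S1 /S2 mulr_suml -sumrB; apply: eq_bigr => e _; rewrite mulrBr.
have aE : alpha w = intensity u w * (last_split ws n w + s - birth_time u w).
  by have [] := clock_levelP gw un (ler_wpDr s0 (lexx (last_split ws n w))).
(* Rates add up: [1 + b w] times the intensity of [u] is zeta. *)
have eE : expR (- c w) * expR (- (1 + b w) * alpha w) =
    expR (- (s * (intensity u w + S1 w))) * expR (- \sum_(e <- leaves ws n) gam e w).
  rewrite -!expRD gE aE; congr expR; rewrite /c /b; field.
  by rewrite gt_eqF.
rewrite zE -[RHS]mulrA -[X in _ = L * X]mulrA -eE.
rewrite /b; field; rewrite !gt_eqF//.
- by rewrite ltr_wpDr.
Qed.

End fixed_words.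

(** * The order of the splits by death times *)

Definition earliest (E : seq word) w : word :=
  head [::] [seq e <- E | all (fun f => death_time e w <= death_time f w) E].

(** The beginning of the order is built as a list, so that it takes countably many values and each
    value can be treated as a prescribed order. *)
Fixpoint split_words n w : seq word :=
  if n is m.+1
  then rcons (split_words m w) (earliest (leaves (nth [::] (split_words m w)) m) w)
  else [::].

Definition order_word w n : word := nth [::] (split_words n.+1 w) n.

Definition stit_path w : path_space R l := split_times (order_word w) w.

Lemma size_split_words n w : size (split_words n w) = n.
Proof. by elim: n => //= n ih; rewrite size_rcons ih. Qed.

Lemma nth_split_words n i w : (i < n)%N -> nth [::] (split_words n w) i = order_word w i.
Proof.
elim: n => // n ih; rewrite ltnS leq_eqVlt => /orP[/eqP -> //|iN].
by rewrite /= nth_rcons size_split_words iN ih.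
Qed.

Lemma order_wordE w n : order_word w n = earliest (leaves (order_word w) n) w.
Proof.
rewrite /order_word /= nth_rcons size_split_words ltnn eqxx; congr (earliest _ w).
by apply: eq_leaves => i iN; rewrite nth_split_words.
Qed.

Lemma eq_last_split ws ws' n w : (forall i, (i < n)%N -> ws i = ws' i) -> last_split ws n w = last_split ws' n w.
Proof. by case: n => //= n ->. Qed.

Lemma eq_split_times ws ws' n w : (forall i, (i < n)%N -> ws i = ws' i) ->
  forall i, (i < n)%N -> split_times ws w i = split_times ws' w i.
Proof.
move=> h i iN; rewrite /split_times h// (@eq_last_split ws ws')// => j ji; apply: h.
exact: ltn_trans iN.
Qed.

(** True of the generators and stable under the operations of a sigma-algebra. It transfers
    measurable properties of the past between paths with the same first splits. *)
Lemma path_before_eq n (D : set (@path_before R l n)) (x y : path_space R l) : measurable D ->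
  (forall i, (i < n)%N -> x i = y i) -> D x -> D y.
Proof.
move=> mD; move: D mD x y.
pose C : set (set (path_space R l)) := [set D | forall x y, (forall i, (i < n)%N -> x i = y i) -> D x -> D y].
suff : <<s @events_before R l n >> `<=` C by move=> h D mD x y xy; exact: (h D mD).
apply: smallest_sub.
  split.
  - by move=> x y _.
  - move=> A CA x y xy /= [_ nA]; split => // Ay; apply: nA; apply: CA Ay => i iN.
    by rewrite xy.
  - by move=> A CA x y xy [k _ Ax]; exists k => //; exact: CA Ax.
by move=> A [i /= iN [[Q ->]|[B mB ->]|[B mB ->]]] x y xy /=; rewrite /pword /phyp /pwait xy.
Qed.

Lemma eq_good_before n (x y : path_space R l) : (forall i, (i < n)%N -> x i = y i) ->
  good W n x -> good W n y.
Proof. by move=> xy; exact: (path_before_eq (@measurable_good R l W W_window n) xy). Qed.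

Lemma eq_kern_before n u A s (x y : path_space R l) : measurable A ->
  (forall i, (i < n)%N -> x i = y i) -> kern Lam W n u A s x = kern Lam W n u A s y.
Proof.
move=> mA xy; have mk := @measurable_kern R l Lam Lam_fin W W_window n u A s mA.
have m1 : measurable [set z : path_before n | kern Lam W n u A s z = kern Lam W n u A s x].
  rewrite -[X in measurable X]setTI; exact: (mk measurableT _ (emeasurable_set1 _)).
by have /esym := path_before_eq m1 xy (erefl _).
Qed.

Lemma leaves_later ws m n e : (m <= n)%N -> valid_words ws n -> e \in leaves ws m ->
  e \in leaves ws n \/ exists2 j, (m <= j < n)%N & e = ws j.
Proof.
elim: n => [|n ih]; first by rewrite leqn0 => /eqP ->; left.
rewrite leq_eqVlt => /orP[/eqP -> _ em|mn /valid_wordsS[v wn] em]; first by left.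
have [en|[j /andP[mj jn] ->]] := ih mn v em; last by right; exists j => //; rewrite mj ltnW.
have [ew|ew] := eqVneq e (ws n); first by right; exists n => //; rewrite ltnS leqnn andbT -ltnS.
left; have [u _ _] := leaves_invariant v.
by rewrite /= !inE mem_rem_uniq// inE ew en !orbT.
Qed.

(** A criterion, in terms of the prescribed order alone, for [ws] to be the order of the first [n]
    splits. *)
Definition state_at ws n w := good W n (split_times ws w) /\
  forall e, e \in leaves ws n -> last_split ws n w < death_time e w.

Lemma last_split_lt ws m n w : good W n (split_times ws w) -> (m < n)%N ->
  last_split ws m w < last_split ws n w.
Proof.
move=> g; rewrite -!ptime_split_times.
elim: n g => // n ih g; have /goodS[g' _ _ p0] := g.
rewrite ltnS leq_eqVlt ptimeS => /orP[/eqP ->|mn]; first by rewrite ltrDl.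
by apply: (lt_trans (ih g' mn)); rewrite ltrDl.
Qed.

Lemma earliestE E w u : uniq E -> u \in E ->
  (forall e, e \in E -> e != u -> death_time u w < death_time e w) -> earliest E w = u.
Proof.
move=> uE uin h; rewrite /earliest (_ : [seq e <- E | _] = [:: u])//.
rewrite -(filter_pred1_uniq uE uin); apply: eq_in_filter => e eE /=; apply/idP/eqP => [/allP a|->].
  apply/eqP/negPn/negP => eu; have := a u uin; rewrite leNgt h//.
by apply/allP => f fE; have [->//|fu] := eqVneq f u; apply: ltW; exact: h.
Qed.

(** A leaf present before split i, other than the word split then, either is split later or is still
    alive after the last split; in both cases it dies later. *)
Lemma state_at_order ws n w : state_at ws n w -> forall i, (i < n)%N -> order_word w i = ws i.
Proof.
move=> [g h]; have v : valid_words ws n by case: g.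
elim/ltn_ind => i ih iN; rewrite order_wordE.
have -> : leaves (order_word w) i = leaves ws i.
  by apply: eq_leaves => j ji; apply: ih => //; exact: ltn_trans iN.
have [ui _ _] := leaves_invariant (valid_words_le (ltnW iN) v).
have wi : ws i \in leaves ws i by exact: v.
apply: earliestE => // e ei ew.
have lt j : (i < j <= n)%N -> death_time (ws i) w <= last_split ws j w.
  rewrite -[X in X <= _]/(last_split ws i.+1 w) => /andP[ij jn].
  move: ij; rewrite leq_eqVlt => /orP[/eqP -> //|ij]; apply/ltW/last_split_lt => //.
  exact: good_le g.
have [en|[j /andP[ij jn] ej]] := leaves_later (ltnW iN) v ei.
  by apply: le_lt_trans (h e en); apply: lt; rewrite iN leqnn.
have {}ij : (i < j)%N by rewrite ltn_neqAle ij andbT; apply: contra_neq ew => ->.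
rewrite ej -[X in _ < X]/(last_split ws j.+1 w) -[X in X < _]/(last_split ws i.+1 w).
by apply: last_split_lt; [exact: good_le g|rewrite ltnS].
Qed.

Lemma state_at_path ws n w : state_at ws n w ->
  split_words n w = mkseq ws n /\ forall i, (i < n)%N -> stit_path w i = split_times ws w i.
Proof.
move=> st; have o := state_at_order st; split; last exact: eq_split_times.
apply: (@eq_from_nth _ [::]); first by rewrite size_split_words size_mkseq.
by move=> i; rewrite size_split_words => iN; rewrite nth_split_words// nth_mkseq// o.
Qed.

Lemma eq_state_at ws ws' n w : (forall i, (i < n)%N -> ws i = ws' i) -> state_at ws n w -> state_at ws' n w.
Proof.
move=> h [g d0]; split; first by apply: eq_good_before g; exact: eq_split_times.
by move=> e; rewrite -(eq_leaves h) -(eq_last_split w h); exact: d0.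
Qed.

Definition ordered w := forall n, state_at (order_word w) n w.

Lemma clocks_positive : {ae P, forall w, forall e, 0 < Z e w}.
Proof.
suff h e : {ae P, forall w, 0 < Z e w}.
  have h' k : {ae P, forall w, 0 < Z (nth_word k) w} by exact: h.
  by apply: filterS (ae_foralln h') => w hw e; rewrite -(word_codeK e).
have m0 : measurable [set v : R | 0 < v].
  by rewrite (_ : [set v | _] = `]0, +oo[%classic)//; apply/seteqP; split => v /=; rewrite in_itv/= andbT.
have mE : measurable (Z e @^-1` [set v | 0 < v]) by rewrite -[X in measurable X]setTI; exact: measurable_funP.
exists (~` (Z e @^-1` [set v | 0 < v])); split => //; first exact: measurableC.
have PE : P (Z e @^-1` [set v | 0 < v]) = 1%E.
  have := exponential_tail (Z_law e) (lexx 0); rewrite oppr0 expR0 => <-.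
  rewrite -[LHS]/(distribution P (Z e) _) measure_indic_integral//.
  by apply: eq_integral => v _; rewrite indicE mem_setE.
by have := probability_setC P mE; rewrite PE subee.
Qed.

Definition next_split ws n (D : set (path_space R l)) u (A : set Hyp) (s : R) : set Om :=
  split_times ws @^-1` D `&` [set w | [/\ forall e, e \in leaves ws n -> e != u -> death_time u w < death_time e w,
        A (hyp u w) & last_split ws n w + s < death_time u w]].

Lemma measurable_death_time_Om e : measurable_fun [set: Om] (death_time e).
Proof.
apply: (measurable_fun_gen _ (@measurable_death_time setT e I (fun _ _ => conj I I))).
by apply: join_events_measurable; exact: ZH_events_measurable.
Qed.

Lemma measurable_last_split_Om ws n : measurable_fun [set: Om] (last_split ws n).
Proof. by case: n => [|n]; [exact: measurable_cst|exact: measurable_death_time_Om]. Qed.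

Lemma measurable_split_times_Om ws : measurable_fun [set: Om] (split_times ws : Om -> @paths R l).
Proof.
apply: (@measurability _ _ Om (@paths R l) _ _ path_gen) => // _ [B [i _ Bi] <-].
rewrite setTI; case: Bi => [[Q ->]|[A mA ->]|[A mA ->]].
- have [h|h] := pselect (Q (ws i)).
    by rewrite (_ : _ @^-1` _ = setT)//; apply/seteqP; split.
  by rewrite (_ : _ @^-1` _ = set0)//; apply/seteqP; split.
- by rewrite -[X in measurable X]setTI; exact: (measurable_hyp_rv (ws i) measurableT mA).
- rewrite -[X in measurable X]setTI.
  have md : measurable_fun [set: Om] (fun w => death_time (ws i) w - last_split ws i w).
    by apply: measurable_funB; [exact: measurable_death_time_Om|exact: measurable_last_split_Om].
  exact: (md measurableT _ mA).
Qed.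

Lemma measurable_leaves_later ws n E : measurable ([set w | forall e, e \in (E : seq word) ->
  last_split ws n w < death_time e w] : set Om).
Proof.
have -> : [set w | forall e, e \in E -> last_split ws n w < death_time e w] =
    \bigcap_(e in [set` E]) [set w | last_split ws n w < death_time e w].
  by apply/seteqP; split => w h e; exact: h.
apply: fin_bigcap_measurable => [|e _]; first exact: finite_seq.
by apply: measurable_lt_fun; [exact: measurable_last_split_Om|exact: measurable_death_time_Om].
Qed.

Lemma measurable_state_at ws n : measurable (state_at ws n : set Om).
Proof.
apply: measurableI; last exact: measurable_leaves_later.
rewrite -[X in measurable X]setTI; apply: measurable_split_times_Om => //.
by apply: measurable_before_path; exact: measurable_good.
Qed.

Lemma measurable_next_split ws n (D : set (@paths R l)) u A s : measurable D -> measurable A ->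
  measurable (next_split ws n D u A s).
Proof.
move=> mD mA; apply: measurableI.
  by rewrite -[X in measurable X]setTI; apply: measurable_split_times_Om.
rewrite (_ : [set w | _] = (\bigcap_(e in [set e | e \in leaves ws n /\ e != u]) [set w | death_time u w < death_time e w]) `&`
   ([set w | A (hyp u w)] `&` [set w | last_split ws n w + s < death_time u w])).
  apply: measurableI.
    apply: fin_bigcap_measurable => [|e _].
      by apply: (@sub_finite_set _ _ [set` leaves ws n]) => [e []//|]; exact: finite_seq.
    by apply: measurable_lt_fun; exact: measurable_death_time_Om.
  apply: measurableI.
    by rewrite -[X in measurable X]setTI; exact: (measurable_hyp_rv u measurableT mA).
  apply: measurable_lt_fun; last exact: measurable_death_time_Om.
  by apply: measurable_funD => //; exact: measurable_last_split_Om.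
apply/seteqP; split => w /=.
  by move=> [h1 h2 h3]; split => // e [en eu]; exact: h1.
by move=> [h1 [h2 h3]]; split => // e en eu; apply: h1.
Qed.

(** Almost surely one leaf dies strictly before the others. For s = 0 and all hyperplanes, the
    kernels of the leaves sum to 1, so the disjoint events that a given leaf dies first exhaust the
    probability of [state_at]. *)
Lemma next_split_ae ws n : valid_words ws n ->
  P.-negligible (state_at ws n `\` \big[setU/set0]_(u <- leaves ws n) next_split ws n (good W n) u setT 0).
Proof.
move=> v; set E := leaves ws n; have [uE _ _] := leaves_invariant v.
have mN u : measurable (next_split ws n (good W n) u setT 0).
  by apply: measurable_next_split => //; apply: measurable_before_path; exact: measurable_good.
have mU : measurable (\big[setU/set0]_(u <- E) next_split ws n (good W n) u setT 0) by exact: bigsetU_measurable.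
have mS := measurable_state_at ws n.
have sub : \big[setU/set0]_(u <- E) next_split ws n (good W n) u setT 0 `<=` state_at ws n.
  rewrite -bigcup_seq => w [u /= un [g [h1 _]]]; rewrite addr0 => h2; split => // e en.
  by have [->//|eu] := eqVneq e u; apply: (lt_trans h2); exact: h1.
have dis u u' : u \in E -> u' \in E -> u != u' ->
    next_split ws n (good W n) u setT 0 `&` next_split ws n (good W n) u' setT 0 = set0.
  move=> un un' uu'; apply/seteqP; split => // w [[_ [h1 _ _]] [_ [h2 _ _]]].
  have := h2 u un uu'; have := h1 u' un'; rewrite eq_sym uu' => /(_ isT) /lt_trans h /h.
  by rewrite ltxx.
have PU E' : uniq E' -> {subset E' <= E} ->
    P (\big[setU/set0]_(u <- E') next_split ws n (good W n) u setT 0) = (\sum_(u <- E') P (next_split ws n (good W n) u setT 0))%E.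
  elim: E' => [|u E' ih]; first by rewrite !big_nil measure0.
  move=> /= /andP[uE' uniqE'] sE'; rewrite !big_cons measureU//.
  - by congr (_ + _)%E; apply: ih => // e eE'; apply: sE'; rewrite inE eE' orbT.
  - exact: bigsetU_measurable.
  - rewrite -bigcup_seq; apply/seteqP; split => // w [wu [u' /= u'E' wu']].
    have uu' : u != u' by apply: contraNneq uE' => ->.
    have iE : u \in E := sE' _ (mem_head _ _).
    have i'E : u' \in E by apply: sE'; rewrite inE u'E' orbT.
    suff : (set0 : set Om) w by [].
    by rewrite -(dis u u' iE i'E uu').
have mk u : measurable_fun [set: Om] (fun w => kern Lam W n u setT 0 (split_times ws w)).
  apply: (@measurableT_comp _ _ _ _ _ _ (kern Lam W n u setT 0 : @paths R l -> \bar R)); last exact: measurable_split_times_Om.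
  by apply: (@measurable_fun_gen _ (@paths R l) (events_before n)); [exact: events_before_sub|exact: measurable_kern].
have total1 w : state_at ws n w -> (\sum_(u <- E) kern Lam W n u setT 0 (split_times ws w) = 1)%E.
  move=> [g _]; have z0 := zt_gt0 Lam_neq0 Lam_inv Lam_fin W_window g.
  rewrite big_seq (eq_bigr (fun u => (intensity u w * (zt Lam W n (split_times ws w))^-1)%:E)).
    by rewrite -big_seq sumEFin -mulr_suml -(zt_split_times v) divff// gt_eqF.
  move=> u un; rewrite /kern (_ : u \in pleaves n (split_times ws w))// setTI split_times_leaf//.
  by rewrite -intensityE -EFinM mul0r oppr0 expR0 mulr1.
have PUS : P (\big[setU/set0]_(u <- E) next_split ws n (good W n) u setT 0) = P (state_at ws n).
  rewrite PU//; transitivity (\int[P]_(w in state_at ws n) \sum_(u <- E) kern Lam W n u setT 0 (split_times ws w))%E.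
    rewrite ge0_integral_sum//; last 2 first.
    - by move=> u; exact: measurable_funTS.
    - by move=> u w _; exact: kern_ge0.
    rewrite !big_seq; apply: eq_bigr => u un.
    exact: (split_times_kernel v (@measurable_good R l W W_window n) (fun _ h => h) un measurableT (lexx 0)).
  rewrite (eq_integral (fun=> 1%E)); last by move=> w /set_mem; exact: total1.
  by rewrite integral_cst// mul1e.
exists (state_at ws n `\` \big[setU/set0]_(u <- E) next_split ws n (good W n) u setT 0); split => //.
  exact: measurableD.
have PSfin : P (state_at ws n) \is a fin_num by exact: fin_num_measure.
have h : P (\big[setU/set0]_(u <- E) next_split ws n (good W n) u setT 0 `|`
    (state_at ws n `\` \big[setU/set0]_(u <- E) next_split ws n (good W n) u setT 0)) = P (state_at ws n) by rewrite setDUK.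
move: h; rewrite measureU//; last 2 first.
- exact: measurableD.
- by rewrite setDE setICA setICr setI0.
move=> h; set B := state_at ws n `\` _ in h *.
have {}h : (P (state_at ws n) + P B = P (state_at ws n))%E.
  by etransitivity; [|exact: h]; congr (_ + _)%E; exact: esym PUS.
have := congr1 (fun x => x - P (state_at ws n))%E h.
by rewrite subee// addeAC subee// add0e.
Qed.

Lemma state_at0 w : proper w -> (forall e, 0 < Z e w) -> state_at (order_word w) 0 w.
Proof.
move=> pw Zw; split; first by split => // i; rewrite ltn0.
move=> e; rewrite inE => /eqP -> /=; rewrite /death_time /= add0r mulr_gt0// invr_gt0.
rewrite -lte_fin intensityE; apply: hits_gt0 => //; first exact: cellw_compact.
by case: W_window.
Qed.

Lemma proper_intensity_gt0 w e : proper w -> 0 < intensity e w.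
Proof.
move=> pw; rewrite -lte_fin intensityE; apply: hits_gt0 => //; first exact: cellw_compact.
by case: (proper_window (pw (word_code e)) (leqnn _)).
Qed.

Lemma state_atS ws n u w : proper w -> (forall e, 0 < Z e w) -> valid_words ws n ->
  u \in leaves ws n -> ws n = u -> next_split ws n (good W n) u setT 0 w -> state_at ws n.+1 w.
Proof.
move=> pw Zw v un wn [g [h1 _]]; rewrite addr0 => h2; split.
  apply/goodS; split => //.
  - by rewrite /pword /= wn.
  - rewrite /pword /phyp /= wn split_times_leaf//.
    by have [_] := pw (word_code u).+1; apply.
  - by rewrite /pwait /= wn subr_gt0.
move=> e; rewrite /= wn !inE => /orP[/eqP ->|/orP[/eqP ->|]].
- by rewrite {2}/death_time /= ltrDl mulr_gt0// invr_gt0 proper_intensity_gt0.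
- by rewrite {2}/death_time /= ltrDl mulr_gt0// invr_gt0 proper_intensity_gt0.
- have [uL _ _] := leaves_invariant v.
  by rewrite mem_rem_uniq// inE => /andP[eu en]; exact: h1.
Qed.

(** The order is random, but its first [n] places take countably many values, so [next_split_ae] can
    be used for all prescribed orders at once in the induction. *)
Lemma ordered_ae : {ae P, forall w, ordered w}.
Proof.
apply: ae_foralln => n; elim: n => [|n ih].
  by apply: filterS2 proper_ae clocks_positive => w; exact: state_at0.
have h k : {ae P, forall w, forall L : seq word, @choice.pickle_inv (seq word) k = Some L ->
    valid_words (nth [::] L) n -> state_at (nth [::] L) n w ->
    exists2 u, u \in leaves (nth [::] L) n & next_split (nth [::] L) n (good W n) u setT 0 w}.
  case kE : (@choice.pickle_inv (seq word) k) => [L|]; last by apply: aeW.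
  have [v|nv] := pselect (valid_words (nth [::] L) n); last by apply: aeW => w L' [<-].
  have [N [mN N0 sub]] := next_split_ae v.
  exists N; split => // w /= nw; apply: sub; split.
    by apply: contrapT => ns; apply: nw => L' [<-] _ /ns.
  move=> uw; apply: nw => L' [<-] _ _; move: uw; rewrite -bigcup_seq => -[u /= un uw].
  by exists u.
apply: filterS2 (filterI proper_ae clocks_positive) (filterI ih (ae_foralln h)) => w [pw Zw] [st hw].
pose L := split_words n w.
have oL i : (i < n)%N -> order_word w i = nth [::] L i by move=> iN; rewrite nth_split_words.
have stL : state_at (nth [::] L) n w := eq_state_at oL st.
have vL : valid_words (nth [::] L) n by case: stL => -[].
have [u un nu] := hw (choice.pickle L) L (choice.pickleK_inv _) vL stL.
(* The first [n] splits, continued by the word that dies next. *)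
pose ws i := if (i < n)%N then nth [::] L i else u.
have wL i : (i < n)%N -> nth [::] L i = ws i by move=> iN; rewrite /ws iN.
have vw : valid_words ws n.
  move=> i iN; rewrite -wL// -(@eq_leaves (nth [::] L)); first exact: vL.
  by move=> j ji; apply: wL; exact: ltn_trans iN.
have wn : ws n = u by rewrite /ws ltnn.
have uw : u \in leaves ws n by rewrite -(eq_leaves wL).
have nuw : next_split ws n (good W n) u setT 0 w.
  have [g [h1 h2 h3]] := nu; split; first by apply: eq_good_before g; exact: eq_split_times.
  by split => //; [rewrite -(eq_leaves wL)|rewrite -(eq_last_split w wL)].
have stS := state_atS pw Zw vw uw wn nuw.
apply: (eq_state_at _ stS) => i iN.
by rewrite (state_at_order stS).
Qed.

Lemma measurable_split_words n L : measurable [set w | split_words n w = L].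
Proof.
elim: n L => [|n ih] L /=.
  have [h|h] := pselect ([::] = L :> seq word).
    by rewrite (_ : [set _ | _] = setT)//; apply/seteqP; split.
  by rewrite (_ : [set _ | _] = set0)//; apply/seteqP; split.
apply: (@measurable_countable_fiber _ Om _ (split_words n)
  (fun L' => [set w | rcons L' (earliest (leaves (nth [::] L') n) w) = L])) => // L'.
set E := leaves _ _.
have -> : [set w | rcons L' (earliest E w) = L] =
   [set w | [set m | rcons L' (head [::] (mask m E)) = L]
     [seq all (fun f => death_time e w <= death_time f w) E | e <- E]].
  by apply/seteqP; split => w /=; rewrite /earliest filter_mask.
apply: measurable_countable_pred => m.
apply: (measurable_map_bits (b := fun e w => all (fun f => death_time e w <= death_time f w) E)) => e.
have -> : [set w | all (fun f => death_time e w <= death_time f w) E] =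
    \bigcap_(f in [set` E]) ~` [set w | death_time f w < death_time e w].
  apply/seteqP; split => w /=.
    by move/allP => h f fE /=; have := h f fE; rewrite leNgt => /negP.
  move=> h; apply/allP => f fE; rewrite leNgt; apply/negP; exact: h.
apply: fin_bigcap_measurable => [|f _]; first exact: finite_seq.
by apply: measurableC; apply: measurable_lt_fun; exact: measurable_death_time_Om.
Qed.

Lemma measurable_stit_path : measurable_fun setT (stit_path : Om -> @paths R l).
Proof.
apply: (@measurability _ _ Om (@paths R l) _ _ path_gen) => // _ [B [i _ Bi] <-].
have -> : setT `&` stit_path @^-1` B =
    [set w | [set w | B (split_times (nth [::] (split_words i.+1 w)) w)] w].
  have mB : measurable (B : set (@path_before R l i.+1)) by apply: sub_sigma_algebra; exists i => //=.
  have E w j : (j < i.+1)%N -> stit_path w j = split_times (nth [::] (split_words i.+1 w)) w j.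
    by apply: eq_split_times => k ki; rewrite nth_split_words.
  rewrite setTI; apply/seteqP; split => w /=; apply: (path_before_eq mB) => j ji; first exact: E.
  by rewrite E.
apply: (@measurable_countable_fiber _ Om _ (split_words i.+1)
  (fun L => [set w | B (split_times (nth [::] L) w)])); first exact: measurable_split_words.
move=> L; rewrite -[X in measurable X]setTI; apply: (measurable_split_times_Om (nth [::] L)) => //.
by apply: (@measurable_before_path _ _ i.+1); apply: sub_sigma_algebra; exists i => //=.
Qed.

(** Outcomes are sorted by the order of their first [n] splits. On each piece the beginning of the
    path is the one with that prescribed order, and [split_times_kernel] gives the kernel. *)
Lemma stit_chain : exists X : {RV P >-> @paths R l},
  [/\ {ae P, forall w, [/\ X w = stit_path w, proper w, ordered w & forall e, 0 < Z e w]},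
      forall n, distribution P X (good W n) = 1%E &
      split_chain Lam W (distribution P X)].
Proof.
pose X : {RV P >-> @paths R l} := HB.pack stit_path (isMeasurableFun.Build _ _ _ _ _ measurable_stit_path).
have aeX : {ae P, forall w, [/\ X w = stit_path w, proper w, ordered w & forall e, 0 < Z e w]}.
  by apply: filterS3 proper_ae ordered_ae clocks_positive.
have [N [mN N0 subN]] := aeX.
pose D0 := ~` N; have mD0 : measurable D0 by exact: measurableC.
have PD0 : P D0 = 1%E by rewrite probability_setC// N0 sube0.
have okD0 w : D0 w -> [/\ proper w, ordered w & forall e, 0 < Z e w].
  by move=> nN; apply: contrapT => h; apply: nN; apply: subN => -[_ h1 h2 h3]; exact: h.
have mX A : measurable (A : set (@paths R l)) -> measurable (stit_path @^-1` A).
  by move=> mA; rewrite -[X in measurable X]setTI; exact: measurable_stit_path.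
exists X; split => //.
  move=> n; have mg : measurable (good W n : set (@paths R l)).
    by apply: measurable_before_path; exact: measurable_good.
  apply/eqP; rewrite eq_le probability_le1//= -PD0.
  apply: measure_mono => //; first exact: mX.
  by move=> w /okD0[_ ow _]; have [] := ow n.
move=> n D u A s mD Dg mA s0.
have mDP : measurable (D : set (@paths R l)) := measurable_before_path mD.
have mkP : measurable_fun setT (kern Lam W n u A s : @paths R l -> \bar R).
  by apply: (@measurable_fun_gen _ (@paths R l) (events_before n)); [exact: events_before_sub|exact: measurable_kern].
have mcyl : measurable (D `&` cylinder n u A s : set (@paths R l)).
  by apply: (@measurable_before_path _ _ n.+1); exact: measurable_setI_cylinder.
rewrite /distribution ge0_integral_pushforward//; last 2 first.
- exact: measurable_funTS.
- by move=> x _; exact: kern_ge0.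
have mkX : measurable_fun [set: Om] (fun w => kern Lam W n u A s (stit_path w)).
  by apply: (measurableT_comp mkP); exact: measurable_stit_path.
pose SW k : set Om := [set w | choice.pickle (split_words n w) = k].
have mSW k : measurable (SW k).
  by apply: (measurable_countable_pred (fun L => choice.pickle L = k)); exact: measurable_split_words.
have piece k : (P ((stit_path @^-1` (D `&` cylinder n u A s)) `&` SW k) =
    \int[P]_(w in stit_path @^-1` D `&` SW k) kern Lam W n u A s (stit_path w))%E.
  have full (C B : set Om) : measurable C -> measurable B -> C `&` D0 = B `&` D0 -> P C = P B.
    move=> mC mB CB; rewrite -(measure_setI_full mD0 mC PD0) -(measure_setI_full mD0 mB PD0).
    by rewrite CB.
  have mC := measurableI _ _ (mX _ mcyl) (mSW k).
  pose L := odflt [::] (@choice.pickle_inv (seq word) k); pose ws := nth [::] L.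
  have SWE w : SW k w -> split_words n w = L.
    by move=> kE; rewrite /L -kE choice.pickleK_inv.
  have agree w : SW k w -> forall i, (i < n)%N -> order_word w i = ws i.
    by move=> wk i iN; rewrite -(@nth_split_words n i w iN) (SWE w wk).
  have apath w : SW k w -> forall i, (i < n)%N -> stit_path w i = split_times ws w i.
    by move=> wk; exact: eq_split_times (agree w wk).
  have [[v SWL]|nv] := pselect (valid_words ws n /\ SW k = [set w | split_words n w = L]); last first.
    have E0 : stit_path @^-1` D `&` SW k = set0.
      apply/seteqP; split => // w [Dw wk]; apply: nv; split.
        move=> i iN; have [vw _] := Dg _ Dw.
        rewrite -(agree w wk i iN) -(@eq_leaves (order_word w)); first exact: vw.
        by move=> j ji; apply: (agree w wk); exact: ltn_trans iN.
      apply/seteqP; split => w' /=; first exact: SWE.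
      by rewrite /SW /= => ->; rewrite -(SWE w wk).
    rewrite E0 integral_set0 (_ : _ `&` SW k = set0) ?measure0//.
    by apply/seteqP; split => // w [[Dw _] wk]; rewrite -E0.
  have [sL|sL] := eqVneq (size L) n; last first.
    have S0 : SW k = set0.
      by apply/seteqP; split => // w /SWE wL; move: sL; rewrite -wL size_split_words eqxx.
    by rewrite S0 !setI0 measure0 integral_set0.
  (* On ordered outcomes the piece coincides with this event, which refers to the prescribed order
     only. *)
  pose T : set Om := split_times ws @^-1` D `&` [set w | forall e, e \in leaves ws n -> last_split ws n w < death_time e w].
  have mT : measurable T.
    apply: measurableI; last exact: measurable_leaves_later.
    by rewrite -[X in measurable X]setTI; exact: measurable_split_times_Om.
  have TX w : T w -> (stit_path @^-1` D `&` SW k) w.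
    move=> [Dw h]; have st : state_at ws n w by split => //; exact: Dg.
    have [wL xy] := state_at_path st; split.
      by apply: (path_before_eq mD) Dw => i iN; rewrite xy.
    by rewrite SWL /= wL /ws -sL mkseq_nth.
  have XT w : ordered w -> (stit_path @^-1` D `&` SW k) w -> T w.
    move=> ow [Dw wk]; split; first by apply: (path_before_eq mD) Dw; exact: apath.
    by have [_ h] := eq_state_at (agree w wk) (ow n).
  have kE w : SW k w -> kern Lam W n u A s (stit_path w) = kern Lam W n u A s (split_times ws w).
    by move=> wk; apply: eq_kern_before => //; exact: apath.
  have lE w : SW k w -> leaves (order_word w) n = leaves ws n by move=> wk; exact: eq_leaves (agree w wk).
  have [un|un] := boolP (u \in leaves ws n); last first.
    rewrite integral0_eq; last first.
      move=> w [_ wk]; rewrite /kern (_ : pleaves n (stit_path w) = leaves ws n) ?(negPf un)//.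
      exact: lE.
    rewrite (full _ set0)// ?measure0//; apply/seteqP; split => w //; last by move=> [].
    move=> [[[_ [un' _ _]] wk] /okD0[_ ow _]]; exfalso; move/negP: un; apply.
    have [/goodS[_ + _ _] _] := ow n.+1; rewrite -(lE w wk).
    by move: un'; rewrite /pword /= => ->.
  have mB : measurable (next_split ws n D u A s) by exact: measurable_next_split.
  rewrite (full _ (next_split ws n D u A s) mC mB); last first.
    apply/seteqP; split => w [].
      move=> [[Dw [wu Aw sw]] wk] /[dup] Nw /okD0[_ ow _]; split => //.
      have wu' : order_word w n = u by [].
      split; first by apply: (path_before_eq mD) Dw; exact: apath.
      have [_ later] := ow n.+1; have [[vn _] _] := ow n; split.
      - move=> e en eu; rewrite -wu'; apply: later => /=; rewrite wu' !inE.
        have [uL _ _] := leaves_invariant vn.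
        by rewrite mem_rem_uniq// inE eu lE// en !orbT.
      - by move: Aw; rewrite /phyp /= wu'.
      - move: sw; rewrite /pwait /= wu' ltrBrDl.
        by rewrite (@eq_last_split (order_word w) ws)//; exact: agree.
    move=> [Dw [h1 h2 h3]] Nw; split => //.
    have Tw : T w.
      split => // e en; have h0 : last_split ws n w < death_time u w.
        by apply: le_lt_trans h3; rewrite lerDl.
      by have [->//|eu] := eqVneq e u; apply: (lt_trans h0); exact: h1.
    have [DX wk] := TX w Tw; split => //; split => //.
    have wu : order_word w n = u.
      rewrite order_wordE lE//; apply: earliestE => //.
      by have [] := leaves_invariant v.
    split => //; first by rewrite /phyp /= wu.
    rewrite /pwait /= wu ltrBrDl (@eq_last_split (order_word w) ws)//; exact: agree.
  have mkS : measurable_fun [set: Om] (fun w => kern Lam W n u A s (split_times ws w)).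
    by apply: (measurableT_comp mkP); exact: measurable_split_times_Om.
  rewrite (split_times_kernel v mD Dg un mA s0) -/T.
  rewrite (integral_setI_full mD0 PD0 mT); last 2 first.
  - exact: measurable_funTS.
  - by move=> w _; exact: kern_ge0.
  have mS : measurable (stit_path @^-1` D `&` SW k) by apply: measurableI => //; exact: mX.
  apply: (etrans _ (esym (integral_setI_full mD0 PD0 mS (measurable_funTS mkX) (fun w _ => kern_ge0 _ _ _ _ _ _ _)))).
  have -> : (stit_path @^-1` D `&` SW k) `&` D0 = T `&` D0.
    apply/seteqP; split => w [h Nw]; split => //; last exact: TX.
    by apply: XT => //; have [] := okD0 w Nw.
  by apply: eq_integral => w /set_mem[Tw _]; rewrite kE//; have [] := TX w Tw.
transitivity (P (stit_path @^-1` (D `&` cylinder n u A s))); first by [].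
rewrite (measure_pickle P (mX _ mcyl) (@measurable_split_words n)).
have DE : stit_path @^-1` D = \bigcup_k (stit_path @^-1` D `&` SW k).
  apply/seteqP; split => w; last by move=> [k _ []].
  by move=> Dw; exists (choice.pickle (split_words n w)).
transitivity (\int[P]_(w in \bigcup_k (stit_path @^-1` D `&` SW k)) kern Lam W n u A s (stit_path w))%E; last first.
  by rewrite -DE.
rewrite ge0_integral_bigcup//; last 4 first.
- by move=> k; apply: measurableI => //; exact: mX.
- exact: measurable_funTS.
- by move=> w _; exact: kern_ge0.
- by move=> i j _ _ [w [[_ <-] [_ <-]]].
by apply: eq_eseriesr => k _; exact: piece.
Qed.

(** * Identification with the STIT process on regular outcomes *)

Definition hit_index e w : nat := odflt 0%N (stg (word_code e).+1 w).1.

Section regular_outcome.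
Variable w : Om.
Hypotheses (pw : proper w) (ow : ordered w) (Zw : forall e, 0 < Z e w) (Gw : hits W (G 1%N w)).

Local Notation g := (fun k => G k w).
Local Notation k := (hit_index ^~ w).

Lemma hit_indexE e : (stg (word_code e).+1 w).1 = Some (k e).
Proof. by have [[m mE] _] := pw (word_code e).+1; move: (mE); rewrite /hit_index mE. Qed.

Lemma hyp_hit_index e : hyp e w = G (k e) w.
Proof. exact: stit_hyp_some (hit_indexE e). Qed.

Lemma hit_index_nil : k [::] = 1%N.
Proof.
have [m [<-] fh] := (stage_some W g 0 (k [::])).1 (hit_indexE [::]).
have n0 : nth_word 0 = [::] by rewrite -[0%N]/(word_code [::]) word_codeK.
have f1 : first_hit g 0 W 1 by split => // -[].
by rewrite n0 in fh; apply: first_hit_uniq fh f1.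
Qed.

Lemma hit_index_first e f : word_code e = (word_code f).+1 -> first_hit g (k f) (cellw e w) (k e).
Proof.
move=> ef; have [m mE fh] := (stage_some W g (word_code e) (k e)).1 (hit_indexE e).
move: mE fh; rewrite {1}ef => mE; rewrite word_codeK.
by have := hit_indexE f; rewrite /stg mE => -[->].
Qed.

Lemma hit_index_mono e f : word_lt f e -> (k f < k e)%N.
Proof.
rewrite word_ltE; move eE : (word_code e) => i.
elim: i e f eE => // i ih e f eE; rewrite ltnS => fi.
have eS : word_code e = (word_code (nth_word i)).+1 by rewrite nth_wordK.
have [lt _ _] := hit_index_first eS.
move: fi; rewrite leq_eqVlt => /orP[/eqP fi|fi]; first by rewrite -fi word_codeK in lt.
by apply: ltn_trans lt; apply: ih fi; rewrite nth_wordK.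
Qed.

Lemma stit_cell_ofE (k' : word -> nat) e : stit_cell_of W g k' e = tree_cell W (fun f => G (k' f) w) e.
Proof. by elim: e => //= b e ->. Qed.

Lemma stit_cell_of_hit_index e : stit_cell_of W g k e = cellw e w.
Proof. by rewrite stit_cell_ofE; apply: eq_tree_cell => f _; rewrite hyp_hit_index. Qed.

Lemma is_stit_index_hit_index : is_stit_index W g k.
Proof.
split; first exact: hit_index_nil.
move=> e e0; have [i iE] : exists i, word_code e = i.+1 by case: e e0 => //= b e _; eexists.
have eS : word_code e = (word_code (nth_word i)).+1 by rewrite nth_wordK.
have [lt hke nh] := hit_index_first eS.
rewrite /= stit_cell_of_hit_index; split; first by split => // f; exact: hit_index_mono.
move=> n [hn hlt]; rewrite leqNgt; apply/negP => nk; apply: (nh n) hn.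
by rewrite nk andbT; apply: hlt; rewrite word_ltE eS.
Qed.

(** Uniqueness by induction along the order of words: the cell of a word and the lower bound on its
    index involve the indices of earlier words only. *)
Lemma stit_indexE : stit_index W g = k.
Proof.
rewrite /stit_index; case: xgetP => [k' _ [k'0 k'S]|]; last by move=> /(_ k) []; exact: is_stit_index_hit_index.
have [k0 kS] := is_stit_index_hit_index.
suff h i e : word_code e = i -> k' e = k e by apply/funext => e; exact: (h (word_code e)).
elim/ltn_ind: i e => i ih e eE; have [->|e0] := eqVneq e [::]; first by rewrite k'0 k0.
have k'k f : word_lt f e -> k' f = k f by rewrite word_ltE eE => fi; exact: (ih (word_code f)).
have cE : stit_cell_of W g k' e = stit_cell_of W g k e.
  rewrite !stit_cell_ofE; apply: eq_tree_cell => f /ancestor_word_code fe.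
  by rewrite k'k// word_ltE.
have [[h1 l1] m1] := k'S e e0; have [[h2 l2] m2] := kS e e0.
apply/eqP; rewrite eqn_leq; apply/andP; split.
  by apply: m1; rewrite cE; split => // f fe; rewrite k'k//; exact: l2.
by apply: m2; rewrite -cE; split => // f fe; rewrite -k'k//; exact: l1.
Qed.

Lemma stit_cellE e : stit_cell W g e = cellw e w.
Proof. by rewrite /stit_cell stit_indexE stit_cell_of_hit_index. Qed.

Lemma lifetimeE e : lifetime Lam W (fun e => Z e w) g e = (intensity e w)^-1 * Z e w.
Proof. by rewrite /lifetime stit_cellE. Qed.

Lemma birthE e : birth Lam W (fun e => Z e w) g e = birth_time e w.
Proof. by elim: e => //= b e ->; rewrite lifetimeE. Qed.

Lemma lifetime_gt0 e : 0 < (intensity e w)^-1 * Z e w.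
Proof. by rewrite mulr_gt0// invr_gt0 proper_intensity_gt0. Qed.

Lemma birth_time_ge0 e : 0 <= birth_time e w.
Proof. by elim: e => //= b e ih; rewrite addr_ge0// ltW// lifetime_gt0. Qed.

Lemma ancestor_death e f : f \in ancestors e -> death_time f w <= birth_time e w.
Proof.
elim: e => //= b e ih; rewrite inE -/(death_time e w) => /orP[/eqP -> //|/ih h].
by apply: (le_trans h); rewrite /death_time lerDl ltW// lifetime_gt0.
Qed.

(** At time [t] the split words are dead and the proper descendants of leaves are not yet born; by
    [leaves_trichotomy] only the leaves remain. *)
Lemma alive_leaves n t : last_split (order_word w) n w <= t < last_split (order_word w) n.+1 w ->
  [set e | birth_time e w <= t < death_time e w] = [set` leaves (order_word w) n].
Proof.
move=> /andP[nt tn]; have [g0 later] := ow n.+1; have /goodS[gn _ _ _] := g0.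
have v : valid_words (order_word w) n by case: gn.
have [uL _ _] := leaves_invariant v.
have death e : e \in leaves (order_word w) n -> t < death_time e w.
  move=> en; apply: (lt_le_trans tn); have [->//|ew] := eqVneq e (order_word w n).
  by apply/ltW/later; rewrite /= !inE mem_rem_uniq// inE ew en !orbT.
apply/seteqP; split => e /=; last first.
  move=> en; rewrite death// andbT; apply: le_trans nt; exact: birth_before_last.
have [//|[i iN ->]|[f fe fn]] := leaves_trichotomy e v => /andP[bt td]; exfalso.
  move: td; rewrite ltNge => /negP; apply; apply: le_trans nt.
  rewrite -[X in X <= _]/(last_split (order_word w) i.+1 w).
  by move: iN; rewrite leq_eqVlt => /orP[/eqP -> //|iN]; exact/ltW/last_split_lt.
have := lt_le_trans (death _ fn) (ancestor_death fe).
by rewrite ltNge bt.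
Qed.

Lemma stit_path_process : good_path W (stit_path w) ->
  (fun t => stit Lam W (fun e => Z e w) g t) = path_process W (stit_path w).
Proof.
move=> gp; apply/funext => t.
have -> : stit Lam W (fun e => Z e w) g t = [set cellw e w | e in [set e | birth_time e w <= t < death_time e w]].
  apply/seteqP; split => C [e /= te <-]; exists e; rewrite ?stit_cellE//=.
    by move: te; rewrite birthE lifetimeE.
  by rewrite birthE lifetimeE.
(* At negative times both sides are empty. *)
have [t0|t0] := leP 0 t; last first.
  apply/seteqP; split => C.
    by move=> [e /= /andP[h _] _]; have := lt_le_trans t0 (birth_time_ge0 e); rewrite ltNge h.
  move=> [n /= /andP[h _] _]; exfalso; move: h; apply/negP; rewrite -ltNge; apply: (lt_le_trans t0).
  rewrite /stit_path ptime_split_times; case: n => // n.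
  by rewrite ltW// -[X in X < _]/(last_split (order_word w) 0 w) last_split_lt//; have [] := ow n.+1.
have [n tn ->] := good_path_process gp t0.
rewrite (@alive_leaves n t); last by move: tn; rewrite /stit_path !ptime_split_times.
have [[v _] _] := ow n.
by apply/seteqP; split => C [e /= en <-]; exists e => //; rewrite /stit_path split_times_leaf.
Qed.

End regular_outcome.

(** The identification is conditional on a good path: unbounded split times are obtained for this
    process only from the equality of laws. *)
Lemma stit_process_chain : exists X : {RV P >-> @paths R l},
  [/\ {ae P, forall w, good_path W (X w) ->
        (fun t => stit Lam W (fun e => Z e w) (fun k => G k w) t) = path_process W (X w)},
      forall n, distribution P X (good W n) = 1%E &
      split_chain Lam W (distribution P X)].
Proof.
have [X [aeX gX cX]] := stit_chain; exists X; split => //.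
have G1 : {ae P, forall w, hits W (G 1%N w)}.
  exists (G 1%N @^-1` ~` hits W); split => //.
    by rewrite -[X in measurable X]setTI; apply: measurable_funP => //; exact: measurableC.
  apply: (etrans (G_law 0 (measurableC mhW))).
  by rewrite /normalize /Lam_on setICl measure0 mule0.
by apply: filterS2 aeX G1 => w [-> pw ow Zw] Gw; exact: stit_path_process.
Qed.

End stit_side.

Theorem theorem9p1 (R : realType) (l : nat)
  (Lam : {measure set (hyperplane R l) -> \bar R})
  (Lam_neq0 : Lam setT <> 0%E)
  (Lam_inv : translation_invariant Lam)
  (Lam_fin : locally_finite Lam)
  (Lam_dir : no_common_parallel_line Lam)
  (W : set 'rV[R]_l.+1) (W_window : window W)
  (* the driving sequences; only the indices n >= 1 are used *)
  (d : measure_display) (Om : measurableType d) (P : probability Om R)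
  (U V : nat -> {RV P >-> R}) (G : nat -> {RV P >-> hyperplane R l})
  (U_law : forall n, has_law (U n.+1) (uniform_prob (@ltr01 R)))
  (V_law : forall n, has_law (V n.+1) (exponential_prob (1 : R)))
  (G_law : forall n, has_law (G n.+1) (normalize (Lam_on Lam W)))
  (UVG_indep : mutually_independent P (UVG_events U V G))
  (* the maps Xi_n, functions of the measure Gamma_n *)
  (Xi : nat -> (set (hyperplane R l) -> \bar R) ->
        hyperplane R l -> hyperplane R l)
  (Xi_id : forall h, hits W h -> Xi 0%N (Gam Lam [set W]) h = h)
  (Xi_transports : {ae P, forall w, forall n,
     let Y := split_tess Lam W Xi (fun k => U k w) (fun k => G k w) n in
     transports Lam W (Gam Lam Y) (Xi n (Gam Lam Y))})
  (Xi_measurable : forall n,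
     measurable_fun ([set T : tess_space W | tessellation W T] `*` hits W)
       (fun p : tess_space W * hyperplane R l => Xi n (Gam Lam p.1) p.2))
  (* the random variables defining the STIT process *)
  (d' : measure_display) (Om' : measurableType d') (P' : probability Om' R)
  (Z : word -> {RV P' >-> R}) (G' : nat -> {RV P' >-> hyperplane R l})
  (Z_law : forall e, has_law (Z e) (exponential_prob (1 : R)))
  (G'_law : forall n, has_law (G' n.+1) (normalize (Lam_on Lam W)))
  (ZG'_indep : mutually_independent P' (ZG_events Z G')) :
  same_law W
    P (fun t w => split_process Lam W Xi (fun k => U k w) (fun k => V k w)
                    (fun k => G k w) t)
    P' (fun t w => stit Lam W (fun e => Z e w) (fun k => G' k w) t).
Proof.
have [X [aeX gX cX]] := split_process_chain Lam_neq0 Lam_inv Lam_fin W_window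
  Xi_measurable U_law V_law G_law UVG_indep Xi_transports.
have [X' [aeX' gX' cX']] := stit_process_chain Lam_neq0 Lam_inv Lam_fin W_window Z_law G'_law ZG'_indep.
have XX' (A : set (@paths R l)) : measurable A -> P (X @^-1` A) = P' (X' @^-1` A).
  move=> mA; have := @split_chain_unique _ _ _ Lam_fin _ W_window (distribution P X) (distribution P' X')
    (fun n => conj (gX n) (gX' n)) (conj cX cX') A mA.
  by rewrite /distribution /pushforward.
have mgp := @measurable_good_path R l W W_window.
have mX' : measurable (X' @^-1` good_path W) by rewrite -[X in measurable X]setTI; exact: measurable_funP.
have mX : measurable (X @^-1` good_path W) by rewrite -[X in measurable X]setTI; exact: measurable_funP.
(* For the global construction good paths have probability 1, which includes non-explosion. *)
have PX : P (X @^-1` good_path W) = 1%E.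
  have [N [mN N0 sub]] := aeX; apply/eqP; rewrite eq_le probability_le1//=.
  have <- : P (~` N) = 1%E by rewrite probability_setC// N0 sube0.
  apply: measure_mono => //; first exact: measurableC.
  by move=> w nN; apply: contrapT => h; apply: nN; apply: sub => -[].
(* Goodness is a measurable property of the path, so the equality of laws carries it over to the
   STIT process. *)
have gpX' : {ae P', forall w, good_path W (X' w)}.
  exists (~` (X' @^-1` good_path W)); split => //; first exact: measurableC.
  by rewrite probability_setC// -XX'// PX subee.
apply: (same_law_paths W_window aeX _ XX').
by apply: filterS2 aeX' gpX' => w h gw; split => //; exact: h.
Qed.
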